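(* Let $T$ be a complete first-order theory with infinite models and monster model $\mathcal{U}$. If $T$ is NIP and $m>0$, then the following are equivalent: (i) $T$ is $m$-distal. (ii) For all $n>m$ and all invariant types $p_0(x_0),\ldots,p_{n-1}(x_{n-1})\in S_U$ which commute pairwise, the product $p_0\otimes\cdots\otimes p_{n-1}$ is $m$-determined. (iii) For all invariant types $p_0(x_0),\ldots,p_m(x_m)\in S_U$ which commute pairwise, the product $p_0\otimes\cdots\otimes p_m$ is $m$-determined.
   Context: Conventions. $T$ is a complete first-order theory in a language $L$ with infinite models, and $\mathcal{U}\models T$, with universe $U$, is a monster model: universal and strongly $\hat\kappa$-homogeneous for a sufficiently large cardinal $\hat\kappa$. ''Small'' means of cardinality $<\hat\kappa$. Variables and parameters may be tuples (finite or infinite, small); all sequences of parameters are small. ''NIP'' means that no formula has the independence property. EM-types. A sequence $\mathcal{I}=(b_i:i\in I)$ of tuples of the same size, indexed by an infinite linear order, satisfies $\mathcal I\models^{\mathrm{EM}}\phi(x_0,\dots,x_{n-1})$ if $\mathcal{U}\models\phi(b_{i_0},\dots,b_{i_{n-1}})$ for all $i_0<\cdots<i_{n-1}$ in $I$. The EM-type of $\mathcal I$ (over $\varnothing$) is the set of all $L$-formulas $\phi$ in variables $(x_k:k<\omega)$ with $\mathcal I\models^{\mathrm{EM}}\phi$; $\mathcal I$ is indiscernible iff this EM-type is complete. A complete EM-type is the EM-type of some infinite indiscernible sequence. Dedekind partitions. A partition $I=I_0+\cdots+I_n$ of a linear order into nonempty convex sets $I_0<\cdots<I_n$ is Dedekind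 if for each $i<n$ the set $I_0\cup\cdots\cup I_i$ has no maximum and $I_{i+1}\cup\cdots\cup I_n$ has no minimum; the $i$-th cut is $\mathfrak c_i=(I_0\cup\cdots\cup I_i,\ I_{i+1}\cup\cdots\cup I_n)$. For an indiscernible sequence $\mathcal I$ indexed by $I$, write $\mathcal I=\mathcal I_0+\cdots+\mathcal I_n$ for the corresponding partition. Given $A=(a_0,\dots,a_{n-1})$ of tuples of the same size as those in $\mathcal I$, a subsequence $A'\subseteq A$ inserts into $\mathcal I_0+\cdots+\mathcal I_n$ if the sequence obtained by inserting each $a_i\in A'$ at the cut $\mathfrak c_i$ is indiscernible. $m$-distality. For $n>m>0$, the Dedekind partition $\mathcal I_0+\cdots+\mathcal I_n$ of an indiscernible sequence is $m$-distal if every sequence $A=(a_0,\dots,a_{n-1})$ which does not insert contains an $m$-element subsequence which does not insert. A complete EM-type $\Gamma$ is $m$-distal if every Dedekind partition $\mathcal I_0+\cdots+\mathcal I_{m+1}$ of an indiscernible sequence with EM-type $\Gamma$ is $m$-distal. $T$ is $m$-distal if every complete EM-type, in every tuple size, is $m$-distal. Invariant types and products. $S_U(x)$ is the set of complete types over $U$ in $x$. A global type $p(x)\in S_U$ is invariant over a small $A\subseteq U$ if for all $\phi(x,d)\in p$ and all $d'\equiv_A d$ in $U$, $\phi(x,d')\in p$; it is invariant if it is invariant over some small set. For $p(x),q(y)\in S_U$ with $q$ invariant over a small set $A$, the product $p\otimes q\in S_U(x,y)$ is given by: $\phi(x,y,d)\in p\otimes q$ iff for all $a\in U$ realizing $p\restriction_{Ad}$,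 $\phi(a,y,d)\in q$. This operation is associative. Two invariant types commute if $p(x)\otimes q(y)=q(y)\otimes p(x)$. Determinacy. For $n>m>0$ and $C\subseteq U$ (possibly $C=U$), a type $p\in S_C(x_0,\dots,x_{n-1})$ is $m$-determined if it is completely determined by its restrictions to $m$ of the variables, i.e. $p$ is the only type in $S_C(x_0,\dots,x_{n-1})$ containing every $q\in S_C(x_{i_0},\dots,x_{i_{m-1}})$ with $i_0<\cdots<i_{m-1}<n$ and $q\subseteq p$. *)

(* Defs.v *)
From mathcomp Require Import all_boot.
From mathcomp Require Import boolp classical_sets functions cardinality.

Set Implicit Arguments.
Unset Strict Implicit.
Unset Printing Implicit Defensive.

Local Open Scope classical_set_scope.
Local Open Scope card_scope.

(** * First-order logic *)

Record language := Language {
  fsym : Type;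
  rsym : Type;
  farity : fsym -> nat;
  rarity : rsym -> nat }.

Inductive term (L : language) (V : Type) : Type :=
| Var of V
| Fun (f : fsym L) of 'I_(farity f) -> term L V.

(* The bound variable of [All] is [None]; a formula in [formula L V] has all
   its free variables in [V], which may be an arbitrary type.  Formulas with
   parameters from a structure [M] are elements of [formula L (V + M)], where
   the parameters are the variables [inr u], always interpreted by [u]. *)
Inductive formula (L : language) (V : Type) : Type :=
| Falsum
| Eq of term L V & term L V
| Rel (r : rsym L) of 'I_(rarity r) -> term L V
| Imp of formula L V & formula L V
| All of formula L (option V).

Arguments Falsum {L V}.

Definition Neg (L : language) (V : Type) (phi : formula L V) : formula L V :=
  Imp phi Falsum.

Definition sentence (L : language) := formula L void.

Fixpoint tmap (L : language) (V W : Type) (h : V -> W) (t : term L V) :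
    term L W :=
  match t with
  | Var v => Var L (h v)
  | Fun f ts => Fun (fun i => tmap h (ts i))
  end.

Fixpoint fmap (L : language) (V W : Type) (h : V -> W) (phi : formula L V) :
    formula L W :=
  match phi with
  | Falsum => Falsum
  | Eq t u => Eq (tmap h t) (tmap h u)
  | Rel r ts => Rel (fun i => tmap h (ts i))
  | Imp phi1 phi2 => Imp (fmap h phi1) (fmap h phi2)
  | All phi1 => All (fmap (omap h) phi1)
  end.

Fixpoint tfv (L : language) (V : Type) (t : term L V) : set V :=
  match t with
  | Var v => [set v]
  | Fun f ts => [set v | exists i, tfv (ts i) v]
  end.

Fixpoint fv (L : language) (V : Type) (phi : formula L V) : set V :=
  match phi with
  | Falsum => set0
  | Eq t u => tfv t `|` tfv u
  | Rel r ts => [set v | exists i, tfv (ts i) v]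
  | Imp phi1 phi2 => fv phi1 `|` fv phi2
  | All phi1 => [set v | fv phi1 (Some v)]
  end.

Record structure (L : language) := Structure {
  carrier :> Type;
  carrier_inhabited : inhabited carrier;
  fint : forall f : fsym L, ('I_(farity f) -> carrier) -> carrier;
  rint : forall r : rsym L, ('I_(rarity r) -> carrier) -> Prop }.

Fixpoint teval (L : language) (M : structure L) (V : Type) (e : V -> M)
    (t : term L V) : M :=
  match t with
  | Var v => e v
  | Fun f ts => fint (fun i => teval e (ts i))
  end.

Fixpoint sat (L : language) (M : structure L) (V : Type) (e : V -> M)
    (phi : formula L V) : Prop :=
  match phi with
  | Falsum => False
  | Eq t u => teval e t = teval e u
  | Rel r ts => rint (fun i => teval e (ts i))
  | Imp phi1 phi2 => sat e phi1 -> sat e phi2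
  | All phi1 => forall x : M, sat (fun o => if o is Some v then e v else x) phi1
  end.

Definition holds (L : language) (M : structure L) (s : sentence L) : Prop :=
  sat (fun v : void => match v with end : M) s.

Definition models (L : language) (M : structure L) (T : set (sentence L)) :
    Prop :=
  forall s, T s -> holds M s.

Definition entails (L : language) (T : set (sentence L)) (s : sentence L) :
    Prop :=
  forall M : structure L, models M T -> holds M s.

Definition complete_theory (L : language) (T : set (sentence L)) : Prop :=
  (exists M : structure L, models M T) /\
  (forall s, entails T s \/ entails T (Neg s)).

Definition has_infinite_model (L : language) (T : set (sentence L)) : Prop :=
  exists M : structure L, models M T /\ infinite_set [set: M].

Definition elementary_embedding (L : language) (M N : structure L)
    (h : M -> N) : Prop :=
  forall (phi : formula L nat) (e : nat -> M), sat e phi <-> sat (h \o e) phi.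

Definition automorphism (L : language) (M : structure L) (s : M -> M) : Prop :=
  [/\ bijective s,
      (forall (f : fsym L) (x : 'I_(farity f) -> M),
        s (fint x) = fint (s \o x)) &
      (forall (r : rsym L) (x : 'I_(rarity r) -> M),
        rint x <-> rint (s \o x))].

(** * Monster models *)

(* A cardinal is given by a type [K] of that cardinality: [A] is small when
   its cardinality is less than that of [K]. *)
Definition small (K T : Type) (A : set T) : Prop := ~~ ([set: K] #<= A).

Definition universal (K : Type) (L : language) (T : set (sentence L))
    (U : structure L) : Prop :=
  forall M : structure L, models M T -> small K [set: M] ->
  exists h : M -> U, elementary_embedding h.

(* [f] matters only on [A]: it is a partial elementary map with domain [A]. *)
Definition strongly_homogeneous (K : Type) (L : language) (U : structure L) :
    Prop :=
  forall (A : set U) (f : U -> U), small K A ->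
  (forall phi : formula L U, fv phi `<=` A -> sat id phi <-> sat f phi) ->
  exists s : U -> U, automorphism s /\ {in A, s =1 f}.

(* [formula L nat] has cardinality |L| + aleph_0. *)
Definition monster (K : Type) (L : language) (T : set (sentence L))
    (U : structure L) : Prop :=
  [/\ models U T, small K [set: formula L nat], universal K T U &
      strongly_homogeneous K U].

Definition has_IP (L : language) (U : structure L) (k l : nat)
    (phi : formula L ('I_k + 'I_l)) : Prop :=
  exists (a : nat -> 'I_k -> U) (b : set nat -> 'I_l -> U),
  forall (i : nat) (S : set nat),
    sat (fun z => match z with inl j => a i j | inr j => b S j end) phi <-> S i.

Definition NIP (L : language) (U : structure L) : Prop :=
  forall (k l : nat) (phi : formula L ('I_k + 'I_l)), ~ has_IP U phi.

(** * EM-types and m-distality *)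

Definition linear_order (I : Type) (le : rel I) : Prop :=
  [/\ antisymmetric le, transitive le & total le].

(* A tuple of size [X] is a function [X -> U]. *)
Definition EM_sat (L : language) (U : structure L) (X I : Type) (le : rel I)
    (b : I -> X -> U) (n : nat) (phi : formula L ('I_n * X)) : Prop :=
  forall i : 'I_n -> I,
    (forall j k : 'I_n, (j < k)%N -> ~~ le (i k) (i j)) ->
    sat (fun v => b (i v.1) v.2) phi.

(* The formulas are sorted by the initial segment x_0, ..., x_(n-1) of the
   variables (x_k : k < omega) in which they are displayed. *)
Definition EM_type (L : language) (U : structure L) (X I : Type) (le : rel I)
    (b : I -> X -> U) : forall n, set (formula L ('I_n * X)) :=
  fun n => [set phi | EM_sat le b phi].

Definition indiscernible (L : language) (U : structure L) (X I : Type)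
    (le : rel I) (b : I -> X -> U) : Prop :=
  forall (n : nat) (phi : formula L ('I_n * X)),
    EM_type le b phi \/ EM_type le b (Neg phi).

Definition indiscernible_sequence (K : Type) (L : language) (U : structure L)
    (X I : Type) (le : rel I) (b : I -> X -> U) : Prop :=
  [/\ linear_order le, infinite_set [set: I], small K [set: I] &
      indiscernible le b].

Definition complete_EM_type (K : Type) (L : language) (U : structure L)
    (X : Type) (G : forall n, set (formula L ('I_n * X))) : Prop :=
  exists (I : Type) (le : rel I) (b : I -> X -> U),
    indiscernible_sequence K le b /\ G = EM_type le b.

(* A partition I_0 + ... + I_n is given by the map [P] sending an element of
   [I] to the index of its block; the i-th cut separates [P x <= i] from
   [i < P x]. *)
Definition Dedekind (I : Type) (le : rel I) (n : nat) (P : I -> 'I_n.+1) :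
    Prop :=
  [/\ (forall i : 'I_n.+1, exists x, P x = i),
      (forall x y, le x y -> (P x <= P y)%N),
      (forall (i : 'I_n) (x : I), (P x <= i)%N ->
        exists y, (P y <= i)%N /\ ~~ le y x) &
      (forall (i : 'I_n) (x : I), (i < P x)%N ->
        exists y, (i < P y)%N /\ ~~ le x y)].

Definition insertion_le (I : Type) (le : rel I) (n : nat) (P : I -> 'I_n.+1)
    (S : {set 'I_n}) : rel (I + {i : 'I_n | i \in S}) :=
  fun u v => match u, v with
  | inl x, inl y => le x y
  | inl x, inr i => (P x <= sval i)%N
  | inr i, inl x => (sval i < P x)%N
  | inr i, inr j => (sval i <= sval j)%N
  end.

Definition insertion (I W : Type) (b : I -> W) (n : nat) (a : 'I_n -> W)
    (S : {set 'I_n}) (u : I + {i : 'I_n | i \in S}) : W :=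
  match u with inl x => b x | inr i => a (sval i) end.

Definition inserts (L : language) (U : structure L) (X I : Type) (le : rel I)
    (b : I -> X -> U) (n : nat) (P : I -> 'I_n.+1) (a : 'I_n -> X -> U)
    (S : {set 'I_n}) : Prop :=
  indiscernible (@insertion_le I le n P S) (@insertion I (X -> U) b n a S).

Definition m_distal_partition (m : nat) (L : language) (U : structure L)
    (X I : Type) (le : rel I) (b : I -> X -> U) (n : nat) (P : I -> 'I_n.+1) :
    Prop :=
  forall a : 'I_n -> X -> U, ~ inserts le b P a [set: 'I_n] ->
  exists S : {set 'I_n}, #|S| = m /\ ~ inserts le b P a S.

Definition m_distal_EM_type (m : nat) (K : Type) (L : language)
    (U : structure L) (X : Type) (G : forall n, set (formula L ('I_n * X))) :
    Prop :=
  forall (I : Type) (le : rel I) (b : I -> X -> U) (P : I -> 'I_m.+2),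
    indiscernible_sequence K le b -> EM_type le b = G -> Dedekind le P ->
    m_distal_partition m le b P.

Definition m_distal (m : nat) (K : Type) (L : language) (U : structure L) :
    Prop :=
  forall (X : Type) (G : forall n, set (formula L ('I_n * X))),
    small K [set: X] -> complete_EM_type K U G -> m_distal_EM_type m K U G.

(** * Types over sets of parameters *)

Definition vars (L : language) (V W : Type) (phi : formula L (V + W)) : set V :=
  [set v | fv phi (inl v)].

Definition params (L : language) (V W : Type) (phi : formula L (V + W)) :
    set W :=
  [set u | fv phi (inr u)].

Definition with_params (V W : Type) (a : V -> W) (z : V + W) : W :=
  match z with inl v => a v | inr u => u end.

(* [Stype D C] is the set S_C(x) of complete types over [C] in the tuple [x]
   of the variables belonging to [D]. *)
Definition Stype (L : language) (U : structure L) (V : Type) (D : set V)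
    (C : set U) : set (set (formula L (V + U))) :=
  [set p |
    [/\ (forall phi, p phi -> vars phi `<=` D /\ params phi `<=` C),
        (forall phi, vars phi `<=` D -> params phi `<=` C ->
          p phi \/ p (Neg phi)) &
        (forall F : set (formula L (V + U)), finite_set F -> F `<=` p ->
          exists a : V -> U, forall phi, F phi -> sat (with_params a) phi)]].

(* d and d' have the same type over A *)
Definition equiv_over (L : language) (U : structure L) (A : set U) (k : nat)
    (d d' : 'I_k -> U) : Prop :=
  forall phi : formula L ('I_k + U), params phi `<=` A ->
    sat (with_params d) phi <-> sat (with_params d') phi.

Definition plug (V W : Type) (k : nat) (d : 'I_k -> W) (z : V + 'I_k) : V + W :=
  match z with inl v => inl v | inr j => inr (d j) end.

Definition invariant_over (L : language) (U : structure L) (V : Type)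
    (A : set U) (p : set (formula L (V + U))) : Prop :=
  forall (k : nat) (phi : formula L (V + 'I_k)) (d d' : 'I_k -> U),
    equiv_over A d d' -> p (fmap (plug d) phi) -> p (fmap (plug d') phi).

Definition invariant (K : Type) (L : language) (U : structure L) (V : Type)
    (p : set (formula L (V + U))) : Prop :=
  exists A : set U, small K A /\ invariant_over A p.

(* a realizes the restriction of p to B *)
Definition realizes_over (L : language) (U : structure L) (V : Type)
    (p : set (formula L (V + U))) (B : set U) (a : V -> U) : Prop :=
  forall phi, p phi -> params phi `<=` B -> sat (with_params a) phi.

(* substitutes the parameters [a v] for the variables [v] in [D] *)
Definition instantiate (V W : Type) (D : set V) (a : V -> W) (z : V + W) :
    V + W :=
  match z with
  | inl v => if v \in D then inr (a v) else inl v
  | inr u => inr u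
  end.

(* The product of p(x) and q(y), where [D] is the set of variables of [x]; it
   does not depend on the choice of [A]. *)
Definition product (K : Type) (L : language) (U : structure L) (V : Type)
    (D : set V) (p q : set (formula L (V + U))) : set (formula L (V + U)) :=
  [set phi | exists A : set U, [/\ small K A, invariant_over A q &
    forall a : V -> U, realizes_over p (A `|` params phi) a ->
      q (fmap (instantiate D a) phi)]].

Definition commute (K : Type) (L : language) (U : structure L) (V : Type)
    (D E : set V) (p q : set (formula L (V + U))) : Prop :=
  product K D p q = product K E q p.

(* The only element of S_U in the empty tuple of variables, which is the
   neutral element of the product. *)
Definition trivial_type (L : language) (U : structure L) (V : Type) :
    set (formula L (V + U)) :=
  [set phi | vars phi = set0 /\
    exists a : V -> U, sat (with_params a) phi].

(* p_0 * (p_1 * (... * (p_(n-1) * trivial_type))) *)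
Definition iterated_product (K : Type) (L : language) (U : structure L)
    (V : Type) (n : nat) (D : 'I_n -> set V)
    (p : 'I_n -> set (formula L (V + U))) : set (formula L (V + U)) :=
  foldr (fun i q => product K (D i) (p i) q) (@trivial_type L U V) (enum 'I_n).

Definition m_determined (m : nat) (L : language) (U : structure L) (V : Type)
    (n : nat) (D : 'I_n -> set V) (C : set U) (p : set (formula L (V + U))) :
    Prop :=
  forall p', Stype (\bigcup_i D i) C p' ->
    (forall S : {set 'I_n}, #|S| = m ->
      forall q, Stype (\bigcup_(i in [set` S]) D i) C q ->
        q `<=` p -> q `<=` p') ->
    p' = p.

(* The types p_i(x_i) are in pairwise disjoint small tuples of variables x_i,
   [D i] being the set of the variables of x_i. *)
Definition commuting_products_determined (m n : nat) (K : Type) (L : language)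
    (U : structure L) : Prop :=
  forall (V : Type) (D : 'I_n -> set V) (p : 'I_n -> set (formula L (V + U))),
    (forall i, small K (D i)) ->
    trivIset [set: 'I_n] D ->
    (forall i, Stype (D i) [set: U] (p i)) ->
    (forall i, invariant K (p i)) ->
    (forall i j, i <> j -> commute K (D i) (D j) (p i) (p j)) ->
    m_determined m D [set: U] (iterated_product K D p).

(* Main.v *)
From Stdlib Require List.
From mathcomp Require Import all_boot all_order ssralg ssrnum ssrint.
From mathcomp Require Import boolp classical_sets functions cardinality filter.
Require Import Defs.

(* A realization of a product of invariant types is a chain: each tuple realizes
   its type over the base and the preceding tuples, and pairwise commuting types
   may be realized in any order.

   If T is m-distal and p' agrees with the product of the p_l on all sets of m
   variables, then by induction it does so on every set S of variables.  Split S
   into m+1 nonempty groups.  Realize first the part of a Morley sequence of the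
   product that lies, for the l-th coordinate, below the cut attached to the
   group of l; then p'; then the rest.  Any m of the resulting m+1 fillers involve
   a proper subset of S, so by induction and commutation they insert; m-distality
   inserts all of them, which computes the type of the realization of p'.

   Conversely, let A fill the cuts of an indiscernible sequence b so that all its
   m-element parts insert.  The limit types of b from the left at the cuts
   commute, because otherwise a formula would alternate along an indiscernible
   sequence, against NIP.  If A does not insert, it falsifies over b a formula of
   the product of these types.  By base change, again an alternation argument,
   that failure is consistent with the restrictions of the global product to all
   sets of m variables, so that the product is not m-determined. *)

Set Implicit Arguments.
Unset Strict Implicit.
Unset Printing Implicit Defensive.

Local Open Scope classical_set_scope.
Local Open Scope card_scope.

(** * Cardinals *)

(** The monster model is given by universality and strong homogeneity, while every construction has
    to realize types over small sets. Saturation is therefore derived: a small Skolem hull inside an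
    ultrapower realizes the type, embeds by universality, and is brought back over the parameters by
    homogeneity. As smallness is measured by an arbitrary type [K], this rests on some arithmetic of
    infinite cardinals.

    The number m+1 of groups is the number of cuts of a partition into m+2 pieces, the shape in the
    definition of m-distality. In the converse, the obstacle is that insertion is a statement over b
    alone, while determinacy is about types over all of U, whose parameters are unrelated to b. Base
    change moves A by automorphisms fixing b pointwise. Limits from the right provide the room for
    it: over b they agree with the limits from the left, and they can be realized over A in such a
    way that A still realizes the left limits over them. *)

Definition embeds (X Y : Type) : Prop := exists f : X -> Y, injective f.

Lemma embeds_refl X : embeds X X.
Proof. by exists id. Qed.

Lemma embeds_trans Y X Z : embeds X Y -> embeds Y Z -> embeds X Z.
Proof. by move=> [f fI] [g gI]; exists (g \o f); exact: inj_comp. Qed.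

Lemma embeds_surj (X Y : Type) (f : X -> Y) :
  (forall y, exists x, f x = y) -> embeds Y X.
Proof.
move=> /choice[g gK]; exists g => y y' e.
by rewrite -(gK y) -(gK y') e.
Qed.

Lemma sval_inj (X : Type) (A : set X) : injective (@sval X A).
Proof. by move=> [x Ax] [y Ay] /= e; apply: eq_exist. Qed.

Lemma embeds_sum X X' Y Y' : embeds X X' -> embeds Y Y' ->
  embeds (X + Y) (X' + Y').
Proof.
move=> [f fI] [g gI].
exists (fun s => match s with inl x => inl (f x) | inr y => inr (g y) end).
by move=> [x|y] [x'|y'] // [] => [/fI|/gI] ->.
Qed.

Lemma embeds_prod X X' Y Y' : embeds X X' -> embeds Y Y' ->
  embeds (X * Y) (X' * Y').
Proof.
move=> [f fI] [g gI]; exists (fun s => (f s.1, g s.2)).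
by move=> [x y] [x' y'] /= [/fI -> /gI ->].
Qed.

(** Zorn's lemma on graphs of partial injections: a maximal one that is neither total nor onto could
    be extended by one more pair. *)
Lemma embeds_total X Y : embeds X Y \/ embeds Y X.
Proof.
pose P (G : set (X * Y)) :=
  (forall x y y', G (x, y) -> G (x, y') -> y = y') /\
  (forall x x' y, G (x, y) -> G (x', y) -> x = x').
have [F FP Ftot|G [[Gf Gi] Gmax]] := @Zorn_bigcup _ P.
  have common p q : (\bigcup_(G in F) G) p -> (\bigcup_(G in F) G) q ->
      exists G, [/\ P G, G p & G q].
    move=> [G FG Gp] [H FH Hq]; have [GH|HG] := Ftot _ _ FG FH.
      by exists H; split => //; [exact: FP|exact: GH].
    by exists G; split => //; [exact: FP|exact: HG].
  by split=> [x y y' a b|x x' y a b]; have [G [[Gf Gi] Gp Gq]] := common _ _ a b;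
    [exact: Gf Gp Gq|exact: Gi Gp Gq].
have [tot|] := pselect (forall x, exists y, G (x, y)).
  left; have [f fP] := choice tot; exists f => x x' e.
  by apply: (Gi _ _ (f x)) => //; rewrite e.
move=> /existsNP[x0 /forallNP nx0].
have [tot|] := pselect (forall y, exists x, G (x, y)).
  right; have [f fP] := choice tot; exists f => y y' e.
  by apply: (Gf (f y)) => //; rewrite e.
move=> /existsNP[y0 /forallNP ny0].
case: (Gmax (G `|` [set (x0, y0)])).
  split; first by move=> p; left.
  by move=> /(_ (x0, y0)) h; apply: (nx0 y0); apply: h; right.
split=> [x y y'|x x' y] [a|/= [? ?]] [b|/= [? ?]]; subst.
- exact: Gf a b.
- by case: (nx0 y).
- by case: (nx0 y').
- by [].
- exact: Gi a b.
- by case: (ny0 x).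
- by case: (ny0 x').
- by [].
Qed.

(** * The square of an infinite set *)

Section Square.
Variables (X : Type) (g : nat -> X) (gI : injective g).

Let dom (G : set ((X * X) * X)) x := exists z, G ((x, x), z).

(** The graph of an injection of A * A into A, where A is [dom G]. *)
Let pairing (G : set ((X * X) * X)) :=
  [/\ forall p z z', G (p, z) -> G (p, z') -> z = z',
      forall p p' z, G (p, z) -> G (p', z) -> p = p',
      forall x y z, G ((x, y), z) -> [/\ dom G x, dom G y & dom G z] &
      forall x y, dom G x -> dom G y -> exists z, G ((x, y), z)].

Let G0 : set ((X * X) * X) :=
  [set t | exists i j, t = ((g i, g j), g (pickle (i, j)))].

Let pairing_G0 : pairing G0.
Proof.
split.
- by move=> p z z' [i [j [-> ->]]] [i' [j' [/gI -> /gI -> ->]]].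
- move=> p p' z [i [j [-> ->]]] [i' [j' [-> /gI]]].
  by move=> /(pcan_inj pickleK) [-> ->].
- move=> x y z [i [j [-> -> ->]]].
  by split; [exists (g (pickle (i, i))), i, i|exists (g (pickle (j, j))), j, j|
    exists (g (pickle (pickle (i, j), pickle (i, j)))), (pickle (i, j)), (pickle (i, j))].
- move=> x y [_ [i [_ [-> _ _]]]] [_ [j [_ [-> _ _]]]].
  by exists (g (pickle (i, j))), i, j.
Qed.

(** Zorn's lemma is applied to the [G] whose union with [G0] is a pairing, so that the empty chain
    also has an upper bound and the maximal pairing has an infinite domain. *)
Let pairing_max : exists H, [/\ pairing H, G0 `<=` H &
  forall H', pairing H' -> H `<=` H' -> H' `<=` H].
Proof.
pose P G := pairing (G `|` G0).
have [F FP Ftot|G [PG Gmax]] := @Zorn_bigcup _ P; last first.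
  exists (G `|` G0); split => // H' pH' GH'.
  suff : H' `<=` G by move=> h t /h; left.
  have H'E : H' `|` G0 = H' by apply: setUidl => t Gt; apply: GH'; right.
  apply: contrapT => nH'; apply: (Gmax H'); last by rewrite /P H'E.
  by split=> // t Gt; apply: GH'; left.
have [F0|/set0P[G1 FG1]] := eqVneq F set0.
  by rewrite /P F0 bigcup_set0 set0U.
have common p q : (\bigcup_(G in F) G `|` G0) p ->
    (\bigcup_(G in F) G `|` G0) q ->
    exists G, [/\ pairing (G `|` G0), G `<=` \bigcup_(G in F) G, (G `|` G0) p &
      (G `|` G0) q].
  have one r : (\bigcup_(G in F) G `|` G0) r -> exists2 G, F G & (G `|` G0) r.
    by move=> [[G FG Gr]|r0]; [exists G => //; left|exists G1 => //; right].
  move=> /one[G FG Gp] /one[H FH Hq]; have [GH|HG] := Ftot _ _ FG FH.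
    exists H; split => //; first exact: FP.
      by move=> t Ht; exists H.
    exact: setSU GH _ Gp.
  exists G; split => //; first exact: FP.
    by move=> t Ht; exists G.
  exact: setSU HG _ Hq.
have domS (G H : set ((X * X) * X)) x : G `<=` H -> dom G x -> dom H x.
  by move=> GH [z /GH Gz]; exists z.
split.
- by move=> p z z' a b; have [G [[h _ _ _] _ Gp Gq]] := common _ _ a b; exact: h Gp Gq.
- by move=> p p' z a b; have [G [[_ h _ _] _ Gp Gq]] := common _ _ a b; exact: h Gp Gq.
- move=> x y z a; have [G [[_ _ h _] GF Gp _]] := common _ _ a a.
  have S : G `|` G0 `<=` \bigcup_(G in F) G `|` G0 by exact: setSU.
  by have [? ? ?] := h _ _ _ Gp; split; apply: domS S _.
- move=> x y [z a] [z' b]; have [G [[_ _ _ h] GF Gp Gq]] := common _ _ a b.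
  have [|t ht] := h x y (ex_intro _ z Gp); first by exists z'.
  by exists t; exact: setSU GF _ ht.
Qed.

(** Let A be the domain of a maximal pairing. If the complement of A embeds into A, then so does X,
    and the pairing on A gives one on X. Otherwise A has a disjoint copy B in its complement, and
    the pairing extends to the union of A and B, against maximality. *)
Lemma embeds_square : embeds (X * X) X.
Proof.
have [H [[Hf Hi Hc Ht] GH Hmax]] := pairing_max.
pose A := dom H.
have Ag i : A (g i) by exists (g (pickle (i, i))); apply: GH; exists i, i.
have /choice[f fP] : forall p : X * X, exists z, A p.1 -> A p.2 -> H (p, z).
  move=> [x y]; have [[Ax Ay]|nA] := pselect (A x /\ A y).
    by have [z hz] := Ht _ _ Ax Ay; exists z.
  by exists x => /= Ax Ay; case: nA.
have fA x y : A x -> A y -> A (f (x, y)).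
  by move=> Ax Ay; have [] := Hc _ _ _ (fP (x, y) Ax Ay).
have fI p q : A p.1 -> A p.2 -> A q.1 -> A q.2 -> f p = f q -> p = q.
  move=> p1 p2 q1 q2 e; apply: (Hi _ _ (f p)); first exact: fP.
  by rewrite e; exact: fP.
(* Two disjoint copies fit into A: pairing with the tags [g 0] and [g 1] keeps them apart. *)
have key (B : set X) (u : X -> X) : (forall x, B x -> ~ A x) ->
    (forall x, B x -> A (u x)) -> {in B &, injective u} ->
    exists k : X -> X, (forall x, (A `|` B) x -> A (k x)) /\
      (forall x y, (A `|` B) x -> (A `|` B) y -> k x = k y -> x = y).
  move=> BA uA uI.
  exists (fun x => if `[< A x >] then f (g 0, x) else f (g 1, u x)).
  split=> [x [Ax|Bx]|].
  - by rewrite asboolT //; apply: fA.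
  - by rewrite asboolF; [apply: fA => //; exact: uA|exact: BA].
  move=> x y hx hy; case: asboolP => Ax; case: asboolP => Ay.
  - by move=> e; have [] := @fI (g 0, x) (g 0, y) (Ag 0) Ax (Ag 0) Ay e.
  - have By : B y by case: hy.
    move=> e; have := @fI (g 0, x) (g 1, u y) (Ag 0) Ax (Ag 1) (uA _ By) e.
    by move=> [] /gI.
  - have Bx : B x by case: hx.
    move=> e; have := @fI (g 1, u x) (g 0, y) (Ag 1) (uA _ Bx) (Ag 0) Ay e.
    by move=> [] /gI.
  - have Bx : B x by case: hx.
    have By : B y by case: hy.
    move=> e; have [e'] := @fI (g 1, u x) (g 1, u y) (Ag 1) (uA _ Bx) (Ag 1) (uA _ By) e.
    by apply: uI => //; exact: mem_set.
have [[h hI]|[h hI]] := embeds_total {x | ~ A x} {x | A x}.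
- have [] := key (~` A) (fun x =>
    match pselect (~ A x) with left n => sval (h (exist _ x n)) | right _ => x end).
  + by [].
  + by move=> x nx; case: pselect => // n; exact: svalP.
  + move=> x y /set_mem nx /set_mem ny.
    case: pselect => // n; case: pselect => // n' /sval_inj /hI.
    by move=> /(congr1 sval).
  + rewrite setUv => k [kA kI].
    exists (fun p => f (k p.1, k p.2)) => -[x y] [x' y'] /= e.
    have [e1 e2] := @fI (k x, k y) (k x', k y') (kA _ I) (kA _ I) (kA _ I) (kA _ I) e.
    by rewrite (kI x x') // (kI y y').
- pose B := [set x | exists a, sval (h a) = x].
  have /choice[u uP] : forall x, exists y, B x -> exists a : {x | A x},
      sval (h a) = x /\ sval a = y.
    move=> x; have [[a <-]|nB] := pselect (B x); last by exists x.
    by exists (sval a) => _; exists a.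
  have BA x : B x -> ~ A x by move=> [a <-]; exact: (svalP (h a)).
  have [] := key B u BA.
  + by move=> x /uP[a [_ <-]]; exact: svalP.
  + move=> x y /set_mem /uP[a [<- <-]] /set_mem /uP[b [<- <-]].
    by move=> /sval_inj ->.
  move=> k [kA kI].
  have hlift x : exists y, A x -> B y /\ exists a, sval a = x /\ sval (h a) = y.
    have [Ax|nA] := pselect (A x); last by exists x.
    exists (sval (h (exist _ x Ax))) => _.
    by split; exists (exist _ x Ax).
  have [h' h'P] := choice hlift.
  have h'B x : A x -> B (h' x) by move=> /h'P[].
  have h'I x y : A x -> A y -> h' x = h' y -> x = y.
    move=> /h'P[_ [a [<- <-]]] /h'P[_ [b [<- <-]]].
    by move=> /sval_inj /hI ->.
  (* The new pairs are sent into B and the old ones into A, so that injectivity is preserved. *)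
  pose G := [set t | exists x y, [/\ (A `|` B) x, (A `|` B) y, ~ (A x /\ A y) &
    t = ((x, y), h' (f (k x, k y)))]].
  have HA x y z : H ((x, y), z) -> [/\ A x, A y & A z] by exact: Hc.
  have fkA x y : (A `|` B) x -> (A `|` B) y -> A (f (k x, k y)).
    by move=> hx hy; apply: fA; exact: kA.
  have domE x : dom (H `|` G) x <-> (A `|` B) x.
    split.
      by move=> [z [/HA[]|[x' [y' [hx hy _ [-> _ _]]]]]] //; left.
    move=> [Ax|Bx].
      by have [z Hz] := Ax; exists z; left.
    exists (h' (f (k x, k x))); right; exists x, x; split => //.
    - by right.
    - by right.
    - by move=> []; move/BA: Bx.
  have : H `|` G `<=` H.
    apply: Hmax; last by move=> t; left.
    split.
    - move=> p z z' [a|[x [y [hx hy nxy [e e']]]]] [b|[x' [y' [hx' hy' nxy' [e1 e1']]]]].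
      + exact: Hf a b.
      + by move: a; rewrite e1 => /HA[? ?]; case: nxy'.
      + by move: b; rewrite e => /HA[? ?]; case: nxy.
      + by move: e' e1'; rewrite e in e1; case: e1 => -> -> -> ->.
    - move=> p p' z [a|[x [y [hx hy nxy [-> ez]]]]] [b|[x' [y' [hx' hy' nxy' [-> ez']]]]].
      + exact: Hi a b.
      + case: p a => p1 p2 /HA[_ _ Az]; case: (BA z) => //.
        by rewrite ez'; apply: h'B; exact: fkA.
      + case: p' b => p1 p2 /HA[_ _ Az]; case: (BA z) => //.
        by rewrite ez; apply: h'B; exact: fkA.
      + move: ez'; rewrite ez => /h'I e.
        have [] := @fI (k x, k y) (k x', k y') (kA _ hx) (kA _ hy) (kA _ hx') (kA _ hy')
          (e (fkA _ _ hx hy) (fkA _ _ hx' hy')).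
        by move=> /kI -> // /kI ->.
    - move=> x y z [/HA[Ax Ay Az]|[x' [y' [hx hy _ [-> -> ->]]]]].
        by split; apply/domE; left.
      by split; apply/domE => //; right; apply: h'B; exact: fkA.
    - move=> x y /domE hx /domE hy.
      have [[Ax Ay]|n] := pselect (A x /\ A y).
        by have [z hz] := Ht _ _ Ax Ay; exists z; left.
      by exists (h' (f (k x, k y))); right; exists x, y.
  move=> HG; have Bg : B (h' (g 0)) by exact: h'B.
  case: (BA _ Bg); have /domE [z /HG Hz] : (A `|` B) (h' (g 0)) by right.
  by exists z.
Qed.

End Square.

Lemma embeds_seq X : embeds nat X -> embeds (seq X) X.
Proof.
move=> [g gI]; have [f fI] := embeds_square gI.
pose c := foldr (fun x y => f (x, y)) (g 0).
(* The code records the length as well, since [c] alone need not distinguish sequences of different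
   lengths. *)
exists (fun s => f (g (size s), c s)) => s s' /fI[/gI].
elim: s s' => [|x s IHs] [|x' s'] //= [] /IHs {}IHs /fI[-> /IHs ->] //.
Qed.

Definition smallT (K X : Type) : Prop := ~ embeds K X.

Lemma card_le_embeds (T T' : Type) (A : set T) (B : set T') :
  A #<= B <-> embeds {x | A x} {x | B x}.
Proof.
split=> [/card_leP/injfunPex[f _ fI]|[f fI]].
  exists (fun x => let y := f (exist _ (sval x) (mem_set (svalP x))) in
    exist _ (sval y) (set_mem (svalP y))).
  move=> [x Ax] [y Ay] [] /sval_inj /fI e; apply: eq_exist.
  have := e _ _; rewrite !inE => /(_ I I); exact: (congr1 sval).
apply/card_leP/injfunPex.
exists (fun x => let y := f (exist _ (sval x) (set_mem (svalP x))) in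
    exist _ (sval y) (mem_set (svalP y))) => //.
by move=> [x Ax] [y Ay] _ _ [] /sval_inj /fI [] e; apply: eq_exist.
Qed.

Lemma embeds_setT T : embeds T {x | [set: T] x}.
Proof. by exists (fun x => exist _ x I) => x y []. Qed.

Lemma smallE (K T : Type) (A : set T) : small K A <-> smallT K {x | A x}.
Proof.
have KT : embeds {x | [set: K] x} K by exists sval; exact: sval_inj.
split=> [/negP h e|h].
  by apply: h; apply/card_le_embeds; apply: embeds_trans e.
apply/negP => /card_le_embeds e; apply: h.
exact: embeds_trans (embeds_setT K) e.
Qed.

Lemma small_setT (K T : Type) : small K [set: T] <-> smallT K T.
Proof.
rewrite smallE; split => h e; apply: h; apply: embeds_trans e _.
  exact: embeds_setT.
by exists sval; exact: sval_inj.
Qed.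

Section Small.
Variables (K : Type) (K_nat : smallT K nat).

Lemma smallT_embeds X Y : embeds X Y -> smallT K Y -> smallT K X.
Proof. by move=> XY h KX; apply: h; exact: embeds_trans XY. Qed.

Lemma smallT_surj X Y (f : X -> Y) : (forall y, exists x, f x = y) ->
  smallT K X -> smallT K Y.
Proof. by move=> /embeds_surj; exact: smallT_embeds. Qed.

(** An infinite small bound of both types, to which [embeds_square] applies. *)
Lemma smallT_unbound X Y : smallT K X -> smallT K Y ->
  exists Z, [/\ smallT K Z, embeds nat Z, embeds X Z & embeds Y Z].
Proof.
have pair A B : smallT K A -> smallT K B ->
    exists C, [/\ smallT K C, embeds A C & embeds B C].
  move=> sA sB; have [AB|BA] := embeds_total A B.
    by exists B; split => //; exact: embeds_refl.
  by exists A; split => //; exact: embeds_refl.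
move=> sX sY; have [W [sW XW YW]] := pair _ _ sX sY.
have [Z [sZ WZ nZ]] := pair _ _ sW K_nat.
by exists Z; split => //; exact: embeds_trans WZ.
Qed.

Lemma smallT_prod X Y : smallT K X -> smallT K Y -> smallT K (X * Y).
Proof.
move=> sX sY; have [Z [sZ [g gI] XZ YZ]] := smallT_unbound sX sY.
apply: smallT_embeds sZ; apply: embeds_trans (embeds_square gI).
exact: embeds_prod.
Qed.

Lemma smallT_sum X Y : smallT K X -> smallT K Y -> smallT K (X + Y).
Proof.
move=> sX sY; have [Z [sZ [g gI] XZ YZ]] := smallT_unbound sX sY.
apply: smallT_embeds sZ; apply: embeds_trans (embeds_square gI).
apply: embeds_trans (embeds_sum XZ YZ) _.
exists (fun s => match s with inl x => (g 0, x) | inr x => (g 1, x) end).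
by move=> [x|x] [y|y] // [] // => [->|/gI|/gI|->].
Qed.

Lemma smallT_seq X : smallT K X -> smallT K (seq X).
Proof.
move=> sX; have [Z [sZ nZ [f fI] _]] := smallT_unbound sX K_nat.
apply: smallT_embeds sZ; apply: embeds_trans (embeds_seq nZ).
by exists (map f); exact: inj_map.
Qed.

Lemma smallT_countType (X : countType) : smallT K X.
Proof. by apply: smallT_embeds K_nat; exists pickle; exact: (pcan_inj pickleK). Qed.

Lemma small_sub (T : Type) (A B : set T) : A `<=` B -> small K B -> small K A.
Proof.
move=> AB /smallE sB; apply/smallE; apply: smallT_embeds sB.
exists (fun x => exist _ (sval x) (AB _ (svalP x))).
by move=> x y [] /sval_inj.
Qed.

Lemma small_image (T T' : Type) (f : T -> T') (A : set T) :
  small K A -> small K (f @` A).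
Proof.
move=> /smallE sA; apply/smallE.
apply: (@smallT_surj _ _ (fun x => exist _ (f (sval x)) (imageP f (svalP x)))) sA.
by move=> [y [x Ax e]]; exists (exist _ x Ax); apply: eq_exist.
Qed.

Lemma small_range (T T' : Type) (f : T -> T') : smallT K T -> small K (range f).
Proof. by move=> /small_setT sT; exact: small_image. Qed.

Lemma small_setU (T : Type) (A B : set T) :
  small K A -> small K B -> small K (A `|` B).
Proof.
move=> /smallE sA /smallE sB; apply: (@small_sub _ _
  (range (fun s : {x | A x} + {x | B x} => match s with inl x => sval x | inr x => sval x end))).
  move=> x [Ax|Bx]; first by exists (inl (exist _ x Ax)).
  by exists (inr (exist _ x Bx)).
by apply: small_range; exact: smallT_sum.
Qed.

Lemma small_finite (T : Type) (A : set T) : finite_set A -> small K A.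
Proof.
move=> /finite_set_countable/card_le_embeds e; apply/smallE.
apply: smallT_embeds K_nat; apply: embeds_trans e _.
by exists sval; exact: sval_inj.
Qed.

Lemma small_setX (T T' : Type) (A : set T) (B : set T') :
  small K A -> small K B -> small K (A `*` B).
Proof.
move=> /smallE sA /smallE sB.
apply/smallE; apply: smallT_embeds (smallT_prod sA sB).
exists (fun x => (exist A (sval x).1 (proj1 (svalP x)),
  exist B (sval x).2 (proj2 (svalP x)))).
by move=> [[x y] ?] [[x' y'] ?] [] /= ? ?; subst; apply: eq_exist.
Qed.

End Small.

(** * Formulas and automorphisms *)

Section Syntax.
Variable L : language.

Lemma tfv_tmap (V W : Type) (h : V -> W) (t : term L V) :
  tfv (tmap h t) = h @` tfv t.
Proof.
elim: t => [v|f ts IH] /=; first by rewrite image_set1.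
apply/seteqP; split=> [w [i]|w [v [i tv] <-]].
  by rewrite IH => -[v tv <-]; exists v => //; exists i.
by exists i; rewrite IH; exists v.
Qed.

Lemma fv_fmap (V W : Type) (h : V -> W) (phi : formula L V) :
  fv (fmap h phi) = h @` fv phi.
Proof.
elim: phi W h => {V} [V|V t u|V r ts|V phi IHphi psi IHpsi|V phi IH] W h /=.
- by rewrite image_set0.
- by rewrite !tfv_tmap image_setU.
- apply/seteqP; split=> [w [i]|w [v [i tv] <-]].
    by rewrite tfv_tmap => -[v tv <-]; exists v => //; exists i.
  by exists i; rewrite tfv_tmap; exists v.
- by rewrite IHphi IHpsi image_setU.
- rewrite IH; apply/seteqP; split=> [w [[v|] //= fv_v [<-]]|w [v fv_v <-]].
    by exists v.
  by exists (Some v).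
Qed.

Lemma tmap_ext (V W : Type) (h k : V -> W) (t : term L V) :
  (forall v, tfv t v -> h v = k v) -> tmap h t = tmap k t.
Proof.
elim: t => [v|f ts IH] /= hk; first by rewrite hk.
by congr Fun; apply: funext => i; apply: IH => v tv; apply: hk; exists i.
Qed.

Lemma fmap_ext (V W : Type) (h k : V -> W) (phi : formula L V) :
  (forall v, fv phi v -> h v = k v) -> fmap h phi = fmap k phi.
Proof.
elim: phi W h k => {V} [V|V t u|V r ts|V phi IHphi psi IHpsi|V phi IH] W h k /= hk.
- by [].
- by congr Eq; apply: tmap_ext => v tv; apply: hk; [left|right].
- by congr Rel; apply: funext => i; apply: tmap_ext => v tv; apply: hk; exists i.
- by congr Imp; [apply: IHphi|apply: IHpsi] => v tv; apply: hk; [left|right].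
- by congr All; apply: IH => -[v|] //= hv; rewrite hk.
Qed.

Lemma tmap_comp (V W X : Type) (g : W -> X) (h : V -> W) (t : term L V) :
  tmap g (tmap h t) = tmap (g \o h) t.
Proof. by elim: t => //= f ts IH; congr Fun; apply: funext. Qed.

Lemma fmap_comp (V W X : Type) (g : W -> X) (h : V -> W) (phi : formula L V) :
  fmap g (fmap h phi) = fmap (g \o h) phi.
Proof.
elim: phi W X g h => {V} [V|V t u|V r ts|V phi IHphi psi IHpsi|V phi IH] W X g h /=.
- by [].
- by rewrite !tmap_comp.
- by congr Rel; apply: funext => i; rewrite tmap_comp.
- by rewrite IHphi IHpsi.
- by rewrite IH; congr All; apply: fmap_ext => -[].
Qed.

Lemma tmap_id (V : Type) (t : term L V) : tmap id t = t.
Proof. by elim: t => //= f ts IH; congr Fun; apply: funext. Qed.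

Lemma fmap_id (V : Type) (phi : formula L V) : fmap id phi = phi.
Proof.
elim: phi => {V} [V|V t u|V r ts|V phi IHphi psi IHpsi|V phi IH] //=.
- by rewrite !tmap_id.
- by congr Rel; apply: funext => i; rewrite tmap_id.
- by rewrite IHphi IHpsi.
- by rewrite -[in RHS]IH; congr All; apply: fmap_ext => -[].
Qed.

Lemma tmap_factor (V X : Type) (h : X -> V) (t : term L V) :
  (forall v, tfv t v -> exists x, h x = v) -> exists t', t = tmap h t'.
Proof.
elim: t => [v|f ts IH] /= ht.
  by have [x <-] := ht _ erefl; exists (Var L x).
have /choice[g gP] : forall i, exists t', ts i = tmap h t'.
  by move=> i; apply: IH => v tv; apply: ht; exists i.
by exists (Fun g) => /=; congr Fun; apply: funext.
Qed.

(** Variable types being arbitrary, this is the tool for changing them: it restricts a formula to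
    the finitely many variables that occur in it, turns parameters into variables, and names
    elements by variables or constants. *)
Lemma fmap_factor (V X : Type) (h : X -> V) (phi : formula L V) :
  (forall v, fv phi v -> exists x, h x = v) -> exists phi', phi = fmap h phi'.
Proof.
elim: phi X h => {V} [V|V t u|V r ts|V phi IHphi psi IHpsi|V phi IH] X h /= hf.
- by exists Falsum.
- have [|t' ->] := @tmap_factor _ _ h t; first by move=> v tv; apply: hf; left.
  have [|u' ->] := @tmap_factor _ _ h u; first by move=> v tv; apply: hf; right.
  by exists (Eq t' u').
- have /choice[g gP] : forall i, exists t', ts i = tmap h t'.
    by move=> i; apply: tmap_factor => v tv; apply: hf; exists i.
  by exists (Rel g) => /=; congr Rel; apply: funext.
- have [|p ->] := IHphi X h; first by move=> v tv; apply: hf; left.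
  have [|q ->] := IHpsi X h; first by move=> v tv; apply: hf; right.
  by exists (Imp p q).
- have [|p ->] := IH (option X) (omap h); last by exists (All p).
  move=> [v|] fv_v; last by exists None.
  by have [x <-] := hf v fv_v; exists (Some x).
Qed.

Lemma finite_tfv (V : Type) (t : term L V) : finite_set (tfv t).
Proof.
elim: t => [v|f ts IH] /=; first exact: finite_set1.
rewrite [X in finite_set X](_ : _ = \bigcup_(i in [set: 'I_(farity f)]) tfv (ts i)).
  by apply: bigcup_finite.
by apply/seteqP; split=> v [i h]; exists i.
Qed.

Lemma finite_fv (V : Type) (phi : formula L V) : finite_set (fv phi).
Proof.
elim: phi => {V} [V|V t u|V r ts|V phi IHphi psi IHpsi|V phi IH] /=.
- exact: finite_set0.
- by rewrite finite_setU; split; exact: finite_tfv.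
- rewrite [X in finite_set X](_ : _ = \bigcup_(i in [set: 'I_(rarity r)]) tfv (ts i)).
    by apply: bigcup_finite => // i _; exact: finite_tfv.
  by apply/seteqP; split=> v [i h]; exists i.
- by rewrite finite_setU.
- rewrite -(eq_finite_set card_some); apply: sub_finite_set IH.
  by move=> _ [v fv_v <-].
Qed.

End Syntax.

Lemma finite_ord (X : Type) (A : set X) : finite_set A ->
  exists k (h : 'I_k -> X), forall x, A x <-> exists i, h i = x.
Proof.
move=> /(@finite_seqP {classic X})[s sE].
exists (size s), (tnth (in_tuple s)) => x; rewrite sE /=; split.
  by move=> xs; have /tnthP[i ->] : x \in in_tuple s by []; exists i.
by move=> [i <-]; exact: mem_tnth.
Qed.

Section FactorFinite.
Variable L : language.

Lemma fmap_ord (V : Type) (phi : formula L V) :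
  exists k (h : 'I_k -> V) phi', phi = fmap h phi' /\ forall i, fv phi (h i).
Proof.
have [k [h hP]] := finite_ord (finite_fv phi).
have [|phi' e] := @fmap_factor _ _ _ h phi; first by move=> v /hP.
by exists k, h, phi'; split => // i; apply/hP; exists i.
Qed.

Lemma fmap_plug (V W : Type) (phi : formula L (V + W)) :
  exists k (d : 'I_k -> W) phi', phi = fmap (plug d) phi' /\
    forall i, params phi (d i).
Proof.
have [k [h hP]] : exists k (h : 'I_k -> W), forall x, params phi x <-> exists i, h i = x.
  apply: finite_ord.
  apply: (@sub_finite_set _ _ (\bigcup_(S in (fun z : V + W =>
     if z is inr u then [set u] else set0) @` fv phi) S)).
    by move=> u hu; exists [set u] => //; exists (inr u).
  apply: bigcup_finite; first exact/finite_image/finite_fv.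
  by move=> S [[v|v] _ <-]; [exact: finite_set0|exact: finite_set1].
have [|phi' e] := @fmap_factor _ _ _ (plug h) phi.
  move=> [v|u] hv; first by exists (inl v).
  by have /hP[i <-] := hv; exists (inr i).
by exists k, h, phi'; split => // i; apply/hP; exists i.
Qed.

Lemma finite_params (V W : Type) (phi : formula L (V + W)) : finite_set (params phi).
Proof.
have [k [d [phi' [-> _]]]] := fmap_plug phi.
apply: (@sub_finite_set _ _ (range d)); last exact: finite_image.
by move=> u; rewrite /params /= fv_fmap => -[[v|i] _ //= [<-]]; exists i.
Qed.

Definition And (V : Type) (phi psi : formula L V) := Neg (Imp phi (Neg psi)).
Definition Ex (V : Type) (phi : formula L (option V)) := Neg (All (Neg phi)).
Definition Conj (V : Type) (s : seq (formula L V)) := foldr (@And V) (Neg Falsum) s.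

Fixpoint Exs (V : Type) (l : nat) : formula L (V + 'I_l) -> formula L V :=
  match l return formula L (V + 'I_l) -> formula L V with
  | 0 => fun phi => fmap (fun z : V + 'I_0 => match z with
      | inl v => v
      | inr i => match notF (ltn_ord i) with end
      end) phi
  | l'.+1 => fun phi => @Exs V l' (Ex (fmap (fun z : V + 'I_l'.+1 => match z with
      | inl v => Some (inl v)
      | inr i => omap inr (unlift ord_max i)
      end) phi))
  end.

End FactorFinite.

Section Semantics.
Variables (L : language) (M : structure L).

Lemma teval_ext (V : Type) (e e' : V -> M) (t : term L V) :
  (forall v, tfv t v -> e v = e' v) -> teval e t = teval e' t.
Proof.
elim: t => [v|f ts IH] /= ee; first exact: ee.
by congr fint; apply: funext => i; apply: IH => v tv; apply: ee; exists i.
Qed.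

Lemma sat_ext (V : Type) (e e' : V -> M) (phi : formula L V) :
  (forall v, fv phi v -> e v = e' v) -> sat e phi <-> sat e' phi.
Proof.
elim: phi e e' => {V} [V|V t u|V r ts|V phi IHphi psi IHpsi|V phi IH] e e' /= ee.
- by [].
- by rewrite (@teval_ext _ e e' t) ?(@teval_ext _ e e' u) // => v tv; apply: ee;
    [right|left].
- rewrite (_ : (fun i => teval e (ts i)) = (fun i => teval e' (ts i))) //.
  by apply: funext => i; apply: teval_ext => v tv; apply: ee; exists i.
- have p := IHphi e e' (fun v h => ee v (or_introl h)).
  have q := IHpsi e e' (fun v h => ee v (or_intror h)).
  tauto.
- have E x : sat (fun o => if o is Some v then e v else x) phi <->
      sat (fun o => if o is Some v then e' v else x) phi.
    by apply: IH => -[v|] //= hv; apply: ee.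
  by split=> h x; apply/E.
Qed.

Lemma sat_eq_iff (V : Type) (e e' : V -> M) (phi : formula L V) :
  e =1 e' -> sat e phi <-> sat e' phi.
Proof. by move=> ee; apply: sat_ext. Qed.

Lemma sat_eq (V : Type) (e e' : V -> M) (phi : formula L V) :
  e =1 e' -> sat e phi -> sat e' phi.
Proof. by move=> ee; rewrite (sat_eq_iff _ ee). Qed.

Lemma teval_tmap (V W : Type) (e : W -> M) (h : V -> W) (t : term L V) :
  teval e (tmap h t) = teval (e \o h) t.
Proof. by elim: t => //= f ts IH; congr fint; apply: funext. Qed.

Lemma sat_fmap (V W : Type) (e : W -> M) (h : V -> W) (phi : formula L V) :
  sat e (fmap h phi) <-> sat (e \o h) phi.
Proof.
elim: phi W e h => {V} [V|V t u|V r ts|V phi IHphi psi IHpsi|V phi IH] W e h /=.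
- by [].
- by rewrite !teval_tmap.
- rewrite (_ : (fun i => teval e (tmap h (ts i))) = (fun i => teval (e \o h) (ts i))) //.
  by apply: funext => i; rewrite teval_tmap.
- have := IHphi _ e h; have := IHpsi _ e h; tauto.
- by split=> H x; have := H x; rewrite IH; apply: sat_eq => -[].
Qed.

Lemma sat_And (V : Type) (e : V -> M) phi psi :
  sat e (And phi psi) <-> sat e phi /\ sat e psi.
Proof.
rewrite /And /Neg /=; split=> [h|[h1 h2] h]; last exact: h.
by split; apply: contrapT => n; apply: h.
Qed.

Lemma sat_Ex (V : Type) (e : V -> M) phi : sat e (Ex phi) <->
  exists x : M, sat (fun o => if o is Some v then e v else x) phi.
Proof.
rewrite /Ex /Neg /=; split=> [h|[x hx] h]; last exact: (h x).
by apply: contrapT => /forallNP n; apply: h.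
Qed.

Lemma sat_Conj (V : Type) (e : V -> M) s :
  sat e (Conj s) <-> forall phi, List.In phi s -> sat e phi.
Proof.
elim: s => [|psi s IH]; first by split => // _ h; exact: h.
rewrite sat_And IH; split=> [[h1 h2] phi [<-//|]|h]; first exact: h2.
by split=> [|phi hphi]; apply: h; [left|right].
Qed.

Lemma sat_Exs (V : Type) (l : nat) (e : V -> M) (phi : formula L (V + 'I_l)) :
  sat e (Exs phi) <-> exists d : 'I_l -> M,
    sat (fun z => match z with inl v => e v | inr i => d i end) phi.
Proof.
elim: l phi => [|l IH] phi /=.
  have [u0] := carrier_inhabited M; rewrite sat_fmap; split.
    by move=> h; exists (fun _ => u0); apply: sat_eq h => -[v|[]].
  by move=> [d h]; apply: sat_eq h => -[v|[]].
rewrite IH; split.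
  move=> [d]; rewrite sat_Ex => -[x]; rewrite sat_fmap => h.
  exists (fun i => if unlift ord_max i is Some j then d j else x).
  by apply: sat_eq h => -[v|i] //=; case: unlift.
move=> [d h]; exists (fun i => d (lift ord_max i)); rewrite sat_Ex.
exists (d ord_max); rewrite sat_fmap; apply: sat_eq h => -[v|i] //=.
by case: unliftP => [j ->|->].
Qed.

End Semantics.

Section Automorphisms.
Variables (L : language) (M : structure L).
Implicit Types s : M -> M.

Lemma automorphism_id : automorphism (@id M).
Proof. by split=> //; exact: (Bijective (g := id)). Qed.

Lemma automorphism_comp s s' : automorphism s -> automorphism s' ->
  automorphism (s \o s').
Proof.
move=> [b f r] [b' f' r']; split=> [|g x|g x]; first exact: bij_comp.
  by rewrite /= f' f.
by rewrite r' r.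
Qed.

Lemma automorphism_inv s : automorphism s -> exists s',
  [/\ automorphism s', cancel s s' & cancel s' s].
Proof.
move=> [[s' ss' s's] f r]; exists s'; split => //; split.
- exact: (Bijective s's ss').
- move=> g x; apply: (can_inj ss'); rewrite s's f; congr fint.
  by apply: funext => i /=; rewrite s's.
- move=> g x; rewrite (r g (s' \o x)); suff -> : s \o (s' \o x) = x by [].
  by apply: funext => i /=; rewrite s's.
Qed.

Lemma sat_automorphism s (V : Type) (e : V -> M) (phi : formula L V) :
  automorphism s -> sat (s \o e) phi <-> sat e phi.
Proof.
move=> [[s' ss' s's] f r].
have te (W : Type) (e' : W -> M) t : teval (s \o e') t = s (teval e' t).
  by elim: t => //= g ts IH; rewrite f; congr fint; apply: funext.
elim: phi e => {V} [V|V t u|V q ts|V phi IHphi psi IHpsi|V phi IH] e /=.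
- by [].
- by rewrite !te; split=> [/(can_inj ss')|->].
- rewrite [X in _ <-> X]r; suff -> : (fun i => teval (s \o e) (ts i)) =
    s \o (fun i => teval e (ts i)) by [].
  by apply: funext => i; rewrite te.
- have := IHphi e; have := IHpsi e; tauto.
- split=> h x.
    by apply/IH; apply: sat_eq (h (s x)) => -[].
  have /IH := h (s' x); apply: sat_eq => -[] //=.
Qed.

End Automorphisms.

Lemma elementary_embedding_sat (L : language) (M N : structure L) (h : M -> N) :
  elementary_embedding h ->
  forall (V : Type) (phi : formula L V) (e : V -> M),
    sat e phi <-> sat (h \o e) phi.
Proof.
move=> hE V phi e; have [k [g [psi [-> _]]]] := fmap_ord phi.
have [u0] := carrier_inhabited M.
have := hE (fmap val psi) (fun n => if insub n is Some i then e (g i) else u0).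
rewrite !sat_fmap => H; rewrite (@sat_eq_iff _ _ _ _ ((fun n => if insub n is Some i then e (g i) else u0) \o val)).
  rewrite H; apply: sat_eq_iff => i /=; by rewrite valK.
by move=> i /=; rewrite valK.
Qed.

(** * Saturation and homogeneity of the monster model *)

Lemma ultra_setC (T : Type) (F : set_system T) (A : set T) :
  UltraFilter F -> F (~` A) <-> ~ F A.
Proof.
move=> FU; split=> [nA FA|nA]; last by case: (in_ultra_setVsetC A FU).
have [x [Ax nx]] := filter_ex (filterI FA nA); exact: nx.
Qed.

Lemma ultra_ext (T : Type) (S : set (set T)) :
  (forall s : seq (set T), (forall B, List.In B s -> S B) ->
    exists x, forall B, List.In B s -> B x) ->
  exists F : set_system T, UltraFilter F /\ S `<=` F.
Proof.
move=> fip.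
pose base := [set s : seq (set T) | forall B, List.In B s -> S B].
pose F0 := filter_from base (fun s => [set x | forall B, List.In B s -> B x]).
have F0P : ProperFilter F0.
  apply: filter_from_proper; last by move=> s /fip.
  apply: filter_from_filter; first by exists [::].
  move=> s s' hs hs'; exists (s ++ s').
    by move=> B; rewrite List.in_app_iff => -[]; [exact: hs|exact: hs'].
  by move=> x h; split=> B hB; apply: h; rewrite List.in_app_iff; [left|right].
have [F [FU F0F]] := ultraFilterLemma F0P; exists F; split => // B SB.
apply: F0F; exists [:: B]; first by move=> C [<-|].
by move=> x; apply; left.
Qed.

(* The Skolem hull of the generators [P] in an ultrapower: its elements are
   classes of Skolem terms, each evaluated in every coordinate [a : V -> U] at
   once, so that it is small whatever the size of the index set. *)
Section SkolemPower.
Variables (L : language) (U : structure L) (V P : Type) (F : set_system (V -> U)).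
Hypothesis FU : UltraFilter F.
Variable gen : P -> (V -> U) -> U.

(** Skolem terms as generic trees, which are easily counted: a leaf is a generator, and a node whose
    first child is a leaf carrying a formula is the Skolem function of that formula applied to the
    remaining children. All other trees are junk with value [u0]. *)
Let skolem := GenTree.tree (P + formula L nat).
Let u0 : U := sval (cid (match carrier_inhabited U with inhabits u => ex_intro xpredT u isT end)).

(** Skolem functions of U: variable 0 is the element sought, and variable i+1 reads the i-th entry
    of [s]. *)
Let witness_ex (phi : formula L nat) (s : seq U) : exists u,
  forall u', sat (nth u0 (u' :: s)) phi -> sat (nth u0 (u :: s)) phi.
Proof.
have [[u hu]|nex] := pselect (exists u, sat (nth u0 (u :: s)) phi).
  by exists u.
by exists u0 => u' hu'; case: nex; exists u'.
Qed.

Let witness phi s : U := sval (cid (witness_ex phi s)).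

Let witnessP phi s u : sat (nth u0 (u :: s)) phi ->
  sat (nth u0 (witness phi s :: s)) phi.
Proof. exact: svalP (cid (witness_ex phi s)) u. Qed.

Let node (phi : formula L nat) (ts : seq skolem) : skolem :=
  GenTree.Node 0 (GenTree.Leaf (inr phi) :: ts).

Fixpoint skolem_eval (a : V -> U) (t : skolem) : U :=
  match t with
  | GenTree.Leaf (inl p) => gen p a
  | GenTree.Leaf (inr phi) => u0
  | GenTree.Node _ ts => match ts with
    | GenTree.Leaf (inr phi) :: ts' => witness phi (map (skolem_eval a) ts')
    | _ => u0
    end
  end.

Let eqF (t : skolem) : set skolem :=
  [set t' | F [set a | skolem_eval a t = skolem_eval a t']].

Let eqFE t t' : F [set a | skolem_eval a t = skolem_eval a t'] -> eqF t = eqF t'.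
Proof.
move=> h; apply/seteqP; split=> s; rewrite /eqF /= => h';
  by apply: filterS (filterI h h') => a /= [e e']; congruence.
Qed.

Definition skolem_class := {c : set skolem | exists t, c = eqF t}.

Let cls (t : skolem) : skolem_class := exist _ (eqF t) (ex_intro _ t erefl).

Let rep (c : skolem_class) : skolem := sval (cid (svalP c)).

Let cls_rep c : cls (rep c) = c.
Proof. by apply: sval_inj; rewrite /= -(svalP (cid (svalP c))). Qed.

Let rep_cls t : F [set a | skolem_eval a (rep (cls t)) = skolem_eval a t].
Proof.
have : eqF (rep (cls t)) t; last by [].
have <- : eqF t = eqF (rep (cls t)) by exact/esym/(congr1 sval (cls_rep (cls t))).
by rewrite /eqF /=; apply: filterS filterT => a.
Qed.

Let ev a c := skolem_eval a (rep c).

(** A function symbol is interpreted by the Skolem term of the formula x_0 = f(x_1, ..., x_k), so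
    that terms need no constructor of their own. *)
Definition skolem_power : structure L := @Structure L skolem_class
  (inhabits (cls (node Falsum [::])))
  (fun f x => cls (node
    (Eq (Var L 0) (Fun (fun i : 'I_(farity f) => Var L (val i).+1)))
    [seq rep (x i) | i <- enum 'I_(farity f)]))
  (fun r x => F [set a | rint (fun i => ev a (x i))]).

Lemma teval_skolem_power (W : Type) (e : W -> skolem_power) (t : term L W) :
  F [set a | ev a (teval e t) = teval (fun w => ev a (e w)) t].
Proof.
elim: t => [w|f ts IH] /=; first by apply: filterS filterT.
have h : F [set a | forall i, ev a (teval e (ts i)) = teval (fun w => ev a (e w)) (ts i)].
  exact: filter_forall.
set t := node _ _; apply: filterS (filterI h (rep_cls t)) => a /= [h1 h2].
rewrite /ev h2 /=; set s := map _ _.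
have sE (i : 'I_(farity f)) : nth u0 s i = ev a (teval e (ts i)).
  rewrite /s -map_comp (nth_map i) ?size_enum_ord // nth_ord_enum.
  by [].
have /witnessP /= -> : sat (nth u0 (fint (fun i => ev a (teval e (ts i))) :: s))
    (Eq (Var L 0) (Fun (fun i : 'I_(farity f) => Var L (val i).+1))).
  rewrite /=; congr fint; apply: funext => i. by rewrite -sE.
by congr fint; apply: funext => i; rewrite sE h1.
Qed.

(** The theorem of Łoś for the hull. If a universal formula fails on a set of the ultrafilter, the
    Skolem term of the negated body is a counterexample in all these coordinates at once. *)
Lemma sat_skolem_power (W : Type) (e : W -> skolem_power) (phi : formula L W) :
  sat e phi <-> F [set a | sat (fun w => ev a (e w)) phi].
Proof.
elim: phi e => {W} [W|W t u|W r ts|W phi IHphi psi IHpsi|W phi IH] e /=.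
- by split=> // h; have [] := filter_ex h.
- have ht := teval_skolem_power e t; have hu := teval_skolem_power e u.
  split=> [tu|h].
    by apply: filterS (filterI ht hu) => a /= [<- <-]; rewrite tu.
  rewrite -[LHS]cls_rep -[RHS]cls_rep; apply: sval_inj; apply: eqFE.
  apply: filterS (filterI h (filterI ht hu)) => a /= [e0 [e1 e2]].
  by rewrite -/(ev _ _) e1 e0 -e2.
- have h : F [set a | forall i, ev a (teval e (ts i)) = teval (fun w => ev a (e w)) (ts i)].
    by apply: filter_forall => i; exact: teval_skolem_power.
  split=> h'; apply: filterS (filterI h h') => a /= [e1 e2].
    rewrite (_ : (fun i => _) = (fun i => ev a (teval e (ts i)))) //.
    by apply: funext => i; rewrite e1.
  rewrite (_ : (fun i => _) = (fun i => teval (fun w => ev a (e w)) (ts i))) //.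
  by apply: funext => i; rewrite e1.
- rewrite IHphi IHpsi; split=> [h|h h']; last first.
    by apply: filterS (filterI h h') => a /= [x y]; exact: x.
  have [hp|hp] := pselect (F [set a | sat (fun w => ev a (e w)) phi]).
    by apply: filterS (h hp) => a /= ha _.
  by have {}hp := iffRL (@ultra_setC _ F _ FU) hp; apply: filterS hp => a /= na /na.
- split=> [h|h x]; last first.
    rewrite IH; apply: filterS h => a /= h.
    by apply: sat_eq (h (ev a x)) => -[].
  apply: contrapT => /(iffRL (@ultra_setC _ F _ FU)) nh.
  have [k [g [psi [phiE _]]]] := fmap_ord phi.
  (* The bound variable becomes variable 0, the one for which [witness] looks; the i-th other
     variable is shifted to i+1. *)
  pose g' i := if g i is Some _ then (val i).+1 else 0.
  pose s := [seq (if g i is Some w then rep (e w) else node Falsum [::]) | i <- enum 'I_k].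
  pose t := node (Neg (fmap g' psi)) s.
  have := h (cls t); rewrite IH => {}h.
  have [a [/= [h1 h2] h3]] := filter_ex (filterI (filterI h nh) (rep_cls t)).
  apply: h2; apply: contrapT => /existsNP[u nu].
  have envE u' i : nth u0 (u' :: map (skolem_eval a) s) (g' i) =
      if g i is Some w then ev a (e w) else u'.
    rewrite /g'; case gi: (g i) => [w|] //=.
    by rewrite /s -map_comp (nth_map i) ?size_enum_ord // nth_ord_enum /= gi.
  have : sat (nth u0 (u :: map (skolem_eval a) s)) (Neg (fmap g' psi)).
    move=> /sat_fmap H; apply: nu; rewrite phiE; apply/sat_fmap.
    by apply: sat_eq H => i /=; rewrite envE; case: (g i).
  move=> /witnessP /=; apply; apply/sat_fmap.
  move: h1; rewrite phiE => /sat_fmap; apply: sat_eq => i /=.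
  by rewrite envE; case: (g i) => //; rewrite /ev h3.
Qed.

Definition skolem_gen (p : P) : skolem_power := cls (GenTree.Leaf (inl p)).

Lemma sat_skolem_gen (W : Type) (e : W -> P) (phi : formula L W) :
  sat (skolem_gen \o e) phi <-> F [set a | sat (fun w => gen (e w) a) phi].
Proof.
have [k [g [psi [-> _]]]] := fmap_ord phi.
rewrite sat_skolem_power.
have h : F [set a | forall i, skolem_eval a (rep (cls (GenTree.Leaf (inl (e (g i)))))) =
    skolem_eval a (GenTree.Leaf (inl (e (g i))))].
  by apply: filter_forall => i; exact: rep_cls.
split=> h'; apply: filterS (filterI h h') => a /= [e1 e2]; apply/sat_fmap;
  by move/sat_fmap : e2; apply: sat_eq => i /=; rewrite /ev e1.
Qed.

Lemma smallT_skolem_power K : smallT K nat -> smallT K P ->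
  smallT K (formula L nat) -> smallT K skolem_power.
Proof.
move=> Kn KP KL; apply: (@smallT_surj _ skolem _ cls) => [c|].
  by exists (rep c).
apply: (@smallT_embeds _ _ (seq (nat + (P + formula L nat)))).
  by exists (@GenTree.encode _); exact: (pcan_inj (GenTree.codeK _)).
by apply: smallT_seq => //; do 2![apply: smallT_sum => //].
Qed.

End SkolemPower.

Definition fixes (X : Type) (B : set X) (s : X -> X) : Prop :=
  forall b, B b -> s b = b.

Section Saturation.
Variables (L : language) (T : set (sentence L)) (K : Type) (U : structure L).
Hypothesis U_monster : monster K T U.

Lemma monster_nat : smallT K nat.
Proof.
have [_ /small_setT h _ _] := U_monster; apply: smallT_embeds h.
by exists (fun n => Eq (Var L n) (Var L n)) => n n' [].
Qed.

(** The hull generated by the variables in [D] and the parameters in [A] is small, so it embeds into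
    U. There the copy of [A] has the type of [A]; an automorphism maps [A] to this copy, and its
    inverse takes the realization back over [A]. *)
Theorem monster_saturated (V : Type) (D : set V) (A : set U)
    (Sig : set (formula L (V + U))) :
  small K D -> small K A ->
  (forall phi, Sig phi -> vars phi `<=` D /\ params phi `<=` A) ->
  (forall s, (forall phi, List.In phi s -> Sig phi) ->
    exists a : V -> U, forall phi, List.In phi s -> sat (with_params a) phi) ->
  exists a : V -> U, forall phi, Sig phi -> sat (with_params a) phi.
Proof.
move=> /smallE sD /smallE sA SigDA fin.
have [UT /small_setT sL Uuniv Uhom] := U_monster.
have [u0] := carrier_inhabited U.
pose Mod phi := [set a : V -> U | sat (with_params a) phi].
have [|F [FU FSig]] := @ultra_ext (V -> U) (Mod @` Sig).
  move=> s hs.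
  have [s' [hs' hs'']] : exists s', (forall phi, List.In phi s' -> Sig phi) /\
      (forall B, List.In B s -> exists2 phi, List.In phi s' & B = Mod phi).
    elim: s hs => [|B s IH] hs; first by exists [::].
    have [s' [h1 h2]] := IH (fun C h => hs C (or_intror h)).
    have [phi Sphi <-] := hs B (or_introl erefl).
    exists (phi :: s'); split=> [psi [<-|/h1]//|C [<-|/h2[psi]]].
      by exists phi => //; left.
    by exists psi => //; right.
  have [a ha] := fin s' hs'; exists a => B /hs''[phi /ha h ->] //.
pose gen (p : {v | D v} + {u | A u}) (a : V -> U) :=
  match p with inl v => a (sval v) | inr u => sval u end.
have sM : small K [set: skolem_power F gen].
  apply/small_setT; apply: smallT_skolem_power => //; first exact: monster_nat.
  by apply: smallT_sum => //; exact: monster_nat.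
have MT : models (skolem_power F gen) T.
  move=> s /UT Us; apply/sat_skolem_power.
  by apply: filterS filterT => a _; apply: sat_eq Us.
have [h hE] := Uuniv _ MT sM.
have hs W (e : W -> _) phi : sat (h \o (skolem_gen F gen \o e)) phi <->
    F [set a | sat (fun w => gen (e w) a) phi].
  by rewrite -(elementary_embedding_sat hE); exact: sat_skolem_gen.
pose f u := if pselect (A u) is left Au then h (skolem_gen F gen (inr (exist _ u Au))) else u.
have [||s [sauto sf]] := Uhom A f.
- exact/smallE.
- move=> phi phiA; have [k [g [psi [phiE gP]]]] := fmap_ord phi.
  pose g' i : {v | D v} + {u | A u} := inr (exist _ (g i) (phiA _ (gP i))).
  rewrite phiE !sat_fmap.
  have -> : sat (f \o g) psi <-> F [set a | sat (id \o g) psi].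
    rewrite -(hs _ g' psi); apply: sat_eq_iff => i; rewrite /= /f.
    case: pselect => [Au|]; last by case; exact: (phiA _ (gP i)).
    by congr (h (skolem_gen _ _ (inr _))); apply: eq_exist.
  split=> [Us|/filter_ex[] //]; exact: filterS filterT.
have [s' [s'auto ss' s's]] := automorphism_inv sauto.
pose a v := s' (if pselect (D v) is left Dv then
  h (skolem_gen F gen (inl (exist _ v Dv))) else u0).
exists a => phi Sphi; have [Dphi Aphi] := SigDA _ Sphi.
have [k [g [psi [phiE gP]]]] := fmap_ord phi.
have /choice[g' g'P] : forall i, exists p : {v | D v} + {u | A u},
    match g i, p with
    | inl v, inl v' => v = sval v'
    | inr u, inr u' => u = sval u'
    | _, _ => False
    end.
  move=> i; have := gP i; case: (g i) => [v|u] hv.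
    by exists (inl (exist _ v (Dphi _ hv))).
  by exists (inr (exist _ u (Aphi _ hv))).
have := FSig (Mod phi) (imageP Mod Sphi).
rewrite /Mod phiE => H.
have /(hs _ g' psi) : F [set a | sat (fun w => gen (g' w) a) psi].
  apply: filterS H => b /= /sat_fmap; apply: sat_eq => i /=.
  by have := g'P i; case: (g i) => [v|u]; case: (g' i) => //= ? ->.
rewrite -(sat_automorphism _ _ s'auto) sat_fmap; apply: sat_eq => i /=.
have := g'P i; case: (g i) => [v|u]; case: (g' i) => //= w e.
  rewrite /a; case: pselect => [Dv|]; last by case; rewrite e; exact: svalP.
  by do 2!congr (_ _); congr (skolem_gen _ _ (inl _)); exact: sval_inj.
apply: (can_inj ss'); rewrite s's sf; last by apply: mem_set; rewrite e; exact: svalP.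
rewrite /f; case: pselect => [Au|]; last by case; rewrite e; exact: svalP.
by congr (h (skolem_gen _ _ (inr _))); exact: sval_inj.
Qed.

(* Types being complete, one inclusion says that [e] and [e'] have the same type. *)
Definition tp_le (V : Type) (D : set V) (B : set U) (e e' : V -> U) : Prop :=
  forall phi : formula L (V + U), vars phi `<=` D -> params phi `<=` B ->
    sat (with_params e) phi -> sat (with_params e') phi.

Theorem monster_homogeneous (V : Type) (D : set V) (B : set U) (e e' : V -> U) :
  small K D -> small K B -> tp_le D B e e' ->
  exists s, [/\ automorphism s, fixes B s & forall v, D v -> s (e v) = e' v].
Proof.
move=> sD sB ee'; have [UT sL Uuniv Uhom] := U_monster.
have ee'2 (phi : formula L (V + U)) : vars phi `<=` D -> params phi `<=` B ->
    sat (with_params e) phi <-> sat (with_params e') phi.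
  move=> vD pB; split; first exact: ee'.
  move=> h; apply: contrapT => n.
  apply: (ee' (Neg phi)) => //; rewrite /vars /params /=.
    by move=> v /= []// /vD.
  by move=> v /= []// /pB.
have /choice[g gP] : forall u, exists z : V + U, (B `|` e @` D) u ->
    (match z with inl v => D v | inr u => B u end) /\ with_params e z = u.
  move=> u; have [Bu|nB] := pselect (B u); first by exists (inr u).
  have [[v Dv <-]|nD] := pselect ((e @` D) u); first by exists (inl v).
  by exists (inr u) => -[].
pose f u := with_params e' (g u).
have gsat (phi : formula L U) : fv phi `<=` B `|` e @` D ->
    [/\ vars (fmap g phi) `<=` D & params (fmap g phi) `<=` B].
  move=> h; split=> [v|u]; rewrite /vars /params /= fv_fmap => -[w wphi gw].
    by have := gP w (h _ wphi); rewrite gw => -[].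
  by have := gP w (h _ wphi); rewrite gw => -[].
have [||s [sauto sf]] := Uhom (B `|` e @` D) f.
- apply: small_setU => //; first exact: monster_nat.
  exact: small_image.
- move=> phi h; have [h1 h2] := gsat _ h.
  have := ee'2 _ h1 h2; rewrite !sat_fmap => <-; apply: sat_ext => u /h hu /=.
  by have [_ ->] := gP u hu.
(* [g u] is only one of the possible names of [u]. Any other name [z] leads to the same value,
   because the equation between the two names passes from [e] to [e']. *)
have fE z : (match z with inl v => D v | inr u => B u end) ->
    f (with_params e z) = with_params e' z.
  move=> hz; set u := with_params e z.
  have hu : (B `|` e @` D) u.
    by rewrite /u; case: (z) hz => [v|b] h; [right; exists v|left].
  have [h1 h2] := gP u hu.
  apply: (ee' (Eq (Var L (g u)) (Var L z))); rewrite /vars /params /=.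
  + by move=> v /= [gv|zv]; [move: h1; rewrite -gv|move: hz; rewrite -zv].
  + by move=> v /= [gv|zv]; [move: h1; rewrite -gv|move: hz; rewrite -zv].
  + by rewrite h2.
exists s; split => // [b Bb|v Dv].
  by rewrite sf; [exact: (fE (inr b))|apply: mem_set; left].
by rewrite sf; [exact: (fE (inl v))|apply: mem_set; right; exists v].
Qed.

End Saturation.

(** * Chains of realizations of global types *)

Lemma finite_set_In (X : Type) (A : set X) : finite_set A ->
  exists s, forall x, A x <-> List.In x s.
Proof.
move=> /finite_ord[k [h hP]]; exists [seq h i | i <- enum 'I_k] => x.
rewrite hP List.in_map_iff; split=> -[i]; last by move=> [<- _]; exists i.
move=> <-; exists i; split => //.
have : i \in enum 'I_k by rewrite mem_enum.
elim: (enum _) => //= j s IH; rewrite inE => /orP[/eqP ->|/IH]; first by left.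
by right.
Qed.

Lemma finite_In (X : Type) (s : seq X) : finite_set [set x | List.In x s].
Proof.
elim: s => [|x s IH] /=; first by rewrite -[X in finite_set X]/set0.
rewrite (_ : [set _ | _] = [set x] `|` [set y | List.In y s]).
  by rewrite finite_setU; split => //; exact: finite_set1.
by apply/seteqP; split=> y [->|]; [left|right|left|right].
Qed.

Section GlobalTypes.
Variables (L : language) (T : set (sentence L)) (K : Type) (U : structure L).
Hypothesis U_monster : monster K T U.

Let K_nat := monster_nat U_monster.

Section OneType.
Variables (V : Type) (D : set V) (p : set (formula L (V + U))).
Hypothesis pS : Stype D [set: U] p.

Lemma Stype_vars phi : p phi -> vars phi `<=` D.
Proof. by case: pS => h _ _ /h[]. Qed.

Lemma Stype_sat s : (forall phi, List.In phi s -> p phi) ->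
  exists a : V -> U, forall phi, List.In phi s -> sat (with_params a) phi.
Proof.
case: pS => _ _ h hs; have [|a ha] := h [set phi | List.In phi s] (finite_In s).
  by move=> phi /hs.
by exists a.
Qed.

Lemma vars_Neg (W : Type) (phi : formula L (V + W)) : vars (Neg phi) = vars phi.
Proof. by apply/seteqP; split=> v /=; rewrite /vars /=; [case|left]. Qed.

Lemma params_Neg (W : Type) (phi : formula L (V + W)) : params (Neg phi) = params phi.
Proof. by apply/seteqP; split=> v /=; rewrite /params /=; [case|left]. Qed.

Lemma Stype_Neg phi : vars phi `<=` D -> p (Neg phi) <-> ~ p phi.
Proof.
move=> vD; split=> [pn pp|np].
  have [|a ha] := @Stype_sat [:: phi; Neg phi].
    by move=> psi /= [<-|[<-|]].
  by apply: (ha (Neg phi)); [right; left|apply: ha; left].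
by case: pS => _ /(_ phi vD (@subsetT _ _))[].
Qed.

Lemma realizes_sat B a phi : realizes_over p B a -> vars phi `<=` D ->
  params phi `<=` B -> p phi <-> sat (with_params a) phi.
Proof.
move=> aB vD pB; split=> [h|h]; first exact: aB.
apply: contrapT => /(Stype_Neg vD) np; have := aB _ np; rewrite params_Neg.
by move=> /(_ pB); apply.
Qed.

Lemma realizes_ext B a a' : (forall v, D v -> a v = a' v) ->
  realizes_over p B a -> realizes_over p B a'.
Proof.
move=> aa' aB phi pphi pB; have := aB _ pphi pB; apply: (iffLR (sat_ext _)).
by move=> [v|u] // hv /=; apply: aa'; exact: Stype_vars pphi _ hv.
Qed.

Lemma realizes_mono B B' a : B' `<=` B ->
  realizes_over p B a -> realizes_over p B' a.
Proof. by move=> BB' aB phi pphi pB; apply: aB => //; exact: subset_trans BB'. Qed.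

Lemma realizes_tp B a a' : realizes_over p B a -> realizes_over p B a' ->
  tp_le D B a a'.
Proof. by move=> aB a'B phi vD pB /(realizes_sat aB vD pB) h; exact: a'B. Qed.

Lemma Stype_realize B : small K D -> small K B -> exists a, realizes_over p B a.
Proof.
move=> sD sB; have [|s|a ha] := monster_saturated U_monster
    (Sig := [set phi | p phi /\ params phi `<=` B]) sD sB.
- by move=> phi [/Stype_vars].
- by move=> hs; apply: Stype_sat => phi /hs[].
by exists a => phi pphi pB; apply: ha.
Qed.

Definition map_params (W W' : Type) (s : W -> W') (z : V + W) : V + W' :=
  match z with inl v => inl v | inr u => inr (s u) end.

Lemma vars_map_params (W W' : Type) (s : W -> W') (phi : formula L (V + W)) :
  vars (fmap (map_params s) phi) = vars phi.
Proof.
apply/seteqP; split=> v; rewrite /vars /= fv_fmap; last by exists (inl v).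
by move=> [[w|w] h //= [<-]].
Qed.

Lemma params_map_params (W W' : Type) (s : W -> W') (phi : formula L (V + W)) :
  params (fmap (map_params s) phi) = s @` params phi.
Proof.
apply/seteqP; split=> v; rewrite /params /= fv_fmap.
  by move=> [[w|w] h //= [<-]]; exists w.
by move=> [w h <-]; exists (inr w).
Qed.

Lemma invariant_automorphism A (s : U -> U) phi : invariant_over A p ->
  automorphism s -> fixes A s -> p phi -> p (fmap (map_params s) phi).
Proof.
move=> pA sauto sA; have [k [d [psi [-> dP]]]] := fmap_plug phi.
move=> h; rewrite fmap_comp.
rewrite (_ : fmap _ psi = fmap (plug (s \o d)) psi); last first.
  by apply: fmap_ext => -[].
apply: pA h => chi chiA.
rewrite -(sat_automorphism (with_params d) chi sauto); apply: sat_ext => -[v|u] //= hu.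
by rewrite sA //; exact: chiA.
Qed.

Lemma fixes_inv (X : Type) (A : set X) (s s' : X -> X) : fixes A s -> cancel s s' -> fixes A s'.
Proof. by move=> sA ss' b /sA bb; rewrite -[b in LHS]bb ss'. Qed.

Lemma realizes_automorphism A s B a : invariant_over A p ->
  automorphism s -> fixes A s -> realizes_over p B a ->
  realizes_over p (s @` B) (s \o a).
Proof.
move=> pA sauto sA aB phi pphi pB.
have [s' [s'auto ss' s's]] := automorphism_inv sauto.
have := invariant_automorphism pA s'auto (fixes_inv sA ss') pphi.
move=> /aB; rewrite params_map_params => h.
have /sat_fmap : sat (with_params a) (fmap (map_params s') phi).
  by apply: h => _ [u /pB [v Bv <-] <-]; rewrite ss'.
rewrite -(sat_automorphism _ _ sauto); apply: sat_eq => -[v|u] //=.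
Qed.

End OneType.

Section Chains.
Variables (Lam V : Type) (D : Lam -> set V) (p : Lam -> set (formula L (V + U))).
Variable A0 : set U.
Hypotheses (pS : forall l, Stype (D l) [set: U] (p l))
  (pA0 : forall l, invariant_over A0 (p l)) (sD : forall l, small K (D l)).

Fixpoint chain (B : set U) (w : seq (Lam * (V -> U))) : Prop :=
  match w with
  | [::] => True
  | x :: w' => realizes_over (p x.1) B x.2 /\ chain (B `|` x.2 @` D x.1) w'
  end.

Fixpoint supp (w : seq (Lam * (V -> U))) : set U :=
  match w with [::] => set0 | x :: w' => x.2 @` D x.1 `|` supp w' end.

(* Realizations of [p l] and [p l'] may be taken in either order. *)
Definition rcomm (l l' : Lam) : Prop :=
  forall B e f, small K B -> A0 `<=` B -> realizes_over (p l) B e ->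
    realizes_over (p l') (B `|` e @` D l) f ->
    realizes_over (p l) (B `|` f @` D l') e.

Lemma supp_cat w w' : supp (w ++ w') = supp w `|` supp w'.
Proof. by elim: w => [|x w IH] /=; rewrite ?set0U // IH setUA. Qed.

Lemma small_supp w : small K (supp w).
Proof.
elim: w => [|x w IH] /=; first exact/small_finite/finite_set0.
by apply: small_setU => //; exact: small_image.
Qed.

Lemma chain_mono B B' w : B' `<=` B -> chain B w -> chain B' w.
Proof.
elim: w B B' => [//|x w IH] B B' BB' /= [h1 h2]; split.
  exact: realizes_mono h1.
by apply: IH h2; exact: setSU.
Qed.

Lemma chain_cat B w w' : chain B (w ++ w') <-> chain B w /\ chain (B `|` supp w) w'.
Proof.
elim: w B => [|x w IH] B /=; first by rewrite setU0; tauto.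
by rewrite IH setUA; tauto.
Qed.

Lemma chain_mask B m w : chain B w -> chain B (mask m w).
Proof.
elim: w m B => [|x w IH] [|[] m] B //= [h1 h2]; first by split => //; exact: IH.
by apply: IH; apply: chain_mono h2; exact: subsetUl.
Qed.

Lemma chain_swap B x y w : small K B -> A0 `<=` B -> rcomm x.1 y.1 ->
  chain B [:: x, y & w] -> chain B [:: y, x & w].
Proof.
move=> sB AB c /= [h1 [h2 h3]]; split; first by apply: realizes_mono h2; exact: subsetUl.
by split; [exact: c|rewrite -setUA (setUC (y.2 @` _)) setUA].
Qed.

Lemma chain_front B x w w' : small K B -> A0 `<=` B ->
  (forall y, List.In y w -> rcomm y.1 x.1) ->
  chain B (w ++ x :: w') -> chain B (x :: w ++ w').
Proof.
elim: w B => [//|y w IH] B sB AB c /= [h1 h2].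
apply: (@chain_swap B y x (w ++ w')) => //; first by apply: c; left.
split => //; apply: IH => //.
- by apply: small_setU => //; exact: small_image.
- by move=> u /AB; left.
- by move=> z hz; apply: c; right.
Qed.

Lemma chain_blocks B w w' : small K B -> A0 `<=` B ->
  (forall x y, List.In x w -> List.In y w' -> rcomm x.1 y.1) ->
  chain B (w ++ w') -> chain B (w' ++ w).
Proof.
elim: w' w B => [|y w' IH] w B sB AB c; first by rewrite cats0.
move=> /(chain_front sB AB) h.
have /= [h1 h2] := h (fun x hx => c _ _ hx (or_introl erefl)).
split=> //; apply: IH => //.
- by apply: small_setU => //; exact: small_image.
- by move=> u /AB; left.
- by move=> x z hx hz; apply: c => //; right.
Qed.

Section Named.
Variables (I : eqType) (l : I -> Lam).
Implicit Types (e : I -> V -> U) (w : seq I).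

Definition named e w := [seq (l t, e t) | t <- w].

Lemma named_cat e w w' : named e (w ++ w') = named e w ++ named e w'.
Proof. exact: map_cat. Qed.

Lemma In_named e w x : List.In x (named e w) <-> exists2 t, t \in w & x = (l t, e t).
Proof.
elim: w => [|t w IH] /=; first by split=> // -[].
rewrite IH; split=> [[<-|[u uw ->]]|[u]].
- by exists t; rewrite ?mem_head.
- by exists u; rewrite // inE uw orbT.
- by rewrite inE => /orP[/eqP -> ->|uw ->]; [left|right; exists u].
Qed.

Lemma supp_namedP e w u : supp (named e w) u <->
  exists t v, [/\ t \in w, D (l t) v & e t v = u].
Proof.
elim: w u => [|t w IH] u /=; first by split=> // -[t [v []]].
split=> [[[v Dv <-]|/IH[s [v [sw Dv <-]]]]|[s [v [+ Dv <-]]]].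
- by exists t, v; rewrite mem_head.
- by exists s, v; rewrite inE sw orbT.
- rewrite inE => /orP[/eqP <-|sw]; first by left; exists v.
  by right; apply/IH; exists s, v.
Qed.

Lemma chain_ext B e e' w :
  (forall t v, t \in w -> D (l t) v -> e t v = e' t v) ->
  chain B (named e w) -> chain B (named e' w).
Proof.
elim: w B => [//|t w IH] B ee' /= [h1 h2]; split.
  by apply: realizes_ext h1 => // v Dv; apply: ee' => //; rewrite mem_head.
rewrite (_ : e' t @` D (l t) = e t @` D (l t)).
  by apply: IH h2 => s v sw; apply: ee'; rewrite inE sw orbT.
by apply: eq_imagel => v Dv; rewrite ee' // mem_head.
Qed.

Lemma chain_subset_sorted (R : rel I) B e w w' : transitive R -> irreflexive R ->
  sorted R w -> sorted R w' -> {subset w <= w'} ->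
  chain B (named e w') -> chain B (named e w).
Proof.
move=> Rt Ri sw sw' ww' h.
have -> : w = [seq t <- w' | t \in w].
  apply: (irr_sorted_eq Rt Ri) => //; first exact: sorted_filter.
  by move=> t; rewrite mem_filter /=; case tw: (t \in w) => //=; rewrite ww'.
have /subseqP[m _ ->] := filter_subseq (fun t => t \in w) w'.
by rewrite /named map_mask; exact: chain_mask.
Qed.

(** Insertion sort by exchanges of neighbours: commutation is required only for the pairs that [R1]
    and [R2] order differently. *)
Lemma chain_perm (R1 R2 : rel I) B e w w' : small K B -> A0 `<=` B ->
  uniq w -> perm_eq w w' -> pairwise R1 w -> pairwise R2 w' ->
  (forall t s, t \in w -> s \in w -> R1 t s -> R2 s t -> rcomm (l t) (l s)) ->
  chain B (named e w) -> chain B (named e w').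
Proof.
elim: w' w B => [|t w' IH] w B sB AB uw ww' p1 p2 c.
  by have /perm_nilP -> := ww'.
have tw : t \in w by rewrite (perm_mem ww') mem_head.
case/splitPr: tw uw ww' p1 c => w1 w2 uw ww' p1 c.
have ww : perm_eq (w1 ++ t :: w2) (t :: w1 ++ w2).
  by rewrite -cat1s perm_catCA.
have {}ww' : perm_eq (w1 ++ w2) w'.
  by rewrite -(perm_cons t) -(permPl ww).
rewrite named_cat => h.
have sub s : s \in w1 ++ w2 -> s \in w1 ++ t :: w2.
  by rewrite (perm_mem ww) inE => ->; rewrite orbT.
have [h1 h2] : chain B (named e (t :: w1 ++ w2)).
  rewrite (_ : named _ _ = (l t, e t) :: named e w1 ++ named e w2); last first.
    by rewrite /named /= map_cat.
  apply: chain_front => //.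
  move=> y /In_named[s sw1 ->] /=; apply: c.
  - by rewrite mem_cat sw1.
  - by rewrite mem_cat mem_head orbT.
  - move: p1; rewrite pairwise_cat => /and3P[/allrelP + _ _].
    by apply => //; rewrite mem_head.
  - move: p2 => /= /andP[/allP p2 _]; apply: p2.
    by rewrite -(perm_mem ww') mem_cat sw1.
split=> //; apply: IH h2 => //.
- by apply: small_setU => //; exact: small_image.
- by move=> u /AB; left.
- by move: uw; rewrite (perm_uniq ww) /= => /andP[].
- move: p1; rewrite !pairwise_cat /= allrel_consr.
  by move=> /and3P[/andP[_ ->] -> /andP[_ ->]].
- by move: p2 => /= /andP[].
- by move=> s s' /sub ? /sub ?; exact: c.
Qed.

Lemma chain_automorphism s B e w : automorphism s -> fixes A0 s ->
  chain B (named e w) -> chain (s @` B) (named (fun t => s \o e t) w).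
Proof.
move=> sauto sA; elim: w B => [//|t w IH] B /= [h1 h2]; split.
  exact: realizes_automorphism h1.
by move/IH: h2; rewrite image_setU image_comp.
Qed.

Lemma fixes_image (B : set U) s : fixes B s -> s @` B = B.
Proof.
move=> sB; apply/seteqP; split=> [_ [b Bb <-]|b Bb]; first by rewrite sB.
by exists b => //; exact: sB.
Qed.

Lemma fixes_sub (B B' : set U) s : B' `<=` B -> fixes B s -> fixes B' s.
Proof. by move=> BB' sB b /BB'; exact: sB. Qed.

(** A chain along a given word has only one type over the base. The first items are conjugate over
    [B]; once they are identified they join the base, and the argument is repeated. *)
Lemma chain_conj B e e' w : small K B -> A0 `<=` B ->
  chain B (named e w) -> chain B (named e' w) ->
  exists s, [/\ automorphism s, fixes B s &
    forall t v, t \in w -> D (l t) v -> s (e t v) = e' t v].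
Proof.
elim: w B e => [|t w IH] B e sB AB.
  by exists id; split => //; exact: automorphism_id.
move=> /= [h1 h2] [h1' h2'].
have [s [sauto sf se]] := monster_homogeneous U_monster (sD (l t)) sB
  (realizes_tp (pS _) h1 h1').
have {}h2 := chain_automorphism sauto (fixes_sub AB sf) h2.
have im : s @` (B `|` e t @` D (l t)) = B `|` e' t @` D (l t).
  rewrite image_setU fixes_image // image_comp; congr (_ `|` _).
  by apply: eq_imagel => v Dv /=; rewrite se.
rewrite im in h2.
have [||s' [s'auto s'f s'e]] := IH _ _ _ _ h2 h2'.
- by apply: small_setU => //; exact: small_image.
- by move=> u /AB; left.
exists (s' \o s); split.
- exact: automorphism_comp.
- by move=> b Bb /=; rewrite sf // s'f //; left.
- move=> r v; rewrite inE => /orP[/eqP ->|rw] Dv /=.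
    by rewrite se // s'f //; right; exists v.
  by rewrite s'e.
Qed.

Lemma chain_exists B w : small K B -> uniq w -> exists e, chain B (named e w).
Proof.
have [u0] := carrier_inhabited U.
elim: w B => [|t w IH] B sB; first by exists (fun _ _ => u0).
move=> /= /andP[tw uw].
have [a ha] := Stype_realize (pS (l t)) (sD _) sB.
have [|e he] := IH (B `|` a @` D (l t)) _ uw.
  by apply: small_setU => //; exact: small_image.
exists (fun s => if s == t then a else e s); rewrite eqxx; split => //.
apply: chain_ext he => s v sw _; case: eqP => // st.
by rewrite -st sw in tw.
Qed.

End Named.

Section Infinite.
Import Order.TTheory.
Variables (d : Order.disp_t) (I : orderType d) (l : I -> Lam).

(** Being a chain is not a condition on single formulas. [Sig] therefore collects the formulas that
    hold in every chain along some finite word, and finitely many of them are satisfied by a chain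
    along the union of their words. *)
Lemma infinite_chain B : small K B -> A0 `<=` B ->
  small K [set x : I * V | D (l x.1) x.2] ->
  exists c : I -> V -> U, forall w, sorted (fun i j => (i < j)%O) w -> chain B (named l c w).
Proof.
set D' := [set x : I * V | D (l x.1) x.2] => sB AB sD'.
pose lt := (fun i j : I => (i < j)%O).
pose curry (e : I -> V -> U) (x : I * V) := e x.1 x.2.
pose Sig := [set phi : formula L ((I * V) + U) | [/\ vars phi `<=` D',
  params phi `<=` B & exists w, [/\ sorted lt w, (forall x, vars phi x -> x.1 \in w) &
    forall e, chain B (named l e w) -> sat (with_params (curry e)) phi]]].
have ltt : transitive lt by exact: lt_trans.
have lti : irreflexive lt by exact: ltxx.
have [|s hs|a ha] := @monster_saturated _ _ _ _ U_monster _ D' B Sig sD' sB.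
- by move=> phi [].
- have [w [sw wP]] : exists w, sorted lt w /\ forall phi, List.In phi s ->
      forall e, chain B (named l e w) -> sat (with_params (curry e)) phi.
    elim: s hs => [|phi s IH] hs; first by exists [::].
    have [|w [sw wP]] := IH; first by move=> psi h; apply: hs; right.
    have [_ _ [w' [sw' _ wP']]] := hs phi (or_introl erefl).
    exists (sort (fun i j => (i <= j)%O) (undup (w ++ w'))).
    have st : sorted lt (sort (fun i j => (i <= j)%O) (undup (w ++ w'))).
      by rewrite sort_lt_sorted undup_uniq.
    split=> // psi [<-|hpsi] e he; [apply: wP'|apply: (wP _ hpsi)];
      apply: (chain_subset_sorted ltt lti _ st _ he) => // i iw;
      by rewrite mem_sort mem_undup mem_cat iw ?orbT.
  have [e he] := @chain_exists _ l B w sB (sorted_uniq ltt lti sw).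
  by exists (curry e) => phi /wP; apply.
exists (fun i v => a (i, v)) => w sw.
have [e he] := @chain_exists _ l B w sB (sorted_uniq ltt lti sw).
(* On the word [w] the realization [a] has the type of a genuine chain, hence is conjugate to it
   over [B], and such automorphisms preserve chains. *)
have [||s [sauto sf se]] := @monster_homogeneous _ _ _ _ U_monster _
    (D' `&` [set x | x.1 \in w]) B (curry e) a _ sB.
- by apply: small_sub sD' => x [].
- move=> phi vphi pphi sphi; apply: ha; split => //.
    by move=> x /vphi[].
  exists w; split => // [x /vphi[]//|e' he'].
  have [s [sauto sf se]] := chain_conj sB AB he he'.
  move: sphi; rewrite -(sat_automorphism _ _ sauto); apply: (iffLR (sat_ext _)).
  move=> [[i v]|u] hv /=; last by rewrite sf //; exact: pphi.
  by have [Dv iw] := vphi _ hv; exact: se.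
have := chain_automorphism sauto (fixes_sub AB sf) he.
rewrite fixes_image //; apply: chain_ext => i v iw Dv.
by rewrite /= (se (i, v)).
Qed.

End Infinite.
End Chains.
End GlobalTypes.

(** * Products of invariant types *)

Section Products.
Variables (L : language) (T : set (sentence L)) (K : Type) (U : structure L).
Hypothesis U_monster : monster K T U.

Let K_nat := monster_nat U_monster.

Lemma Stype_eq (V : Type) (D : set V) (p q : set (formula L (V + U))) :
  Stype D [set: U] p -> Stype D [set: U] q ->
  (forall B, finite_set B -> exists e, realizes_over p B e /\ realizes_over q B e) ->
  p = q.
Proof.
move=> pS qS h; apply/seteqP; split=> phi pphi; have [e [ep eq]] := h _ (finite_params phi).
- have vD := Stype_vars pS pphi.
  by apply/(realizes_sat qS eq vD (@subset_refl _ _)); apply: ep.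
- have vD := Stype_vars qS pphi.
  by apply/(realizes_sat pS ep vD (@subset_refl _ _)); apply: eq.
Qed.

(** Tuples with the same type over the small set [A] are conjugate over it, so automorphisms suffice
    to test invariance. *)
Lemma automorphism_invariant (V : Type) (A : set U) (p : set (formula L (V + U))) :
  small K A ->
  (forall s phi, automorphism s -> fixes A s -> p phi -> p (fmap (map_params s) phi)) ->
  invariant_over A p.
Proof.
move=> sA h k phi d d' dd' pphi.
have [||s [sauto sf se]] := @monster_homogeneous _ _ _ _ U_monster _ [set: 'I_k] A d d' _ sA.
- by apply: (small_finite K_nat).
- by move=> psi _ /dd' ->.
have := h _ _ sauto sf pphi; rewrite fmap_comp.
by rewrite (@fmap_ext _ _ _ _ (plug d')) // => -[v|i] //= _; rewrite se.
Qed.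

Section Product.
Variables (V : Type) (D E : set V) (p q : set (formula L (V + U))) (A : set U).
Hypotheses (pS : Stype D [set: U] p) (qS : Stype E [set: U] q)
  (qA : invariant_over A q) (sA : small K A) (sD : small K D).

(** The definition of the product quantifies over all realizations [a] and over some base. One
    realization decides, since any two are conjugate over [A] and the parameters, and a realization
    over the union of two bases compares them. *)
Lemma product_realizes B a phi : small K B -> A `<=` B -> params phi `<=` B ->
  realizes_over p B a -> product K D p q phi <-> q (fmap (instantiate D a) phi).
Proof.
have conj a' a'' : realizes_over p (A `|` params phi) a' ->
    realizes_over p (A `|` params phi) a'' ->
    q (fmap (instantiate D a') phi) -> q (fmap (instantiate D a'') phi).
  move=> h1 h2.
  have sAp : small K (A `|` params phi).
    by apply: small_setU => //; apply: small_finite => //; exact: finite_params.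
  have [s [sauto sf se]] := monster_homogeneous U_monster sD sAp (realizes_tp pS h1 h2).
  have sfA : fixes A s by move=> u Au; apply: sf; left.
  move=> /(invariant_automorphism qA sauto sfA); rewrite fmap_comp.
  rewrite (@fmap_ext _ _ _ _ (instantiate D a'')) // => -[v|u] /= hv.
    by case: ifPn => // /set_mem Dv /=; rewrite se.
  by rewrite sf //; right.
move=> sB AB pB aB.
have aB' : realizes_over p (A `|` params phi) a.
  by apply: realizes_mono aB => u [/AB|/pB].
split=> [[A' [sA' qA' h]]|h]; last first.
  by exists A; split => // a' ha'; exact: conj h.
have [|a' ha'] := Stype_realize U_monster pS (B := A' `|` B) sD.
  exact: small_setU.
apply: (conj a') => //.
  by apply: realizes_mono ha' => u [/AB|/pB]; right.
by apply: h; apply: realizes_mono ha' => u [|/pB]; [left|right].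
Qed.

Lemma vars_instantiate a (phi : formula L (V + U)) :
  vars (fmap (instantiate D a) phi) = vars phi `\` D.
Proof.
apply/seteqP; split=> v; rewrite /vars /= fv_fmap.
  move=> [[w|u] //= h]; case: ifPn => // /negP nD [<-].
  by split => // Dw; apply: nD; exact: mem_set.
move=> [h nD]; exists (inl v) => //=; rewrite ifF //.
by apply/negP => /set_mem.
Qed.

Lemma params_instantiate a (phi : formula L (V + U)) :
  params (fmap (instantiate D a) phi) `<=` params phi `|` a @` D.
Proof.
move=> u; rewrite /params /= fv_fmap => -[[w|w] /= h].
  by case: ifPn => // /set_mem Dw [<-]; right; exists w.
by move=> [<-]; left.
Qed.

Lemma sat_instantiate a b (phi : formula L (V + U)) :
  sat (with_params b) (fmap (instantiate D a) phi) <->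
  sat (with_params (fun v => if v \in D then a v else b v)) phi.
Proof. by rewrite sat_fmap; apply: sat_eq_iff => -[v|u] //=; case: ifP. Qed.

Lemma Stype_product : Stype (D `|` E) [set: U] (product K D p q).
Proof.
have real (phi : formula L (V + U)) : exists a, realizes_over p (A `|` params phi) a.
  apply: (Stype_realize U_monster pS sD).
  by apply: small_setU => //; apply: small_finite => //; exact: finite_params.
have inst (phi : formula L (V + U)) : exists a, product K D p q phi <-> q (fmap (instantiate D a) phi).
  have [a ha] := real phi; exists a; apply: product_realizes ha.
  - by apply: small_setU => //; apply: small_finite => //; exact: finite_params.
  - exact: subsetUl.
  - exact: subsetUr.
split.
- move=> phi; have [a ->] := inst phi => /(Stype_vars qS); rewrite vars_instantiate.
  move=> h; split=> // v hv; have [|] := pselect (D v); first by left.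
  by move=> nD; right; apply: h.
- move=> phi vDE _; have [a ha] := real phi.
  have sp : small K (A `|` params phi).
    by apply: small_setU => //; apply: small_finite => //; exact: finite_params.
  rewrite (product_realizes sp _ _ ha); [|exact: subsetUl|exact: subsetUr].
  rewrite (product_realizes sp _ _ ha); [|exact: subsetUl|by rewrite params_Neg; exact: subsetUr].
  case: qS => _ /(_ (fmap (instantiate D a) phi)) + _; apply; last exact: subsetT.
  by rewrite vars_instantiate => v [/vDE[]].
- move=> F /finite_set_In[s hs] Fp.
  pose B := A `|` \bigcup_(phi in F) params phi.
  have sB : small K B.
    apply: small_setU => //; apply: small_finite => //; apply: bigcup_finite.
      by rewrite (_ : F = [set x | List.In x s]);
        [exact: finite_In|apply/seteqP; split=> x /hs].
    by move=> phi _; exact: finite_params.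
  have [a ha] := Stype_realize U_monster pS sD sB.
  have [|b hb] := Stype_sat qS (s := [seq fmap (instantiate D a) phi | phi <- s]).
    move=> psi; rewrite List.in_map_iff => -[phi [<- /hs Fphi]].
    apply/(product_realizes sB _ _ ha); [exact: subsetUl| |exact: Fp].
    by move=> u hu; right; exists phi.
  exists (fun v => if v \in D then a v else b v) => phi /hs Fphi.
  apply/sat_instantiate; apply: hb; rewrite List.in_map_iff; exists phi; split => //.
Qed.

Lemma invariant_product : invariant_over A p -> invariant_over A (product K D p q).
Proof.
move=> pA; apply: automorphism_invariant => // s phi sauto sf.
have sAp (psi : formula L (V + U)) : small K (A `|` params psi).
  by apply: small_setU => //; apply: small_finite => //; exact: finite_params.
have [a ha] := Stype_realize U_monster pS sD (sAp phi).
rewrite (product_realizes (sAp phi) _ _ ha); [|exact: subsetUl|exact: subsetUr].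
move=> /(invariant_automorphism qA sauto sf).
have ha' := realizes_automorphism pA sauto sf ha.
have im : s @` (A `|` params phi) = A `|` params (fmap (map_params s) phi).
  by rewrite image_setU (fixes_image sf) params_map_params.
rewrite im in ha'.
rewrite (product_realizes (sAp (fmap (map_params s) phi)) _ _ ha');
  [|exact: subsetUl|exact: subsetUr].
rewrite !fmap_comp (@fmap_ext _ _ _ _ (instantiate D (s \o a) \o map_params s)) //.
by move=> [v|u] //= _; case: ifP.
Qed.

Lemma realizes_product B e : small K B -> A `<=` B -> (forall v, D v -> ~ E v) ->
  realizes_over (product K D p q) B e <->
  realizes_over p B e /\ realizes_over q (B `|` e @` D) e.
Proof.
move=> sB AB DE; have prS := Stype_product; split=> [h|[h1 h2] phi prphi pB].
  have h1 : realizes_over p B e.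
    move=> phi pphi pB; apply: h => //.
    have [a ha] := Stype_realize U_monster pS sD sB.
    have vE : vars (fmap (instantiate D a) phi) `<=` E.
      by rewrite vars_instantiate => v [hv []]; exact: Stype_vars pS _ pphi _ hv.
    apply/(product_realizes sB AB pB ha); apply: contrapT => /(Stype_Neg qS vE) n.
    have [|b hb] := Stype_sat qS (s := [:: fmap (instantiate D a) (Neg phi)]).
      by move=> psi [<-|].
    have := hb _ (or_introl erefl); rewrite sat_instantiate; apply.
    have := ha _ pphi pB; apply: (iffLR (sat_ext _)) => -[v|u] //= hv.
    by rewrite mem_set //; exact: Stype_vars pS _ pphi _ hv.
  split => // psi qpsi pB.
  (* Each parameter of [psi] that comes from [e] is turned back into a variable of [D], which gives
     a formula of the product with parameters in [B]. *)
  have /choice[g gP] : forall u, exists z : V + U, (B `|` e @` D) u ->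
      match z with inl v => D v /\ e v = u | inr u' => B u' /\ u' = u end.
    move=> u; have [Bu|nB] := pselect (B u); first by exists (inr u).
    have [[v Dv <-]|nD] := pselect ((e @` D) u); first by exists (inl v).
    by exists (inr u) => -[].
  pose gg (z : V + U) := match z with inl v => inl v | inr u => g u end.
  pose phi := fmap gg psi.
  have phipsi : fmap (instantiate D e) phi = psi.
    rewrite fmap_comp -[RHS]fmap_id; apply: fmap_ext => -[v|u] hv /=.
      rewrite ifF //; apply/negP => /set_mem Dv; apply: (DE v Dv).
      exact: Stype_vars qS _ qpsi _ hv.
    have := gP u (pB _ hv); case: (g u) => [v|u'] [] /= h2 -> //.
    by rewrite mem_set.
  have phiB : params phi `<=` B.
    move=> u; rewrite /params /= fv_fmap => -[[v|u'] hv //= gu].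
    by have := gP u' (pB _ hv); rewrite gu => -[].
  have prphi : product K D p q phi.
    by apply/(product_realizes sB AB phiB h1); rewrite phipsi.
  have := h _ prphi phiB; rewrite -phipsi sat_instantiate.
  by apply: sat_eq => -[v|u] //=; case: ifP.
have := prphi; rewrite (product_realizes sB AB pB h1) => qphi.
have := h2 _ qphi; rewrite sat_instantiate => hh.
have : sat (with_params (fun v => if v \in D then e v else e v)) phi.
  apply: hh; apply: subset_trans (@params_instantiate _ _) _.
  exact: setSU.
by apply: sat_eq => -[v|u] //=; case: ifP.
Qed.

End Product.

Lemma Stype_trivial (V : Type) : Stype set0 [set: U] (@trivial_type L U V).
Proof.
have ext (phi : formula L (V + U)) : vars phi = set0 -> forall a b : V -> U,
    sat (with_params a) phi -> sat (with_params b) phi.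
  move=> v0 a b; apply: (iffLR (sat_ext _)) => -[v|u] //= hv.
  by have : vars phi v by []; rewrite v0.
have [u0] := carrier_inhabited U.
split.
- by move=> phi [-> _]; split.
- move=> phi v0 _; have {}v0 : vars phi = set0 by apply/seteqP; split.
  have [h|h] := pselect (sat (with_params (fun=> u0)) phi).
    by left; split => //; exists (fun=> u0).
  by right; split; [rewrite vars_Neg|exists (fun=> u0)].
- move=> F _ Ft; exists (fun=> u0) => phi /Ft[v0 [a ha]].
  by apply: ext ha.
Qed.

Lemma invariant_trivial (V : Type) A : small K A ->
  invariant_over A (@trivial_type L U V).
Proof.
move=> sA; apply: automorphism_invariant => // s phi sauto sf [v0 [a ha]].
split; first by rewrite vars_map_params.
exists (s \o a); rewrite sat_fmap.
by move: ha; rewrite -(sat_automorphism _ _ sauto); apply: sat_eq => -[v|u].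
Qed.

Section Iterated.
Variables (V : Type) (n : nat) (D : 'I_n -> set V) (p : 'I_n -> set (formula L (V + U))).
Variable A : set U.
Hypotheses (pS : forall i, Stype (D i) [set: U] (p i))
  (pA : forall i, invariant_over A (p i)) (sA : small K A)
  (sD : forall i, small K (D i)) (Dtriv : forall i j v, D i v -> D j v -> i = j).

Definition wproduct (w : seq 'I_n) : set (formula L (V + U)) :=
  foldr (fun i q => product K (D i) (p i) q) (@trivial_type L U V) w.

Definition wvars (w : seq 'I_n) : set V := [set v | exists2 i, i \in w & D i v].

Lemma wvars_cons i w : wvars (i :: w) = D i `|` wvars w.
Proof.
apply/seteqP; split=> v.
  by move=> [j]; rewrite inE => /orP[/eqP ->|jw] h; [left|right; exists j].
by move=> [h|[j jw h]]; [exists i; rewrite ?mem_head|exists j; rewrite // inE jw orbT].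
Qed.

Lemma wproductS w : Stype (wvars w) [set: U] (wproduct w) /\ invariant_over A (wproduct w).
Proof.
elim: w => [|i w [IH1 IH2]] /=.
  split; last exact: invariant_trivial.
  have -> : wvars [::] = set0 by apply/seteqP; split=> v // -[].
  exact: Stype_trivial.
rewrite wvars_cons; split; first exact: (Stype_product (pS i) IH1 IH2).
exact: (invariant_product (pS i) IH2).
Qed.

(** The bridge from products to chains. A single assignment [e] carries all the tuples, which is
    possible because their variables are disjoint. *)
Lemma realizes_wproduct B e w : small K B -> A `<=` B -> uniq w ->
  realizes_over (wproduct w) B e <-> chain D p B (named id (fun _ => e) w).
Proof.
elim: w B => [|i w IH] B sB AB /=.
  move=> _; split=> // _ phi [v0 [a ha]] _.
  move: ha; apply: (iffLR (sat_ext _)) => -[v|u] //= hv.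
  by have : vars phi v by []; rewrite v0.
move=> /andP[iw uw]; have [h1 h2] := wproductS w.
rewrite (realizes_product (pS i) h1 h2) //; last first.
  by move=> v iv [j jw jv]; rewrite (Dtriv iv jv) jw in iw.
rewrite IH //.
  by apply: small_setU => //; exact: small_image.
by move=> u /AB; left.
Qed.

Let disj i j : i <> j -> forall v, D i v -> ~ D j v.
Proof. by move=> ij v h h'; apply: ij; exact: Dtriv h h'. Qed.

Lemma commute_rcomm i j : i <> j -> commute K (D i) (D j) (p i) (p j) ->
  rcomm K D p A i j.
Proof.
move=> ij c B e f sB AB he hf.
pose g v := if v \in D i then e v else f v.
have gi v : D i v -> e v = g v by move=> h; rewrite /g mem_set.
have gj v : D j v -> f v = g v.
  move=> h; rewrite /g; case: ifP => // /set_mem h'.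
  by case: ij; exact: Dtriv h' h.
have im : g @` D i = e @` D i by apply: eq_imagel => v /gi.
have imj : g @` D j = f @` D j by apply: eq_imagel => v /gj.
have : realizes_over (product K (D i) (p i) (p j)) B g.
  apply/(realizes_product (pS i) (pS j) (@pA j) sA (sD i) g sB AB (disj ij)).
  split; first exact: (realizes_ext (pS i) gi).
  by rewrite im; exact: (realizes_ext (pS j) gj).
rewrite c (realizes_product (pS j) (pS i) (@pA i) sA (sD j) g sB AB (disj (nesym ij))).
rewrite imj => -[_ h]; apply: (realizes_ext (pS i)) h.
by move=> v /gi.
Qed.

Lemma rcomm_commute i j : i <> j -> rcomm K D p A i j ->
  commute K (D i) (D j) (p i) (p j).
Proof.
move=> ij c; have Sij := Stype_product (pS i) (pS j) (@pA j) sA (sD i).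
have Sji := Stype_product (pS j) (pS i) (@pA i) sA (sD j).
rewrite setUC in Sji; apply: Stype_eq Sij Sji _ => B0 fB0.
pose B := A `|` B0.
have sB : small K B by apply: small_setU => //; exact: small_finite.
have AB : A `<=` B by left.
have [e he] := Stype_realize U_monster (pS i) (sD i) sB.
have sB' : small K (B `|` e @` D i) by apply: small_setU => //; exact: small_image.
have [f hf] := Stype_realize U_monster (pS j) (sD j) sB'.
pose g v := if v \in D i then e v else f v.
have gi v : D i v -> e v = g v by move=> h; rewrite /g mem_set.
have gj v : D j v -> f v = g v.
  move=> h; rewrite /g; case: ifP => // /set_mem h'.
  by case: ij; exact: Dtriv h' h.
have im : g @` D i = e @` D i by apply: eq_imagel => v /gi.
have imj : g @` D j = f @` D j by apply: eq_imagel => v /gj.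
exists g; split; apply: (@realizes_mono _ _ _ _ B); try by right.
  apply/(realizes_product (pS i) (pS j) (@pA j) sA (sD i) g sB AB (disj ij)).
  split; first exact: (realizes_ext (pS i) gi).
  by rewrite im; exact: (realizes_ext (pS j) gj).
apply/(realizes_product (pS j) (pS i) (@pA i) sA (sD j) g sB AB (disj (nesym ij))).
have cf := c _ _ _ sB AB he hf.
split; first by apply: (realizes_ext (pS j) gj); apply: realizes_mono hf; left.
by rewrite imj; apply: (realizes_ext (pS i) gi).
Qed.

End Iterated.
End Products.

(** * Determinacy of products in m-distal theories *)

Section DistalProducts.
Import Order.TTheory GRing.Theory Num.Theory.
Variables (L : language) (T : set (sentence L)) (K : Type) (U : structure L).
Hypothesis U_monster : monster K T U.
Variables (m : nat) (U_distal : m_distal m K U).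

Let K_nat := monster_nat U_monster.

(* Positions in a sequence with [m.+2] blocks of order type Z: block [k] is
   [{2k} * Z], and the [i]-th cut is at [(2i+1, 0)]. *)
Definition position := (nat *l int)%type.
Definition index_type := ('I_m.+2 * int)%type.
Definition block_pos (x : index_type) : position := ((val x.1).*2, x.2).
Definition cut_pos (i : 'I_m.+1) : position := ((val i).*2.+1, 0%R).
Definition index_le : rel index_type := fun x y => (block_pos x <= block_pos y)%O.
Definition insertion_pos (S : {set 'I_m.+1}) (u : index_type + {i : 'I_m.+1 | i \in S}) :
  position := match u with inl x => block_pos x | inr i => cut_pos (sval i) end.

Lemma insertion_posE S u v : insertion_le index_le fst u v =
  (@insertion_pos S u <= @insertion_pos S v)%O.
Proof.
case: u v => [x|i] [y|j] //=; rewrite /block_pos /cut_pos lexi_pair !leEnat.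
- by rewrite leq_Sdouble ltn_double ltnNge; case: (_ <= _)%N.
- by rewrite leq_Sdouble ltn_double ltnNge; case: (_ <= _)%N.
- by rewrite ltnS leq_double lexx implybT andbT.
Qed.

Lemma index_Dedekind : Dedekind index_le fst.
Proof.
split.
- by move=> i; exists (i, 0%R).
- move=> [x z] [y z']; rewrite /index_le /block_pos lexi_pair => /andP[].
  by rewrite leEnat leq_double.
- move=> i [x z] /= xi; exists (x, z + 1)%R; split => //.
  rewrite /index_le /block_pos lexi_pair !lexx /=.
  by rewrite -ltNge ltrDl.
- move=> i [x z] /= xi; exists (x, z - 1)%R; split => //.
  rewrite /index_le /block_pos lexi_pair !lexx /=.
  by rewrite -ltNge gtrDl oppr_lt0.
Qed.

Lemma block_pos_inj : injective block_pos.
Proof. by move=> [x z] [y z'] [] /double_inj /val_inj -> ->. Qed.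

Lemma index_le_linear : linear_order index_le.
Proof.
split=> [x y xy|x y z|x y]; last exact: le_total.
  by apply: block_pos_inj; exact: le_anti.
exact: le_trans.
Qed.

Lemma index_infinite : infinite_set [set: index_type].
Proof.
apply/infiniteP/card_le_embeds; apply: embeds_trans (embeds_setT _).
exists (fun n => (ord0, Posz (sval n))) => x y [] e.
by apply: sval_inj.
Qed.

Variables (V : Type) (n : nat) (D : 'I_n -> set V) (p : 'I_n -> set (formula L (V + U))).
Variable A : set U.
Hypotheses (pS : forall i, Stype (D i) [set: U] (p i))
  (pA : forall i, invariant_over A (p i)) (sA : small K A)
  (sD : forall i, small K (D i)) (Dtriv : forall i j v, D i v -> D j v -> i = j)
  (prc : forall i j, i <> j -> rcomm K D p A i j).

Notation item := (position *l 'I_n)%type.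

(** * Indiscernible sequences obtained from chains *)

Section Indiscernible.
Variables (S : {set 'I_n}) (B : set U) (c : item -> V -> U).
Hypotheses (sB : small K B) (AB : A `<=` B).
Variable J : set position.

Definition items (js : seq position) : seq item := [seq (j, l) : item | j <- js, l <- enum S].

Hypothesis chainJ : forall js, (forall j, j \in js -> J j) ->
  sorted (fun j j' => (j < j')%O) js -> chain D p B (named (snd : item -> 'I_n) c (items js)).

Variable X : Type.
Variable letter : X -> 'I_n * V + {b | B b}.
Hypothesis letterP : forall x l v, letter x = inl (l, v) -> l \in S /\ D l v.

(** Every tuple repeats all elements of [B], which turns indiscernibility over [B] into plain
    indiscernibility. *)
Definition item_tuple (j : position) (x : X) : U :=
  match letter x with inl (l, v) => c (j, l) v | inr b => sval b end.

(** Two increasing selections of positions give chains along the same word, and these are conjugate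
    over [B]. *)
Lemma items_indiscernible (I : Type) (le : rel I) (pos : I -> position) :
  (forall u v, le u v = (pos u <= pos v)%O) -> (forall u, J (pos u)) ->
  indiscernible (U := U) le (fun u => item_tuple (pos u)).
Proof.
move=> lepos posJ k phi.
suff H (i i' : 'I_k -> I) : (forall a b : 'I_k, (a < b)%N -> ~~ le (i b) (i a)) ->
    (forall a b : 'I_k, (a < b)%N -> ~~ le (i' b) (i' a)) ->
    sat (fun v => item_tuple (pos (i v.1)) v.2) phi ->
    sat (fun v => item_tuple (pos (i' v.1)) v.2) phi.
  have [[i [iinc hi]]|n1] := pselect (exists i : 'I_k -> I,
      (forall a b : 'I_k, (a < b)%N -> ~~ le (i b) (i a)) /\
      sat (fun v => item_tuple (pos (i v.1)) v.2) phi).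
    by left=> i' i'inc; exact: H hi.
  by right=> i' i'inc hi'; apply: n1; exists i'.
move=> iinc i'inc.
pose W : seq ('I_k * 'I_n) := [seq (a, l) | a <- enum 'I_k, l <- enum S].
have cW (f : 'I_k -> I) : (forall a b : 'I_k, (a < b)%N -> ~~ le (f b) (f a)) ->
    chain D p B (named (snd : 'I_k * 'I_n -> 'I_n) (fun t => c (pos (f t.1), t.2)) W).
  move=> finc.
  have := chainJ (js := [seq pos (f a) | a <- enum 'I_k]).
  rewrite /named /items /W.
  rewrite (_ : map _ (allpairs _ _ _) = [seq (t.2, c (pos (f t.1), t.2)) |
      t <- [seq (a, l) | a <- enum 'I_k, l <- enum S]]); last first.
    elim: (enum 'I_k) => //= a s IH; rewrite !map_cat IH; congr (_ ++ _).
    by rewrite -!map_comp.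
  apply; first by move=> j /mapP[a _ ->].
  have : sorted ltn (map val (enum 'I_k)) by rewrite val_enum_ord iota_ltn_sorted.
  rewrite !sorted_map; apply: sub_sorted => a b /finc; by rewrite lepos -ltNge.
have [s [sauto sf se]] := chain_conj U_monster pS pA sD sB AB (cW i iinc) (cW i' i'inc).
rewrite -(sat_automorphism _ _ sauto); apply: sat_eq => -[a x] /=.
rewrite /item_tuple; case e: (letter x) => [[l v]|[b Bb]] /=; last exact: sf.
have [lS Dv] := letterP e.
apply: (se (a, l) v) => //.
by apply: allpairs_f; rewrite ?mem_enum.
Qed.

End Indiscernible.

(* [R B e] stands for: [e] realizes a fixed global type over [B]. *)
Variable R : set U -> (V -> U) -> Prop.
Hypotheses (R_mono : forall B B' e, B' `<=` B -> R B e -> R B' e)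
  (R_ex : forall B, small K B -> exists e, R B e)
  (R_chain : forall B e e' w, small K B -> A `<=` B -> R B e -> R B e' ->
    chain D p B (named id (fun _ => e) w) -> chain D p B (named id (fun _ => e') w)).

Lemma small_wvars w : small K (wvars D w).
Proof.
elim: w => [|i w IH]; last by rewrite wvars_cons; apply: small_setU.
apply: small_finite => //; rewrite (_ : wvars _ _ = set0) //.
by apply/seteqP; split=> v // -[].
Qed.

Definition good (S : {set 'I_n}) : Prop := forall B e, small K B -> A `<=` B ->
  R B e -> chain D p B (named id (fun _ => e) (enum S)).

(** * The induction step on sets of variables *)

Section Step.
Variables (S : {set 'I_n}) (S_card : (m < #|S|)%N).
Hypothesis S_good : forall S' : {set 'I_n}, S' \proper S -> good S'.
(** The first [m] elements of [S] are groups by themselves and all the others form the last group,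
    so that no group is empty when [S] has more than [m] elements. *)
Definition gamma (l : 'I_n) : 'I_m.+1 := inord (minn m (index l (enum S))).

Lemma gamma_surj k : exists2 l, l \in S & gamma l = k.
Proof.
have kS : (k < size (enum S))%N by rewrite -cardE; exact: leq_ltn_trans (ltn_ord k : (k <= m)%N) S_card.
have [l0 _] : exists l0, l0 \in S.
  by apply/card_gt0P; exact: leq_ltn_trans S_card.
exists (nth l0 (enum S) k); first by rewrite -mem_enum mem_nth.
rewrite /gamma index_uniq ?enum_uniq //; apply: val_inj.
by rewrite /= inordK (minn_idPr _) // -ltnS.
Qed.


Definition cut_of (l : 'I_n) : position := cut_pos (gamma l).

Section Sequence.
Variables (B : set U) (c1 c3 : item -> V -> U) (e : V -> U).
Hypotheses (sB : small K B) (AB : A `<=` B).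
Notation lt := (fun t s : item => (t < s)%O).
Let itl : item -> 'I_n := snd.
Hypothesis c1_chain : forall w, sorted lt w -> chain D p B (named itl c1 w).
Let B1 := B `|` [set u | exists t v, D (itl t) v /\ c1 t v = u].
Hypotheses (sB1 : small K B1) (e_R : R B1 e).
Let B3 := B1 `|` [set u | exists l v, D l v /\ e v = u].
Hypothesis c3_chain : forall w, sorted lt w -> chain D p B3 (named itl c3 w).

Definition stage (t : item) : nat :=
  if (t.1 < cut_of t.2)%O then 0 else if t.1 == cut_of t.2 then 1 else 2.

(* Realized in three successive stages: the items below the cut of their
   letter, then [e] itself in the cuts, then the items above the cuts. *)
Definition cseq (t : item) : V -> U :=
  if stage t is 0 then c1 t else if stage t is 1 then e else c3 t.

(** The positions present when only the cuts in [S'] are filled. *)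
Definition avoids (S' : {set 'I_m.+1}) : set position :=
  [set j | forall i, j = cut_pos i -> i \in S'].

(** The order in which the items are realized. Those of stage 1 are parts of the single [e] and are
    left unordered. *)
Let before (t s : item) : bool := (stage t < stage s)%N ||
  (stage t == stage s) && (if stage t == 1 then t.2 != s.2 else (t < s)%O).

Lemma items_sorted (js : seq position) :
  sorted (fun j j' => (j < j')%O) js -> sorted lt (items S js).
Proof.
have sS : sorted (fun l l' : 'I_n => (l < l')%N) (enum S).
  have : sorted (fun l l' : 'I_n => (l < l')%N) (enum 'I_n).
    have : sorted ltn (map val (enum 'I_n)) by rewrite val_enum_ord iota_ltn_sorted.
    by rewrite sorted_map.
  rewrite [enum S](_ : _ = [seq l <- enum 'I_n | l \in S]); last first.
    by rewrite enumT.
  by apply: sorted_filter => x y z; exact: ltn_trans.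
rewrite !sorted_pairwise; [|exact: lt_trans|exact: lt_trans].
have {}sS : pairwise (fun l l' : 'I_n => (l < l')%N) (enum S).
  by rewrite -sorted_pairwise // => x y z; exact: ltn_trans.
elim: js => [//|j js IH] /= /andP[/allP jjs /IH {}IH].
rewrite /items /= pairwise_cat -/(items S js) IH andbT; apply/andP; split.
  apply/allrelP => _ _ /mapP[l _ ->] /allpairsP[[j' l'] [/= j'js _ ->]].
  by rewrite ltxi_pair (ltW (jjs _ j'js)) /= leNgt (jjs _ j'js).
rewrite pairwise_map; apply: sub_pairwise sS => l l' ll'.
by rewrite /= ltxi_pair lexx.
Qed.

(** Since the cut [k] stays empty, the letters that sit at their own cut form a proper subset of
    [S], where [S_good] applies to [e]. This makes [cseq] a chain in the order of realization, which
    is then rearranged into the order of positions. *)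
Lemma cseq_chain (S' : {set 'I_m.+1}) k js : k \notin S' ->
  (forall j, j \in js -> avoids S' j) -> sorted (fun j j' => (j < j')%O) js ->
  chain D p B (named itl cseq (items S js)).
Proof.
move=> kS' jsS' sjs; set W := items S js.
have sW : sorted lt W by exact: items_sorted.
have uW : uniq W by apply: sorted_uniq sW; [exact: lt_trans|exact: ltxx].
have memW t : t \in W = (t.1 \in js) && (t.2 \in S).
  apply/allpairsP/andP => [[[j l] [/= jjs lS ->]]|[tj tS]].
    by rewrite mem_enum in lS.
  by exists (t.1, t.2); rewrite mem_enum; split => //; case: (t).
pose S2 := [set l in S | gamma l \in S'].
have S2S : S2 \proper S.
  apply/properP; split; first by apply/fintype.subsetP => l; rewrite inE => /andP[].
  have [l lS lk] := gamma_surj k; exists l => //.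
  by rewrite inE lS lk (negPf kS').
pose W1 := [seq t <- W | stage t == 0].
pose W2 : seq item := [seq (cut_of l, l) : item | l <- [seq l <- enum S2 | cut_of l \in js]].
pose W3 := [seq t <- W | stage t == 2].
have st_cut l : stage (cut_of l, l) = 1 by rewrite /stage ltxx eqxx.
have st1 t : stage t = 1 -> t = (cut_of t.2, t.2).
  by rewrite /stage; case: ifP => // _; case: eqP => // <- _; case: (t).
have st_lt3 t : (stage t < 3)%N by rewrite /stage; case: ifP => //; case: ifP.
have memW2 t : t \in W2 = (t \in W) && (stage t == 1).
  apply/mapP/andP => [[l]|[tW /eqP/st1 te]].
    rewrite mem_filter mem_enum inE => /andP[ljs /andP[lS _]] ->.
    by rewrite memW ljs lS st_cut.
  move: tW; rewrite memW => /andP[tj tS].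
  exists t.2 => //; rewrite mem_filter mem_enum inE tS /=.
  have tc : t.1 = cut_of t.2 by rewrite [in LHS]te.
  by rewrite -tc tj (jsS' _ tj (gamma t.2)).
have lt_pw : pairwise lt W by rewrite -sorted_pairwise //; exact: lt_trans.
have pw : pairwise before (W1 ++ W2 ++ W3).
  have filt a : a != 1 -> pairwise before [seq t <- W | stage t == a].
    move=> a1; have := pairwise_filter (fun t => stage t == a) lt_pw.
    apply: sub_in_pairwise (allss _) => t s; rewrite !mem_filter.
    move=> /andP[/eqP ta _] /andP[/eqP sa _] ts; rewrite /before ta sa ltnn eqxx /=.
    by rewrite (negPf a1).
  rewrite !pairwise_cat allrel_catr !filt //= andbT -!andbA; apply/and4P; split.
  - apply/allrelP => t s; rewrite mem_filter memW2 => /andP[/eqP t0 _] /andP[_ /eqP s1].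
    by rewrite /before t0 s1.
  - apply/allrelP => t s; rewrite !mem_filter => /andP[/eqP t0 _] /andP[/eqP s1 _].
    by rewrite /before t0 s1.
  - apply/allrelP => t s; rewrite mem_filter memW2 => /andP[_ /eqP t0] /andP[/eqP s1 _].
    by rewrite /before t0 s1.
  - rewrite pairwise_map.
    have : uniq [seq l <- enum S2 | cut_of l \in js] by rewrite filter_uniq ?enum_uniq.
    rewrite uniq_pairwise; apply: sub_pairwise => l l' ll' /=.
    by rewrite /before !st_cut ltnn eqxx.
have uw : uniq (W1 ++ W2 ++ W3).
  rewrite uniq_pairwise; apply: sub_pairwise pw => t s; apply: contraTneq => ->.
  by rewrite /before ltnn eqxx /=; case: ifP => _; rewrite ?eqxx ?ltxx.
have pe : perm_eq (W1 ++ W2 ++ W3) W.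
  apply: uniq_perm => // t; rewrite !mem_cat !mem_filter memW2.
  by have := st_lt3 t; case: (stage t) => [|[|[]]] // _; case: (t \in W).
(* For items of one letter the stage increases with the position, so the two orders agree on them.
   Only items of different letters are exchanged, and their types commute. *)
apply: (chain_perm U_monster (R1 := before) (R2 := lt) sD sB AB uw pe pw lt_pw).
  move=> t s _ _ ts st; apply: prc => /= tsl.
  have s1t1 : (s.1 < t.1)%O.
    move: st; case: (t) (s) tsl => [j l] [j' l'] /= ->.
    rewrite ltxi_pair ltxx implybF -ltNge => /andP[j'j nj].
    by rewrite lt_neqAle j'j andbT; apply: contraTneq nj => ->; rewrite ltxx.
  have st_le : (stage s <= stage t)%N.
    rewrite /stage /itl in tsl *; rewrite tsl; case: (ltP t.1) => h1.
      by rewrite (lt_trans s1t1 h1).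
    case: (eqVneq t.1) => h2.
      have h3 : (t.1 <= cut_of s.2)%O by rewrite h2.
      by rewrite (lt_le_trans s1t1 h3).
    by case: ifP => // _; case: ifP.
  move: ts; rewrite /before ltnNge st_le /= (tsl : t.2 = s.2) eqxx => /andP[_].
  by case: ifP => // _ /(lt_trans st); rewrite ltxx.
have cW1 : chain D p B (named itl cseq W1).
  apply: (chain_ext pS (e := c1)); last first.
    by apply: c1_chain; apply: sorted_filter sW; exact: lt_trans.
  by move=> t v; rewrite mem_filter /cseq => /andP[/eqP ->].
have sub1 w : B `|` supp D (named itl cseq [seq t <- w | stage t == 0]) `<=` B1.
  move=> u [Bu|/supp_namedP[t [v [+ Dv <-]]]]; first by left.
  by rewrite mem_filter /cseq => /andP[/eqP -> _]; right; exists t, v.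
have cW2 : chain D p B1 (named itl cseq W2).
  have := S_good S2S sB1 (subset_trans AB (@subsetUl _ _ _)) e_R.
  have /subseqP[msk _ e2] := filter_subseq (fun l => cut_of l \in js) (enum S2).
  rewrite (_ : named itl cseq W2 =
      named id (fun _ => e) [seq l <- enum S2 | cut_of l \in js]); last first.
    by rewrite /named /W2 -map_comp; apply: eq_map => l /=; rewrite /cseq st_cut.
  by rewrite e2 /named map_mask; exact: chain_mask.
rewrite !named_cat !chain_cat; split => //; split.
  by apply: chain_mono cW2; exact: sub1.
apply: (@chain_mono _ _ _ _ _ _ B3); last first.
  apply: (chain_ext pS (e := c3)); last first.
    by apply: c3_chain; apply: sorted_filter sW; exact: lt_trans.
  by move=> t v; rewrite mem_filter /cseq => /andP[/eqP ->].
move=> u [/sub1|/supp_namedP[t [v [+ Dv <-]]]]; first by left.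
by rewrite memW2 /cseq => /andP[_ /eqP ->]; right; exists t.2, v.
Qed.

(** By m-distality all cuts may be filled at once. Then the m+1 fillers have the same type as m+1
    terms of the sequence, and since the tuples contain [B], an automorphism over [B] takes the
    latter to the former. Taking from each tuple the letters of its group, one obtains [e] from
    items already known to form a chain. *)
Lemma cseq_good : chain D p B (named id (fun _ => e) (enum S)).
Proof.
pose X := ({v | wvars D (enum S) v} + {b | B b})%type.
have /choice[lab labP] : forall v : {v | wvars D (enum S) v}, exists l, l \in S /\ D l (sval v).
  by move=> [v [l lS Dv]]; exists l; rewrite -mem_enum.
pose letter (x : X) : 'I_n * V + {b | B b} :=
  match x with inl v => inl (lab v, sval v) | inr b => inr b end.
have letterP x l v : letter x = inl (l, v) -> l \in S /\ D l v.
  by case: x => //= v' [<- <-]; exact: labP.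
pose b j : X -> U := item_tuple (B := B) cseq letter j.
have ind (S' : {set 'I_m.+1}) k : k \notin S' -> inserts index_le (b \o block_pos) fst (b \o cut_pos) S'.
  move=> kS'; rewrite /inserts.
  rewrite (_ : @insertion _ _ _ _ _ _ = fun u => b (@insertion_pos S' u)); last first.
    by apply: funext => -[x|[i iS']].
  apply: (items_indiscernible (S := S) (c := cseq) sB AB (J := avoids S') _ letterP (@insertion_posE S')).
    by move=> js jsJ sjs; exact: cseq_chain kS' jsJ sjs.
  move=> [x|[i iS']] i'; first by move=> [] /(congr1 odd) /=; rewrite !odd_double.
  by move=> [] /double_inj /val_inj <-.
have X_small : small K [set: X].
  apply/small_setT; apply: smallT_sum => //; last exact/smallE.
  by apply/smallE; apply: small_wvars.
have b_ind : indiscernible_sequence K index_le (b \o block_pos).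
  split; [exact: index_le_linear|exact: index_infinite| |].
    by apply/small_setT; exact: smallT_countType.
  rewrite (_ : b \o _ = fun x => b (block_pos x)) //.
  apply: (@items_indiscernible S B cseq sB AB (avoids finset.set0) _ X letter letterP index_type index_le block_pos (fun _ _ => erefl)).
    move=> js jsJ sjs; apply: (cseq_chain (S' := finset.set0) (k := ord0)) jsJ sjs.
    by rewrite inE.
  by move=> x i' [] /(congr1 odd) /=; rewrite !odd_double.
have full : inserts index_le (b \o block_pos) fst (b \o cut_pos) [set: 'I_m.+1].
  apply: contrapT => nfull.
  have [|S' [cS' nS']] := U_distal X_small _ b_ind erefl index_Dedekind nfull.
    by exists index_type, index_le, (b \o block_pos).
  have /fintype.subsetPn[k _ kS'] : ~~ ([set: 'I_m.+1]%SET \subset S').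
    by apply/negP => /subset_leq_card; rewrite cardsT card_ord cS' ltnn.
  exact: nS' (ind _ _ kS').
pose i1 (k : 'I_m.+1) : index_type + {i : 'I_m.+1 | i \in [set: 'I_m.+1]%SET} :=
  inr (exist _ k (finset.in_setT k)).
(* The points 0, ..., m of the first block: they increase like the cuts and lie in none of them. *)
pose i2 (k : 'I_m.+1) : index_type + {i : 'I_m.+1 | i \in [set: 'I_m.+1]%SET} :=
  inl (ord0, Posz k).
pose g (f : 'I_m.+1 -> position) (x : X) : U :=
  match x with inl v => cseq (f (gamma (lab v)), lab v) (sval v) | inr b => sval b end.
have gE (phi : formula L X) : sat (g cut_pos) phi -> sat (g (fun k => block_pos (ord0, Posz k))) phi.
  have gsat f : sat (g f) phi <-> sat (fun v => b (f v.1) v.2)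
      (fmap (fun x : X => (if x is inl v then gamma (lab v) else ord0, x)) phi).
    by rewrite sat_fmap; apply: sat_eq_iff => -[v|u].
  set psi := fmap _ phi in gsat.
  have inc1 (j k : 'I_m.+1) : (j < k)%N -> ~~ insertion_le index_le fst (i1 k) (i1 j).
    by move=> jk; rewrite /= -ltnNge.
  have inc2 (j k : 'I_m.+1) : (j < k)%N -> ~~ insertion_le index_le fst (i2 k) (i2 j).
    move=> jk; rewrite /= /index_le /block_pos lexi_pair !lexx /= -ltNge.
    by rewrite ltz_nat.
  have [h|h] := full _ psi; first by move=> _; apply/gsat; exact: h inc2.
  by move=> /gsat h'; case: (h i1 inc1).
have [||s [sauto sf se]] := @monster_homogeneous _ _ _ _ U_monster X [set: X] set0
    (g cut_pos) (g (fun k => block_pos (ord0, Posz k))) X_small.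
- exact/small_finite/finite_set0.
- move=> phi _ p0; have [|psi ->] := @fmap_factor _ _ _ inl phi.
    by move=> [x|u] hv; [exists x|case: (p0 u hv)].
  rewrite !sat_fmap => h; have := gE psi; apply.
  by apply: sat_eq h.
have [s' [s'auto ss' s's]] := automorphism_inv sauto.
have sB0 : fixes B s by move=> u Bu; apply: (se (inr (exist _ u Bu))).
have s'A : fixes A s' by apply: fixes_sub AB _; exact: (fixes_inv sB0).
pose pt l : item := (block_pos (ord0, Posz (gamma l)), l).
(* Each letter of [S] is read at the point of its group. As the letters are pairwise distinct,
   commutation lets them be listed in the order of [enum S]. *)
have cpt : chain D p B (named itl cseq [seq pt l | l <- enum S]).
  pose js := [seq block_pos (ord0, Posz k) | k <- iota 0 m.+1].
  have sjs : sorted (fun j j' => (j < j')%O) js.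
    rewrite sorted_map; have := iota_ltn_sorted 0 m.+1; apply: sub_sorted => j k jk.
    by rewrite /= /block_pos ltxi_pair lexx /= ltz_nat.
  have h : chain D p B (named itl cseq (items S js)).
    apply: (cseq_chain (S' := finset.set0) (k := ord0)) sjs; first by rewrite inE.
    by move=> j /mapP[k _ ->] i' [] /(congr1 odd) /=; rewrite !odd_double.
  have sW := items_sorted sjs.
  have lt_pw : pairwise lt (items S js) by rewrite -sorted_pairwise //; exact: lt_trans.
  set w := [seq pt l | l <- enum S].
  have uw : uniq w by rewrite map_inj_uniq ?enum_uniq // => l l' [].
  have uW : uniq (items S js) by apply: sorted_uniq sW; [exact: lt_trans|exact: ltxx].
  have wW : {subset w <= items S js}.
    move=> t /mapP[l lS ->]; apply: allpairs_f => //; apply/mapP; exists (val (gamma l)) => //.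
    by rewrite mem_iota /= add0n.
  pose w' := [seq t <- items S js | t \in w].
  have /subseqP[msk _ e2] := filter_subseq (fun t => t \in w) (items S js).
  have h' : chain D p B (named itl cseq w').
    by rewrite /w' e2 /named map_mask; exact: chain_mask.
  apply: (chain_perm U_monster (R1 := lt) (R2 := fun t t' => t.2 != t'.2) sD sB AB _ _ _ _ _ h').
  - by rewrite filter_uniq.
  - apply: uniq_perm => //; first by rewrite filter_uniq.
    by move=> t; rewrite mem_filter; case tw: (t \in w) => //=; rewrite (wW _ tw).
  - exact: pairwise_filter.
  - rewrite pairwise_map /=; have := enum_uniq (mem S); rewrite uniq_pairwise.
    by apply: sub_pairwise.
  - by move=> t t' _ _ _ /eqP tt'; apply: prc => e'; apply: tt'.
have {}cpt := chain_automorphism pA s'auto s'A cpt.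
rewrite (fixes_image (fixes_inv sB0 ss')) in cpt.
have {}cpt : chain D p B (named id (fun l => s' \o cseq (pt l)) (enum S)).
  by move: cpt; rewrite /named -map_comp.
apply: (chain_ext pS) cpt => l v lS Dv /=.
have Dv' : wvars D (enum S) v by exists l.
have [_ Dv''] := labP (exist _ v Dv'); have ll := Dtriv Dv Dv''.
have := se (inl (exist _ v Dv')) I; rewrite /g /= -ll /pt => <-.
by rewrite ss' /cseq /stage ltxx eqxx.
Qed.

End Sequence.

(** The sequence is built around a realization [e] over a base containing its lower part; [R_chain]
    transfers the conclusion to the given [e0], which satisfies [R] over [B] as [e] does. *)
Lemma distal_step : good S.
Proof.
move=> B e0 sB AB e0R.
have items_small : small K [set x : item * V | D x.1.2 x.2].
  apply: (@small_sub _ _ _ ([set: item] `*` wvars D (enum 'I_n))).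
    by move=> [t v] /= Dv; split => //; exists t.2; rewrite ?mem_enum.
  apply: small_setX => //; last exact: (small_wvars (enum 'I_n)).
  apply/small_setT; apply: smallT_prod => //; last exact: smallT_countType.
  by apply: smallT_prod => //; exact: smallT_countType.
have [c1 c1P] := infinite_chain U_monster pS pA sD (l := snd : item -> 'I_n) sB AB items_small.
pose B1 := B `|` [set u | exists (t : item) v, D t.2 v /\ c1 t v = u].
have sB1 : small K B1.
  apply: small_setU => //; apply: small_sub (small_image (fun x => c1 x.1 x.2) items_small).
  by move=> u [t [v [Dv <-]]]; exists (t, v).
have [e eR] := R_ex sB1.
pose B3 := B1 `|` [set u | exists l v, D l v /\ e v = u].
have sB3 : small K B3.
  apply: small_setU => //; apply: small_sub (small_image e (small_wvars (enum 'I_n))).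
  by move=> u [l [v [Dv <-]]]; exists v => //; exists l; rewrite ?mem_enum.
have AB3 : A `<=` B3 by move=> u /AB Bu; left; left.
have [c3 c3P] := infinite_chain U_monster pS pA sD (l := snd : item -> 'I_n) sB3 AB3 items_small.
apply: (R_chain sB AB _ e0R (cseq_good sB AB c1P sB1 eR c3P)).
by apply: R_mono eR; left.
Qed.

End Step.

Lemma all_good : (forall S : {set 'I_n}, (#|S| <= m)%N -> good S) -> good [set: 'I_n].
Proof.
move=> small_good.
suff H k (S : {set 'I_n}) : (#|S| <= k)%N -> good S by exact: H (leqnn _).
elim: k S => [|k IH] S; first by move=> S0; apply: small_good; exact: leq_trans S0 _.
have [Sm|mS] := leqP #|S| m; first by move=> _; exact: small_good.
move=> Sk; apply: distal_step => // S' /proper_card S'S.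
by apply: IH; rewrite -ltnS; exact: leq_trans S'S Sk.
Qed.

End DistalProducts.

Lemma invariant_over_mono (L : language) (U : structure L) (V : Type) (A A' : set U)
    (p : set (formula L (V + U))) :
  A `<=` A' -> invariant_over A p -> invariant_over A' p.
Proof.
move=> AA' pA k phi d d' dd'; apply: pA => psi pA; apply: dd'.
exact: subset_trans AA'.
Qed.

Lemma card_superset (X : finType) (m : nat) (S : {set X}) :
  (#|S| <= m <= #|X|)%N -> exists S' : {set X}, S \subset S' /\ #|S'| = m.
Proof.
move=> /andP[Sm mX].
elim: m Sm mX => [|m IH].
  by rewrite leqn0 => /eqP S0 _; exists S.
rewrite leq_eqVlt => /predU1P[Sm _|]; first by exists S.
rewrite ltnS => Sm mX; have [S' [SS' S'm]] := IH Sm (ltnW mX).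
have [x] : exists x, x \in ~: S'.
  by apply/card_gt0P; rewrite cardsCs finset.setCK S'm subn_gt0.
rewrite inE => xS'; exists (x |: S'); rewrite cardsU1 xS' S'm; split => //.
exact: fintype.subset_trans SS' (finset.subsetUr _ _).
Qed.

Lemma trivIset_eq (n : nat) (V : Type) (D : 'I_n -> set V) :
  trivIset [set: 'I_n] D -> forall i j v, D i v -> D j v -> i = j.
Proof. by move=> Dt i j v iv jv; apply: Dt => //; exists v. Qed.

(** * From m-distality to determinacy *)

Section Determined.
Variables (L : language) (T : set (sentence L)) (K : Type) (U : structure L).
Hypothesis U_monster : monster K T U.
Let K_nat := monster_nat U_monster.

Lemma common_base (n : nat) (V : Type) (p : 'I_n -> set (formula L (V + U))) :
  (forall i, invariant K (p i)) ->
  exists A, small K A /\ forall i, invariant_over A (p i).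
Proof.
move=> /choice[A AP]; exists (wvars A (enum 'I_n)); split.
  by apply: (small_wvars U_monster) => i; have [] := AP i.
move=> i; have [_] := AP i; apply: invariant_over_mono => u Au.
by exists i; rewrite ?mem_enum.
Qed.

Lemma wvars_enum (n : nat) (V : Type) (D : 'I_n -> set V) (S : {set 'I_n}) :
  wvars D (enum S) = \bigcup_(i in [set` S]) D i.
Proof.
by apply/seteqP; split=> v [i] h Dv; exists i => //; move: h; rewrite mem_enum.
Qed.

Lemma wvars_enumT (n : nat) (V : Type) (D : 'I_n -> set V) :
  wvars D (enum 'I_n) = \bigcup_i D i.
Proof.
by apply/seteqP; split=> v [i] h Dv; exists i => //; rewrite mem_enum.
Qed.

(** [all_good] is applied with [R] the realizations of [p']. As [p'] is an arbitrary complete global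
    type, it is used only through the existence of realizations over small sets and their
    conjugacy. *)
Lemma distal_determined (m n : nat) : m_distal m K U -> (m < n)%N ->
  commuting_products_determined m n K U.
Proof.
move=> U_distal mn V D p sD /trivIset_eq Dtriv pS pinv pc.
have [A [sA pA]] := common_base pinv.
have prc i j (ij : i <> j) : rcomm K D p A i j.
  exact: (commute_rcomm U_monster pS pA sA sD Dtriv ij (pc i j ij)).
rewrite /m_determined -wvars_enumT => p' p'S p'p.
have [prS prA] := wproductS U_monster pS pA sA sD (enum 'I_n).
have sW := small_wvars U_monster sD.
have p'conj B (e e' : V -> U) : small K B -> realizes_over p' B e -> realizes_over p' B e' ->
    exists s, [/\ automorphism s, fixes B s & forall l v, D l v -> s (e v) = e' v].
  move=> sB eB e'B.
  have [s [sauto sf se]] := monster_homogeneous U_monster (sW _) sB (realizes_tp p'S eB e'B).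
  by exists s; split => // l v Dv; apply: se; exists l; rewrite ?mem_enum.
have move_chain B s (e e' : V -> U) w : A `<=` B -> automorphism s -> fixes B s ->
    (forall l v, l \in w -> D l v -> s (e v) = e' v) ->
    chain D p B (named id (fun _ => e) w) -> chain D p B (named id (fun _ => e') w).
  move=> AB sauto sf se /(chain_automorphism pA sauto (fixes_sub AB sf)).
  by rewrite fixes_image //; apply: (chain_ext pS).
apply: (Stype_eq p'S prS) => B0 fB0; pose B := A `|` B0.
have sB : small K B by apply: small_setU => //; exact: small_finite.
have AB : A `<=` B by left.
have [e he] := Stype_realize U_monster p'S (sW _) sB.
exists e; split; first by apply: realizes_mono he; right.
apply: (@realizes_mono _ _ _ _ B); first by right.
apply/(realizes_wproduct U_monster pS pA sA sD Dtriv e sB AB (enum_uniq _)).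
have := @all_good _ _ _ _ U_monster m U_distal V n D p A pS pA sD Dtriv prc (realizes_over p').
rewrite /good enum_setT -enumT; apply => //.
- by move=> B1 B2 e1 h1 h2; exact: realizes_mono h1 h2.
- by move=> B1 sB1; exact: (Stype_realize U_monster p'S (sW _) sB1).
- move=> B' e1 e2 w sB' AB' e1R e2R.
  have [s [sauto sf se]] := p'conj _ _ _ sB' e1R e2R.
  by apply: (move_chain B' s) => // l v _; exact: se.
(* A set of at most [m] variables is enlarged to one of exactly [m], the size at which [p'] is
   compared with the product. *)
move=> S Sm B' e' sB' AB' e'R.
have [|S' [SS' S'm]] := @card_superset _ m S.
  by rewrite Sm card_ord (ltnW mn).
pose q := [set phi | wproduct K D p (enum 'I_n) phi /\ vars phi `<=` wvars D (enum S')].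
have S'W : wvars D (enum S') `<=` wvars D (enum 'I_n).
  by move=> v [l _ Dv]; exists l; rewrite ?mem_enum.
have qS : Stype (wvars D (enum S')) [set: U] q.
  case: prS => pr1 pr2 pr3; split.
  - by move=> phi [_].
  - move=> phi vphi _; have [||h|h] := pr2 phi; first exact: subset_trans S'W.
    + exact: subsetT.
    + by left.
    + by right; split => //; rewrite vars_Neg.
  - by move=> F fF Fq; apply: pr3 => // phi /Fq[].
have qp' : q `<=` p'.
  rewrite wvars_enum in qS; apply: (p'p S' S'm q qS).
  by move=> phi [].
have [e1 he1] := Stype_realize U_monster prS (sW _) sB'.
have [|s [sauto sf se]] := @monster_homogeneous _ _ _ _ U_monster _ (wvars D (enum S')) B' e1 e' (sW _) sB'.
  move=> phi vphi pphi hphi; apply: e'R => //; apply: qp'; split => //.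
  by apply/(realizes_sat prS he1 _ pphi) => //; exact: subset_trans S'W.
have /(realizes_wproduct U_monster pS pA sA sD Dtriv e1 sB' AB' (enum_uniq _)) c1 := he1.
have -> : enum S = [seq l <- enum 'I_n | l \in S] by rewrite enumT.
have /subseqP[msk _ e2] := filter_subseq (fun l => l \in S) (enum 'I_n).
apply: (move_chain B' s e1) => //.
  move=> l v; rewrite mem_filter => /andP[lS _] Dv; apply: se; exists l => //.
  by rewrite mem_enum; exact: (fintype.subsetP SS').
by rewrite e2 /named map_mask; exact: chain_mask.
Qed.

End Determined.

(** * Alternation in NIP theories *)

Lemma In_mem (X : eqType) (x : X) s : List.In x s <-> x \in s.
Proof.
elim: s => [|y s IH] /=; first by [].
by rewrite inE IH; split=> [[->|->]|/orP[/eqP ->|]]; rewrite ?eqxx ?orbT; auto.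
Qed.

Section Alternation.
Variables (L : language) (T : set (sentence L)) (K : Type) (U : structure L).
Hypotheses (U_monster : monster K T U) (U_NIP : NIP U).
Let K_nat := monster_nat U_monster.

(* [H N h] says that [h 0, ..., h (N - 1)] is an initial segment of an
   indiscernible sequence with a fixed EM-type. *)
Lemma NIP_alternation (V : Type) (D : set V) (H : nat -> (nat -> V -> U) -> Prop)
    (theta : formula L (V + U)) :
  vars theta `<=` D ->
  (forall N M h f, H N h -> (forall i j, (i < j < M)%N -> (f i < f j)%N) ->
    (forall i, (i < M)%N -> (f i < N)%N) -> H M (fun i => h (f i))) ->
  (forall N h h' (phi : formula L ('I_N * V)), H N h -> H N h' ->
    (forall x, fv phi x -> D x.2) ->
    sat (fun x : 'I_N * V => h x.1 x.2) phi ->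
    sat (fun x : 'I_N * V => h' x.1 x.2) phi) ->
  exists N, forall h, H N h ->
    ~ forall i, (i < N)%N -> sat (with_params (h i)) theta <-> odd i.
Proof.
move=> vD Hsub Heq; apply: contrapT => /forallNP alt.
have {}alt N : exists h, H N h /\
    forall i, (i < N)%N -> sat (with_params (h i)) theta <-> odd i.
  by have /existsNP[h /not_implyP[Hh /contrapT]] := alt N; exists h.
have [l [d [theta1 [thetaE _]]]] := fmap_plug theta.
have [k [x xP]] : exists k (x : 'I_k -> V), forall v, vars theta v <-> exists i, x i = v.
  apply: finite_ord; apply: (@sub_finite_set _ _ (\bigcup_(S in (fun z : V + U =>
     if z is inl u then [set u] else set0) @` fv theta) S)).
    by move=> u hu; exists [set u] => //; exists (inl u).
  apply: bigcup_finite; first exact/finite_image/finite_fv.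
  by move=> S [[v|v] _ <-]; [exact: finite_set1|exact: finite_set0].
have [|theta0 theta0E] := @fmap_factor _ _ _ (fun z : 'I_k + 'I_l =>
    match z with inl i => inl (x i) | inr j => inr j end) theta1.
  move=> [v|j] hv; last by exists (inr j).
  have /xP[i <-] : vars theta v by rewrite thetaE /vars /= fv_fmap; exists (inl v).
  by exists (inl i).
have xD i : D (x i) by apply: vD; apply/xP; exists i.
pose lit N (S : set nat) (n : 'I_N) : formula L (('I_N * 'I_k) + 'I_l) :=
  fmap (fun z => match z with inl i => inl (n, i) | inr j => inr j end)
    (if `[< S n >] then theta0 else Neg theta0).
have satlit N S (n : 'I_N) (a : 'I_N -> 'I_k -> U) (b : 'I_l -> U) :
    sat (fun z => match z with inl y => a y.1 y.2 | inr j => b j end) (lit N S n) <->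
    (sat (fun z => match z with inl i => a n i | inr j => b j end) theta0 <-> S n).
  pose e (z : 'I_k + 'I_l) := match z with inl i => a n i | inr j => b j end.
  rewrite /lit sat_fmap (@sat_eq_iff _ _ _ _ e); last by case.
  rewrite -/e.
  case: asboolP => Sn /=; first by split => [//|[_ h]]; exact: h.
  by split=> [h|h h']; [split|exact/Sn/h].
(* The pattern [S] on [N] points: some value of the parameters makes [theta0] true at exactly the
   points with index in [S]. *)
pose Pat N S : formula L ('I_N * 'I_k) := Exs (Conj [seq lit N S n | n <- enum 'I_N]).
have satPat N S (a : 'I_N -> 'I_k -> U) : sat (fun y => a y.1 y.2) (Pat N S) <->
    exists b : 'I_l -> U, forall n,
      (sat (fun z => match z with inl i => a n i | inr j => b j end) theta0 <-> S (val n)).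
  rewrite sat_Exs; split=> -[b hb]; exists b.
    move: hb; rewrite sat_Conj => hb n; apply/(satlit N S n a b); apply: hb.
    by rewrite List.in_map_iff; exists n; split => //; apply/In_mem; rewrite mem_enum.
  rewrite sat_Conj => phi; rewrite List.in_map_iff => -[n [<- _]].
  by apply/(satlit N S n a b); exact: hb.
have theta0P (h : V -> U) : sat (with_params h) theta <->
    sat (fun z => match z with inl i => h (x i) | inr j => d j end) theta0.
  by rewrite thetaE theta0E !sat_fmap; apply: sat_eq_iff => -[].
(* All members of [H N] satisfy the same formulas, so it is enough to find the pattern on a
   subsequence of an alternating one, where the parameters [d] of [theta] produce it. *)
have HPat N S h : H N h -> sat (fun y : 'I_N * 'I_k => h y.1 (x y.2)) (Pat N S).
  move=> Hh; have [g [Hg galt]] := alt N.*2.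
  (* Of 2n and 2n+1, the one that is odd exactly when [n] lies in [S]. *)
  pose f n := (n.*2 + `[< S n >])%N.
  have f_lt i : (f i < i.+1.*2)%N.
    by rewrite /f doubleS; case: asboolP; rewrite ?addn1 ?addn0.
  have fN i : (i < N)%N -> (f i < N.*2)%N.
    by move=> iN; apply: leq_trans (f_lt i) _; rewrite leq_double.
  have Hgf : H N (fun i => g (f i)).
    apply: Hsub Hg _ fN => i j /andP[ij _].
    by apply: leq_trans (f_lt i) _; apply: leq_trans (leq_addr _ _); rewrite leq_double.
  have := Heq _ _ _ (fmap (fun y => (y.1, x y.2)) (Pat N S)) Hgf Hh.
  rewrite !sat_fmap; apply; first by move=> y; rewrite fv_fmap => -[[n i] _ <-] /=.
  apply/(satPat N S (fun n i => g (f n) (x i))); exists d => n.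
  by rewrite -theta0P galt ?fN // /f oddD odd_double; case: asboolP.
pose tonat N (y : 'I_N * 'I_k) : nat * 'I_k := (val y.1, y.2).
(* One infinite sequence showing all finite patterns. *)
pose Sig := [set phi | exists N S, phi = fmap (inl : _ -> _ + U) (fmap (tonat N) (Pat N S))].
have [|||s hs|a ha] := @monster_saturated _ _ _ _ U_monster (nat * 'I_k)%type [set: _] set0 Sig.
- by apply/small_setT; exact: smallT_countType.
- exact: (small_finite K_nat (finite_set0 _)).
- move=> phi [N [S ->]]; split; first exact: subsetT.
  by move=> u; rewrite /params /= fv_fmap => -[].
- have [M hM] : exists M, forall phi, List.In phi s -> exists N S,
      (N <= M)%N /\ phi = fmap (inl : _ -> _ + U) (fmap (tonat N) (Pat N S)).
    elim: s hs => [|phi s IH] hs; first by exists 0.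
    have [M hM] := IH (fun psi h => hs psi (or_intror h)).
    have [N [S phiE]] := hs phi (or_introl erefl).
    exists (maxn M N) => psi [<-|/hM[N' [S' [N'M ->]]]].
      by exists N, S; rewrite leq_maxr.
    by exists N', S'; rewrite leq_max N'M.
  have [h [Hh _]] := alt M.
  exists (fun y => h y.1 (x y.2)) => phi /hM[N [S [NM ->]]].
  rewrite !sat_fmap; apply: sat_eq (HPat N S h _) => // .
  apply: (Hsub M N h id) => // [i j /andP[]//|i iN].
  exact: leq_trans NM.
(* Saturation is used a second time, now for the parameters: the patterns on initial segments only
   give a value of them for each finite part of [S]. *)
have aP S : exists b : 'I_l -> U, forall n,
    sat (fun z => match z with inl i => a (n, i) | inr j => b j end) theta0 <-> S n.
  pose litU (n : nat) : formula L ('I_l + U) :=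
    fmap (fun z => match z with inl i => inr (a (n, i)) | inr j => inl j end)
      (if `[< S n >] then theta0 else Neg theta0).
  have satlitU n (b : 'I_l -> U) : sat (with_params b) (litU n) <->
      (sat (fun z => match z with inl i => a (n, i) | inr j => b j end) theta0 <-> S n).
    pose e (z : 'I_k + 'I_l) := match z with inl i => a (n, i) | inr j => b j end.
    rewrite /litU sat_fmap (@sat_eq_iff _ _ _ _ e); last by case.
    rewrite -/e; case: asboolP => Sn /=; first by split => [//|[_ h]]; exact: h.
    by split=> [h|h h']; [split|exact/Sn/h].
  have [|||s hs|b hb] := @monster_saturated _ _ _ _ U_monster 'I_l [set: _] (range a)
      [set litU n | n in [set: nat]].
  - by apply/small_setT; exact: smallT_countType.
  - by apply: small_range; exact: smallT_countType.
  - move=> phi [n _ <-]; split; first exact: subsetT.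
    move=> u; rewrite /params /= fv_fmap => -[[i|j] _ //= [<-]].
    by exists (n, i).
  - have [M hM] : exists M, forall phi, List.In phi s -> exists n : 'I_M, phi = litU n.
      elim: s hs => [|phi s IH] hs; first by exists 0.
      have [M hM] := IH (fun psi h => hs psi (or_intror h)).
      have [N _ phiE] := hs phi (or_introl erefl).
      have le1 : (M <= maxn M N.+1)%N by rewrite leq_maxl.
      have le2 : (N < maxn M N.+1)%N by rewrite leq_maxr.
      exists (maxn M N.+1) => psi [<-|/hM[n ->]].
        by exists (Ordinal le2).
      by exists (widen_ord le1 n).
    have := ha _ (ex_intro _ M (ex_intro _ S erefl)); rewrite !sat_fmap.
    move=> /(satPat M S (fun n i => a (val n, i)))[b hb].
    by exists b => phi /hM[n ->]; apply/satlitU; exact: hb.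
  exists b => n; apply/satlitU; apply: hb; exact: imageP.
have [b bP] := choice aP.
by apply: (U_NIP (phi := theta0)); exists (fun n i => a (n, i)), b => n S; exact: bP.
Qed.

End Alternation.

(** * Limit types at the cuts of an indiscernible sequence *)

(** The definition of indiscernibility speaks of strictly increasing indices only. Hence the values
    of [f] that occur are listed in increasing order without repetition and [phi] is rewritten along
    this list; by the equality of patterns, the corresponding values of [f'] are also increasing. *)
Lemma indiscernible_pattern (L : language) (U : structure L) (X I J : Type)
    (le : rel I) (b : I -> X -> U) (f f' : J -> I) (phi : formula L (J * X)) :
  linear_order le -> indiscernible le b ->
  (forall x y, fv phi x -> fv phi y -> le (f x.1) (f y.1) = le (f' x.1) (f' y.1)) ->
  sat (fun x => b (f x.1) x.2) phi -> sat (fun x => b (f' x.1) x.2) phi.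
Proof.
move=> [le_anti le_trans le_total] b_ind ff'.
have le_refl x : le x x by have := le_total x x; rewrite orbb.
have [k [h [psi [phiE hfv]]]] := fmap_ord phi.
pose s : seq {classic I} := sort le (undup ([seq f (h i).1 | i <- enum 'I_k] : seq {classic I})).
have s_uniq : uniq s by rewrite sort_uniq undup_uniq.
have s_sorted : sorted le s by apply: sort_sorted.
have in_s i : (f (h i).1 : {classic I}) \in s.
  by rewrite mem_sort mem_undup; apply: (map_f (fun i => f (h i).1 : {classic I})); rewrite mem_enum.
have c_lt i : (index (f (h i).1 : {classic I}) s < size s)%N by rewrite index_mem.
pose c i := Ordinal (c_lt i).
have [[i0]|k0] := pselect (inhabited 'I_k); last first.
  rewrite phiE !sat_fmap; apply: sat_eq => i; case: k0; exact: inhabits.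
pose g (a : 'I_(size s)) : I := nth (f (h i0).1 : {classic I}) s a.
have gc i : g (c i) = f (h i).1 by exact: (@nth_index {classic I} _ _ _ (in_s i)).
have gP (a : 'I_(size s)) : exists i, c i = a.
  have : nth (f (h i0).1 : {classic I}) s a \in s by exact: mem_nth.
  rewrite mem_sort mem_undup => /mapP[i _ ei]; exists i; apply: val_inj => /=.
  by rewrite -ei index_uniq.
have [r rP] := choice gP.
have g_inc (a a' : 'I_(size s)) : (a < a')%N -> ~~ le (g a') (g a).
  move=> aa'; apply/negP => h1.
  have h2 : le (g a) (g a').
    by apply: (sorted_leq_nth le_trans le_refl _ s_sorted); rewrite ?inE ?ltn_ord // ltnW.
  have e : (g a' : {classic I}) = g a by apply: le_anti; rewrite h1.
  by move/eqP: e; rewrite /g nth_uniq // => /eqP e; rewrite e ltnn in aa'.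
pose g' a := f' (h (r a)).1.
have g'c i : g' (c i) = f' (h i).1.
  have e : f (h (r (c i))).1 = f (h i).1 by rewrite -!gc rP.
  apply: le_anti; rewrite -!ff' // e !le_refl //.
have g'_inc (a a' : 'I_(size s)) : (a < a')%N -> ~~ le (g' a') (g' a).
  by move=> aa'; rewrite /g' -ff' // -!gc !rP; exact: g_inc.
rewrite phiE !sat_fmap.
pose chi := fmap (fun i => (c i, (h i).2)) psi.
have E (q : J -> I) (q1 : 'I_(size s) -> I) : (forall i, q1 (c i) = q (h i).1) ->
    sat ((fun x => b (q x.1) x.2) \o h) psi <-> sat (fun v => b (q1 v.1) v.2) chi.
  by move=> qq; rewrite sat_fmap; apply: sat_eq_iff => i /=; rewrite qq.
rewrite (E f g gc) (E f' g' g'c).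
by case: (b_ind _ chi) => h1 h2; [exact: h1|case: (h1 g)].
Qed.

Lemma insertion_le_linear (I : Type) (le : rel I) (n : nat) (P : I -> 'I_n.+1)
    (S : {set 'I_n}) : linear_order le -> (forall x y, le x y -> (P x <= P y)%N) ->
  linear_order (@insertion_le I le n P S).
Proof.
move=> [le_anti le_trans le_total] Pmono; split.
- move=> [x|i] [y|j] //=.
  + by move=> /le_anti ->.
  + by rewrite ltnNge andbN.
  + by rewrite ltnNge andNb.
  + by rewrite -eqn_leq => /eqP/val_inj/val_inj ->.
- move=> [y|j] [x|i] [z|k] //=.
  + exact: le_trans.
  + by move=> /Pmono h; exact: leq_trans.
  + by move=> h /Pmono; exact: leq_trans.
  + by move=> h /(leq_trans h)/ltnW.
  + move=> h1 h2; have := leq_ltn_trans h1 h2.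
    by case/orP: (le_total x z) => // /Pmono; rewrite leqNgt => /negP.
  + exact: leq_trans.
  + by move=> h; exact: leq_ltn_trans.
  + exact: leq_trans.
- move=> [x|i] [y|j] //=.
  + by rewrite leqNgt orNb.
  + by rewrite ltnNge orNb.
  + exact: leq_total.
Qed.

Lemma uniq_cat_cons (J : eqType) (t : J) w zs :
  uniq (w ++ t :: zs) = uniq (t :: w ++ zs).
Proof. by apply: perm_uniq; rewrite -[t :: zs]cat1s perm_catCA. Qed.

Section LimitTypes.
Variables (L : language) (T : set (sentence L)) (K : Type) (U : structure L).
Hypotheses (U_monster : monster K T U) (U_NIP : NIP U).
Let K_nat := monster_nat U_monster.
Variables (X I : Type) (X_small : small K [set: X]) (le : rel I) (b : I -> X -> U).
Hypothesis b_ind : indiscernible_sequence K le b.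
Variables (n : nat) (P : I -> 'I_n.+1) (P_Dedekind : Dedekind le P).

Let le_linear : linear_order le. Proof. by case: b_ind. Qed.
Let le_transitive : transitive le. Proof. by case: le_linear. Qed.
Let le_tot : total le. Proof. by case: le_linear. Qed.
Let P_mono x y : le x y -> (P x <= P y)%N.
Proof. by case: P_Dedekind => _ h _ _; exact: h. Qed.

(* [(i, false)] and [(i, true)] are the left and the right side of the [i]-th cut. *)
Definition cut_side := ('I_n * bool)%type.
Implicit Types lam mu : cut_side.
Definition block lam : nat := (lam.1 + lam.2)%N.

(** As [F] varies, these sets form a basis of neighbourhoods of the side [lam]. *)
Definition closer lam (F : seq I) (x : I) : Prop :=
  (P x = block lam :> nat) /\ forall y, List.In y F -> P y = block lam :> nat ->
    ~~ (if lam.2 then le y x else le x y).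

Lemma closer_ex lam F : exists x, closer lam F x.
Proof.
case: P_Dedekind => Psurj _ Pmax Pmin; elim: F => [|y F [x [Px xF]]].
  have lt : (block lam < n.+1)%N.
    by rewrite /block; case: (lam) => i [] /=; rewrite ?addn1 ?addn0 ?ltnS // ltnW.
  by have [x Px] := Psurj (Ordinal lt); exists x; split => //; rewrite Px.
have [Py|nPy] := eqVneq (P y : nat) (block lam); last first.
  by exists x; split => // z [<- Py|]; [rewrite Py eqxx in nPy|exact: xF].
case: lam Px xF Py => i s; rewrite /closer /block /= => Px xF Py.
have [z [Pz hz]] : exists z, P z = (i + s)%N :> nat /\
    if s then le z x && le z y else le x z && le y z.
  have lexx w : le w w by have := le_tot w w; rewrite orbb.
  case/orP: (le_tot x y) => h; [exists (if s then x else y)|exists (if s then y else x)];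
    by case: s Px Py {xF} => ? ?; rewrite ?lexx ?h.
case: s Px xF Py Pz hz; rewrite ?addn1 ?addn0 => Px xF Py Pz /andP[zx zy].
  have [|w [Pw wz]] := Pmin i z; first by rewrite Pz.
  have lwz : le w z by case/orP: (le_tot w z) => // h; rewrite h in wz.
  exists w; split.
    by apply/eqP; rewrite eqn_leq Pw -Pz P_mono.
  move=> v [<- _|vF Pv].
    by apply: contra wz; exact: le_transitive.
  apply: contra (xF v vF Pv) => vw; apply: le_transitive zx.
  exact: le_transitive lwz.
have [|w [Pw wz]] := Pmax i z; first by rewrite Pz.
have lzw : le z w by case/orP: (le_tot z w) => // h; rewrite h in wz.
exists w; split.
  by apply/eqP; rewrite eqn_leq Pw -Pz P_mono.
move=> v [<- _|vF Pv].
  by apply: contra wz => h; exact: le_transitive h zy.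
apply: contra (xF v vF Pv) => wv; apply: le_transitive wv.
exact: le_transitive lzw.
Qed.

Lemma closer_sub lam F F' x : (forall y, List.In y F' -> List.In y F) ->
  closer lam F x -> closer lam F' x.
Proof. by move=> FF' [Px h]; split => // y /FF'; exact: h. Qed.

(* The order relation of a point close to [lam] with a point in block [k] *)
Definition side_le lam k := if k == block lam then lam.2 else (block lam < k)%N.
Definition side_ge lam k := if k == block lam then ~~ lam.2 else (k < block lam)%N.

Lemma closer_le lam F x y : closer lam F x -> List.In y F ->
  le x y = side_le lam (P y) /\ le y x = side_ge lam (P y).
Proof.
move=> [Px xF] yF; rewrite /side_le /side_ge; case: eqP => [Py|nPy].
  have := xF y yF Py; case: (lam.2) => /negPf h; rewrite h; split => //;
    by have := le_tot x y; rewrite h ?orbF.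
have := @P_mono x y; have := @P_mono y x; have := le_tot x y.
rewrite Px; have : P y <> block lam :> nat by []. 
case: (ltngtP (P y) (block lam)) => // h _.
  by case: (le x y) => /= [_ _ /(_ isT)//|-> _ _].
by case: (le y x) => /= [_ /(_ isT)//|]; rewrite orbF => ->.
Qed.

Lemma limit_ultra : exists W : cut_side -> set_system I,
  forall lam, UltraFilter (W lam) /\ forall F, W lam (closer lam F).
Proof.
suff h lam : exists W : set_system I, UltraFilter W /\ forall F, W (closer lam F).
  by have [W hW] := choice h; exists W.
have [|W [WU hW]] := @ultra_ext I [set closer lam F | F in [set: seq I]].
  move=> s hs; have [F hF] : exists F, forall B, List.In B s -> closer lam F `<=` B.
    elim: s hs => [|B s IH] hs; first by exists [::].
    have [F hF] := IH (fun C h => hs C (or_intror h)).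
    have [F' _ BE] := hs B (or_introl erefl); exists (F ++ F') => C [<-|/hF h] x.
      by rewrite -BE; apply: closer_sub => y; rewrite List.in_app_iff; right.
    by move=> hx; apply: h; apply: closer_sub hx => y; rewrite List.in_app_iff; left.
  by have [x hx] := closer_ex lam F; exists x => B /hF; exact.
by exists W; split => // F; apply: hW; exact: imageP.
Qed.

Let W : cut_side -> set_system I := sval (cid limit_ultra).
Let WU lam : UltraFilter (W lam). Proof. by have [] := svalP (cid limit_ultra) lam. Qed.
Let W_closer lam F : W lam (closer lam F).
Proof. exact: (proj2 (svalP (cid limit_ultra) lam) F). Qed.

(** A limit along an ultrafilter containing all neighbourhoods of [lam]: it is complete, and it is
    invariant over the elements of the sequence because formulas are tested only on these. *)
Definition limit_type lam : set (formula L (X + U)) :=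
  [set phi | W lam [set t | sat (with_params (b t)) phi]].

Lemma limit_closer lam F phi : limit_type lam phi ->
  exists t, closer lam F t /\ sat (with_params (b t)) phi.
Proof.
move=> h; have WUl := WU lam.
by have [t [h1 h2]] := filter_ex (filterI (W_closer lam F) h); exists t.
Qed.

Definition seq_params : set U := [set u | exists t x, b t x = u].

Lemma small_seq_params : small K seq_params.
Proof.
apply: (@small_sub _ _ _ (range (fun z : I * X => b z.1 z.2))).
  by move=> u [t [x <-]]; exists (t, x).
apply: small_range; apply: smallT_prod => //; last exact/small_setT.
by case: b_ind => _ _ /small_setT h _.
Qed.

Lemma Stype_limit lam : Stype [set: X] [set: U] (limit_type lam).
Proof.
have WUl := WU lam; split.
- by move=> phi _; split; exact: subsetT.
- move=> phi _ _; have [h|h] := in_ultra_setVsetC [set t | sat (with_params (b t)) phi] WUl.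
    by left.
  by right.
- move=> F /finite_set_In[s sE] hF.
  have : W lam [set t | forall phi, List.In phi s -> sat (with_params (b t)) phi].
    have : forall phi, List.In phi s -> limit_type lam phi by move=> phi /sE/hF.
    elim: s {sE hF} => [|phi s IH] hs; first by apply: filterS filterT => t _ phi [].
    apply: filterS (filterI (hs phi (or_introl erefl)) (IH (fun psi h => hs psi (or_intror h)))).
    by move=> t [h1 h2] psi [<-|]; [exact: h1|exact: h2].
  by move=> /filter_ex[t ht]; exists (b t) => phi /sE; exact: ht.
Qed.

Lemma invariant_limit lam : invariant_over seq_params (limit_type lam).
Proof.
apply: (automorphism_invariant U_monster small_seq_params) => s phi sauto sf.
have WUl := WU lam; apply: filterS => t /= h; apply/sat_fmap.
move: h; rewrite -(sat_automorphism _ _ sauto); apply: sat_eq => -[x|u] //=.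
by rewrite sf //; exists t, x.
Qed.

Let Dall (lam : cut_side) : set X := [set: X].
Let sDall lam : small K (Dall lam) := X_small.

Section Generic.
Variables (J : eqType) (l : J -> cut_side).

(* [w] lists the items from the last realized to the first: the last one
   realized is the farthest from its cut. *)
Fixpoint gen (f : J -> I) (zs w : seq J) : Prop :=
  if w is t :: w' then closer (l t) (map f zs) (f t) /\ gen f (t :: zs) w' else True.

Lemma gen_sub f zs zs' w : {subset zs' <= zs} -> gen f zs w -> gen f zs' w.
Proof.
elim: w zs zs' => //= t w IH zs zs' zz [h1 h2]; split.
  apply: closer_sub h1 => y; rewrite !List.in_map_iff => -[z [<- /In_mem/zz/In_mem h]].
  by exists z.
by apply: IH h2 => s; rewrite !inE => /orP[->|/zz ->]; rewrite ?orbT.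
Qed.

(** Two different sides share a block only as its two ends. A point nearer to one end than a second
    point is then also the one from which the second is separated towards the other end, so neither
    has to be chosen first. *)
Lemma gen_swap f zs t s w : l t <> l s -> gen f zs [:: t, s & w] -> gen f zs [:: s, t & w].
Proof.
move=> ts /= [h1 [h2 h3]]; split; first by apply: closer_sub h2 => y; right.
split; last by apply: gen_sub h3 => z; rewrite !inE orbCA.
case: h1 => Pt h1; split => // y /= [<- Ps|]; last exact: h1.
have [Ps' h] := h2; have := h (f t) (or_introl erefl).
rewrite Pt => /(_ _).
have e : block (l t) = block (l s) by rewrite -Ps -Ps'.
move=> /(_ e); move: ts e; rewrite /block.
case: (l t) => i []; case: (l s) => j []; rewrite ?addn1 ?addn0 //=.
  by move=> ij [] /val_inj e; case: ij; rewrite e.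
by move=> ij /val_inj e; case: ij; rewrite e.
Qed.

Lemma gen_ex f zs w : uniq (w ++ zs) -> exists f', gen f' zs w /\ {in zs, f =1 f'}.
Proof.
elim: w f zs => [|t w IH] f zs /=; first by exists f.
move=> /andP[]; rewrite mem_cat negb_or => /andP[tw tzs] uw.
have [x hx] := closer_ex (l t) (map f zs).
have [|f' [gf' ff']] := IH (fun s => if s == t then x else f s) (t :: zs).
  by rewrite uniq_cat_cons /= mem_cat (negPf tw) (negPf tzs).
exists f'; split; last first.
  move=> z zzs; rewrite -ff' ?inE ?zzs ?orbT //.
  by case: eqP => // zt; rewrite zt (negPf tzs) in zzs.
split=> //; have <- := ff' t (mem_head _ _); rewrite eqxx.
rewrite (_ : map f' zs = map f zs) //; apply/eq_in_map => z zzs.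
rewrite -ff' ?inE ?zzs ?orbT //.
by case: eqP => // zt; rewrite zt (negPf tzs) in zzs.
Qed.

Lemma gen_le f f' zs w : gen f zs w -> gen f' zs w ->
  {in zs, forall z, P (f z) = P (f' z)} ->
  {in zs &, forall z z', le (f z) (f z') = le (f' z) (f' z')} ->
  {in w ++ zs &, forall z z', le (f z) (f z') = le (f' z) (f' z')}.
Proof.
elim: w zs => [//|t w IH] zs /= [h1 h2] [h1' h2'] PP ll.
suff : {in w ++ (t :: zs) &, forall z z', le (f z) (f z') = le (f' z) (f' z')}.
  move=> h z z' hz hz'; apply: h.
    by move: hz; rewrite !(inE, mem_cat) orbCA.
  by move: hz'; rewrite !(inE, mem_cat) orbCA.
apply: IH => //.
  move=> z; rewrite inE => /orP[/eqP ->|]; last exact: PP.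
  by apply: ord_inj; rewrite (proj1 h1) (proj1 h1').
have lexx x : le x x by have := le_tot x x; rewrite orbb.
have lez z : z \in zs -> le (f t) (f z) = le (f' t) (f' z) /\ le (f z) (f t) = le (f' z) (f' t).
  move=> zzs; have [|-> ->] := closer_le (y := f z) h1.
    by rewrite List.in_map_iff; exists z; split => //; exact/In_mem.
  have [|-> ->] := closer_le (y := f' z) h1'.
    by rewrite List.in_map_iff; exists z; split => //; exact/In_mem.
  by rewrite PP.
move=> z z'; rewrite !inE => /orP[/eqP ->|hz] /orP[/eqP ->|hz'].
- by rewrite !lexx.
- by have [] := lez _ hz'.
- by have [] := lez _ hz.
- exact: ll.
Qed.

Lemma limit_chain w zs e f (phi : formula L (J * X)) : uniq (w ++ zs) ->
  chain Dall limit_type seq_params (named l e (rev w)) ->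
  {in zs, forall z, e z = b (f z)} -> gen f zs w ->
  (forall x, fv phi x -> x.1 \in w ++ zs) ->
  sat (fun x => e x.1 x.2) phi <-> sat (fun x => b (f x.1) x.2) phi.
Proof.
elim: w zs e f => [|t w IH] zs e f.
  by move=> _ _ ez _ vphi; apply: sat_ext => x /vphi hx; rewrite ez.
move=> /= /andP[]; rewrite mem_cat negb_or => /andP[tw tzs] uw.
rewrite rev_cons -cats1 named_cat chain_cat => -[cw [et _]] ez [ft gf] vphi.
pose psi : formula L (X + U) :=
  fmap (fun x : J * X => if x.1 == t then inl x.2 else inr (e x.1 x.2)) phi.
have psiE (a : X -> U) : sat (with_params a) psi <->
    sat (fun x => (if x.1 == t then a else e x.1) x.2) phi.
  by rewrite sat_fmap; apply: sat_eq_iff => x /=; case: ifP.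
have psiB : params psi `<=` seq_params `|` supp Dall (named l e (rev w)).
  move=> u; rewrite /params /= fv_fmap => -[x hx]; case: eqP => // xt [<-].
  have := vphi _ hx; rewrite inE mem_cat => /or3P[/eqP//|xw|xzs]; last first.
    by left; rewrite ez //; exists (f x.1), x.2.
  by right; apply/supp_namedP; exists x.1, x.2; rewrite mem_rev.
have WUt := WU (l t).
have [t0 [t0c t0P]] : exists t0, closer (l t) (map f zs) t0 /\
    (sat (with_params (b t0)) psi <-> sat (with_params (e t)) psi).
  have key := realizes_sat (Stype_limit (l t)) et (@subsetT _ _) psiB.
  have [h|h] := pselect (sat (with_params (e t)) psi).
    have [t0 [/= h1 h2]] := filter_ex (filterI (W_closer (l t) (map f zs)) (iffRL key h)).
    by exists t0; split => //; split.
  have nh : W (l t) (~` [set t0 | sat (with_params (b t0)) psi]).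
    by apply/ultra_setC => /key.
  have [t0 [/= h1 h2]] := filter_ex (filterI (W_closer (l t) (map f zs)) nh).
  by exists t0; split => //; split.
pose f0 s := if s == t then t0 else f s.
have [|f1 [gf1 f01]] := @gen_ex f0 (t :: zs) w.
  by rewrite uniq_cat_cons /= mem_cat (negPf tw) (negPf tzs).
have f1t : f1 t = t0 by rewrite -f01 ?mem_head // /f0 eqxx.
have f1z z : z \in zs -> f1 z = f z.
  move=> zzs; rewrite -f01 ?inE ?zzs ?orbT // /f0.
  by case: eqP => // zt; rewrite zt (negPf tzs) in zzs.
pose e1 s := if s == t then b t0 else e s.
have := IH (t :: zs) e1 f1 _ _ _ gf1 _.
rewrite uniq_cat_cons /= mem_cat (negPf tw) (negPf tzs) => /(_ uw) H.
have {H}E1 : sat (fun x => e1 x.1 x.2) phi <-> sat (fun x => b (f1 x.1) x.2) phi.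
  apply: H.
  - apply: (chain_ext Stype_limit) cw => s v; rewrite mem_rev /e1 => sw _.
    by case: eqP => // st; rewrite -st sw in tw.
  - move=> z; rewrite inE /e1; case: eqP => [-> _|_ /= zzs]; first by rewrite f1t.
    by rewrite f1z // ez.
  - by move=> x /vphi; rewrite !(inE, mem_cat) orbCA.
have E2 : sat (fun x => e x.1 x.2) phi <-> sat (fun x => e1 x.1 x.2) phi.
  transitivity (sat (with_params (e t)) psi).
    by rewrite psiE; apply: sat_eq_iff => x; case: eqP => // ->.
  rewrite -t0P psiE; apply: sat_eq_iff => x; rewrite /e1; by case: eqP.
have gf1' : gen f1 zs (t :: w).
  split => //; rewrite f1t (_ : map f1 zs = map f zs) //.
  by apply/eq_in_map => z; exact: f1z.
have gft : gen f zs (t :: w) by split.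
have pat : {in (t :: w) ++ zs &, forall z z', le (f1 z) (f1 z') = le (f z) (f z')}.
  by apply: gen_le gf1' gft _ _ => [z /f1z ->|z z' /f1z -> /f1z ->].
have b_ind' : indiscernible le b by case: b_ind.
rewrite E2 E1; split; apply: (indiscernible_pattern le_linear b_ind') => x y /vphi hx /vphi hy.
  exact: pat.
by rewrite pat.
Qed.

End Generic.
End LimitTypes.

Lemma fmap_factor_in (L : language) (V X : Type) (h : X -> V) (Q : set X)
    (phi : formula L V) :
  (forall v, fv phi v -> exists x, Q x /\ h x = v) ->
  exists phi', phi = fmap h phi' /\ forall x, fv phi' x -> Q x.
Proof.
move=> hQ; have [|psi psiE] := @fmap_factor _ _ {x | Q x} (fun x => h (sval x)) phi.
  by move=> v /hQ[x [Qx <-]]; exists (exist _ x Qx).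
exists (fmap sval psi); rewrite fmap_comp; split => // x.
by rewrite fv_fmap => -[y _ <-]; exact: svalP.
Qed.

Lemma fv_index (L : language) (J : eqType) (X : Type) (phi : formula L (J * X)) :
  exists js : seq J, uniq js /\ forall x, fv phi x -> x.1 \in js.
Proof.
have [s sE] := finite_set_In (finite_fv phi).
exists (undup (map fst s)); split; first exact: undup_uniq.
move=> x /sE hx; rewrite mem_undup; apply/In_mem; rewrite List.in_map_iff.
by exists x.
Qed.

Section CutTypes.
Variables (L : language) (T : set (sentence L)) (K : Type) (U : structure L).
Hypotheses (U_monster : monster K T U) (U_NIP : NIP U).
Let K_nat := monster_nat U_monster.
Variables (X I : Type) (X_small : small K [set: X]) (le : rel I) (b : I -> X -> U).
Hypothesis b_ind : indiscernible_sequence K le b.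
Variables (n : nat) (P : I -> 'I_n.+1) (P_Dedekind : Dedekind le P).

Let le_linear : linear_order le. Proof. by case: b_ind. Qed.
Let b_indisc : indiscernible le b. Proof. by case: b_ind. Qed.
Let P_mono x y : le x y -> (P x <= P y)%N.
Proof. by case: P_Dedekind => _ h _ _; exact: h. Qed.

Notation side := (cut_side n).
Notation lim := (limit_type b_ind P_Dedekind).
Notation B0 := (seq_params b).
Let Dall (lam : side) : set X := [set: X].
Let sDall lam : small K (Dall lam) := X_small.
Let limS : forall lam, Stype (Dall lam) [set: U] (lim lam) := Stype_limit b_ind P_Dedekind.
Let limI : forall lam, invariant_over B0 (lim lam) :=
  @invariant_limit _ _ _ _ U_monster _ _ X_small _ _ b_ind _ _ P_Dedekind.
Let sB0 : small K B0 := small_seq_params U_monster X_small b_ind.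

Lemma side_leE (i : 'I_n) s k :
  side_le (i, s) k = (i < k)%N /\ side_ge (i, s) k = (k <= i)%N.
Proof.
rewrite /side_le /side_ge /block /=; case: s; rewrite ?addn1 ?addn0.
  case: eqP => [->|/eqP ne]; first by rewrite leqnn ltnn.
  by rewrite ltnS ltn_neqAle eq_sym ne.
case: eqP => [->|/eqP ne]; first by rewrite leqnn ltnn.
by rewrite [(k < i)%N]ltn_neqAle ne.
Qed.

(** No term of the sequence lies in the cut, so points near its left and its right side compare in
    the same way with each of the finitely many terms in a formula. *)
Lemma limit_left_right i e :
  realizes_over (lim (i, false)) B0 e -> realizes_over (lim (i, true)) B0 e.
Proof.
move=> he psi lpsi psiB.
pose J := option {classic I}.
pose k (z : J * X) : X + U := match z.1 with Some j => inr (b j z.2) | None => inl z.2 end.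
have [|phi phiE] := @fmap_factor _ _ _ k psi.
  move=> [x|u] hv; first by exists (None, x).
  by have [j [x <-]] := psiB _ hv; exists (Some j, x).
have [js [js_uniq jsP]] := fv_index phi.
pose zs := [seq z <- js | z != None].
have uzs : uniq ([:: None] ++ zs) by rewrite /= mem_filter eqxx /= filter_uniq.
pose env (a : X -> U) (z : J) := if z is Some j then b j else a.
pose ind (t : I) (z : J) : I := if z is Some j then j else t.
have satE s (a : X -> U) t : closer le P (i, s) (map (ind t) zs) t ->
    realizes_over (lim (i, s)) B0 a ->
    sat (with_params a) psi <-> sat (fun x => b (ind t x.1) x.2) phi.
  move=> tc ha; rewrite phiE sat_fmap.
  have <- : sat (fun x => env a x.1 x.2) phi <-> sat (fun x => b (ind t x.1) x.2) phi.
    apply: (@limit_chain _ _ _ _ _ _ _ b_ind _ _ P_Dedekind _ (fun _ => (i, s)) [:: None] zs) => //.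
    - by move=> [z|] //; rewrite mem_filter.
    - move=> x /jsP; rewrite !inE mem_filter; by case: (x.1).
  by apply: sat_eq_iff => -[[j|] x].
have [a ha] := Stype_realize U_monster (limS (i, true)) X_small sB0.
have ex s : exists t, closer le P (i, s) (map (ind t) zs) t.
  have [t ht] := closer_ex b_ind P_Dedekind (i, s) (pmap id zs : seq I).
  exists t; apply: closer_sub ht => y.
  rewrite List.in_map_iff => -[[z|] [<- /In_mem]]; last by rewrite mem_filter.
  by move=> h; apply/(@In_mem {classic I}); rewrite mem_pmap; apply/mapP; exists (Some z).
have [t1 h1] := ex false; have [t2 h2] := ex true.
apply/(satE _ _ _ h1 he).
have : sat (with_params a) psi by exact: ha.
move/(satE _ _ _ h2 ha); apply: (indiscernible_pattern le_linear b_indisc).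
have pat (y : {classic I}) : Some y \in zs -> le t2 y = le t1 y /\ le y t2 = le y t1.
  move=> yzs; have inn t : List.In (y : I) (map (ind t) zs).
    by rewrite List.in_map_iff; exists (Some y); split => //; exact/In_mem.
  have [-> ->] := closer_le b_ind P_Dedekind h1 (inn t1).
  have [-> ->] := closer_le b_ind P_Dedekind h2 (inn t2).
  by have [-> ->] := side_leE i true (P y); have [-> ->] := side_leE i false (P y).
have lexx x : le x x by case: le_linear => _ _ tot; have := tot x x; rewrite orbb.
move=> [[x|] vx] [[y|] vy] /jsP hx /jsP hy //=.
- by have [] := pat x _; rewrite ?mem_filter.
- by have [] := pat y _; rewrite ?mem_filter.
- by rewrite !lexx.
Qed.

(** * Commutation of the limit types *)

Section Commutation.
Variables (lam mu : side).

Let l (t : nat * bool) := if t.2 then lam else mu.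

(** In the k-th pair [o k] tells which type is realized first: [lam] if it is true, [mu]
    otherwise. *)
Fixpoint word (o : nat -> bool) (N : nat) : seq (nat * bool) :=
  if N is N'.+1 then word o N' ++ [:: (N', o N'); (N', ~~ o N')] else [::].

Let R (o : nat -> bool) (t s : nat * bool) :=
  (t.1 < s.1)%N || [&& t.1 == s.1, t.2 == o t.1 & s.2 == ~~ o s.1].

Let R_trans o : transitive (R o).
Proof.
move=> [j y] [i x] [k z]; rewrite /R /= => /orP[ij|/and3P[/eqP -> xo yo]] /orP[jk|].
- by rewrite (ltn_trans ij jk).
- by move=> /and3P[/eqP <- _ _]; rewrite ij.
- by rewrite jk.
- by move=> /and3P[_ yo' _]; move: yo yo'; case: (o j); case: (y).
Qed.

Let R_irr o : irreflexive (R o).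
Proof. by move=> [i x]; rewrite /R /= ltnn eqxx /=; case: x; case: (o i). Qed.

Let mem_word o N t : (t \in word o N) = (t.1 < N)%N.
Proof.
elim: N => [|N IH] //=; rewrite mem_cat IH !inE ltnS (leq_eqVlt t.1) orbC.
case: (t) => k y; rewrite /= !xpair_eqE; case: (eqVneq k N) => //= _.
by case: y; case: (o N).
Qed.

Let word_pairwise o N : pairwise (R o) (word o N).
Proof.
elim: N => [|N IH] //=; rewrite pairwise_cat IH /= {2}/R /= ltnn !eqxx /= !andbT.
apply/allrelP => t s.
by rewrite /R mem_word !inE => tN /orP[] /eqP -> /=; rewrite tN.
Qed.

Let word_sorted o N : sorted (R o) (word o N).
Proof. by rewrite sorted_pairwise //; exact: R_trans. Qed.

Let word_uniq o N : uniq (word o N).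
Proof. exact: sorted_uniq (@R_trans o) (R_irr o) _ (word_sorted o N). Qed.

(** Only the order inside the pairs depends on [o], and points near different sides can be
    exchanged. The chains for all [o] thus satisfy the same formulas, although [theta] with its
    additional parameters may tell them apart. *)
Let gen_word f zs o o' N : lam <> mu ->
  gen le P l f zs (rev (word o N)) -> gen le P l f zs (rev (word o' N)).
Proof.
move=> lm; have lt_ne (k : nat) (y : bool) : l (k, ~~ y) <> l (k, y).
  by rewrite /l /=; case: y => // /esym.
elim: N zs => [//|N IH] zs; rewrite /= !rev_cat /= => h.
have : gen le P l f zs [:: (N, ~~ o' N), (N, o' N) & rev (word o N)].
  have [<- //|oo'] := eqVneq (o N) (o' N).
  have -> : o' N = ~~ o N by move: oo'; case: (o N); case: (o' N).
  by rewrite negbK; apply: gen_swap h; exact: lt_ne.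
by move=> /= [h1 [h2 h3]]; split => //; split => //; exact: IH.
Qed.

(* If [lam, mu] and [mu, lam] disagreed on some [theta], realizing them
   alternately would give an indiscernible sequence along which [theta]
   alternates. *)
Lemma limit_rcomm : lam <> mu -> rcomm K Dall lim B0 lam mu.
Proof.
move=> lm B e0 f0 sB B0B he hf psi lpsi psiB; apply: contrapT => npsi.
pose V := (bool * X)%type.
pose k (z : V + U) : X + U := match z with
  | inl (true, x) => inl x | inl (false, x) => inr (f0 x) | inr u => inr u end.
have [|theta [thetaE thetaB]] := @fmap_factor_in _ _ _ k
    [set z | if z is inr u then B u else True] psi.
  move=> [x|u] hv; first by exists (inl (true, x)).
  by have [Bu|[x _ <-]] := psiB _ hv; [exists (inr u)|exists (inl (false, x))].
have theta_psi a : sat (with_params a) psi <->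
    sat (with_params (fun v : V => (if v.1 then a else f0) v.2)) theta.
  by rewrite thetaE sat_fmap; apply: sat_eq_iff => -[[[] x]|u].
pose ent (h : nat -> V -> U) (t : nat * bool) (x : X) := h t.1 (t.2, x).
pose H N (h : nat -> V -> U) := exists o, chain Dall lim B (named l (ent h) (word o N)).
have [||N hN] := @NIP_alternation _ _ _ _ U_monster U_NIP V [set: V] H theta (@subsetT _ _).
- move=> N M h f [o ho] finc fN; exists (o \o f).
  have -> : named l (ent (fun i => h (f i))) (word (o \o f) M) =
      named l (ent h) [seq (f t.1, t.2) | t <- word (o \o f) M].
    by rewrite /named -map_comp.
  apply: chain_subset_sorted (@R_trans o) (R_irr o) _ (word_sorted o N) _ ho.
    rewrite sorted_pairwise; last exact: R_trans.
    rewrite pairwise_map; have := word_pairwise (o \o f) M.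
    apply: sub_in_pairwise (allss _) => t s; rewrite !mem_word => tM sM.
    rewrite /R /= => /orP[ts|/and3P[/eqP -> -> ->]]; last by rewrite eqxx orbT.
    by rewrite finc // ts.
  by move=> _ /mapP[t + ->]; rewrite !mem_word; exact: fN.
- move=> N h h' phi [o ho] [o' ho'] _.
  case: (P_Dedekind) => Psurj _ _ _; have [x0 _] := Psurj ord0.
  have [|f [gf _]] := gen_ex b_ind P_Dedekind l (fun _ => x0) (zs := [::]) (w := rev (word o N)).
    by rewrite cats0 rev_uniq.
  pose g (v : 'I_N * V) : (nat * bool) * X := ((val v.1, v.2.1), v.2.2).
  have tr h1 o1 : chain Dall lim B (named l (ent h1) (word o1 N)) ->
      sat (fun x : 'I_N * V => h1 x.1 x.2) phi <->
      sat (fun x => b (f x.1) x.2) (fmap g phi).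
    move=> c1; rewrite -(@limit_chain _ _ _ _ _ _ _ b_ind _ _ P_Dedekind _ l (rev (word o1 N)) [::] (ent h1) f (fmap g phi)).
    + by rewrite sat_fmap; apply: sat_eq_iff => -[i [y x]].
    + by rewrite cats0 rev_uniq.
    + by rewrite revK; exact: chain_mono c1.
    + by [].
    + exact: gen_word gf.
    + by move=> x; rewrite fv_fmap cats0 mem_rev mem_word => -[[i v] _ <-] /=.
  by move=> /(tr h o ho)/(tr h' o' ho').
(* In even pairs [lam] comes first, as for [e0] and [f0], and [theta] fails; in odd pairs [mu] comes
   first and [theta] holds. *)
pose o k := ~~ odd k.
have [e ce] := chain_exists U_monster limS sDall l sB (word_uniq o N).
pose h i (v : V) := e (i, v.1) v.2.
have eE : named l (ent h) (word o N) = named l e (word o N).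
  by apply: eq_map => -[i y].
case: (hN h); first by exists o; rewrite eE.
move=> i iN.
have ci : chain Dall lim B (named l e [:: (i, o i); (i, ~~ o i)]).
  apply: chain_subset_sorted (@R_trans o) (R_irr o) _ (word_sorted o N) _ ce.
    by rewrite /= /R /= ltnn !eqxx.
  by move=> t; rewrite mem_word !inE => /orP[] /eqP ->.
have sBe e1 : small K (B `|` e1 @` [set: X]) by apply: small_setU => //; exact: small_image.
have satB (s : U -> U) (a a' : V -> U) : automorphism s -> fixes B s ->
    (forall v, s (a v) = a' v) -> sat (with_params a) theta <-> sat (with_params a') theta.
  move=> sauto sf sa; rewrite -(sat_automorphism (with_params a) _ sauto).
  by apply: sat_ext => -[v|u] hv /=; [rewrite sa|rewrite sf //; exact: (thetaB _ hv)].
move: ci; rewrite /named /l /o; case: (odd i) => /= -[h1 [h2 _]].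
- split=> // _.
  have [s [sauto sf se]] := monster_homogeneous U_monster X_small sB
    (realizes_tp (limS mu) (realizes_mono (@subsetUl _ _ _) hf) h1).
  have := invariant_automorphism (limI (lam := lam)) sauto (fixes_sub B0B sf) lpsi.
  move=> /h2; rewrite params_map_params => /(_ _)/sat_fmap hh.
  have /hh : s @` params psi `<=` B `|` [set e (i, false) x | x in Dall mu].
    move=> _ [u /psiB [Bu|[x _ <-]] <-]; first by left; rewrite sf.
    by right; exists x => //; rewrite se.
  rewrite thetaE => /sat_fmap; apply: (iffLR (sat_ext _)) => -[[[] x]|u] hv //=.
    by rewrite /h /= se.
  by rewrite sf //; exact: (thetaB _ hv).
- split=> // hth; case: npsi; apply/theta_psi.
  pose e2 (t : nat * bool) := if t.2 then e0 else f0.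
  have c1 : chain Dall lim B (named l e [:: (i, true); (i, false)]) by split.
  have c2 : chain Dall lim B (named l e2 [:: (i, true); (i, false)]) by split.
  have [s [sauto sf se]] := chain_conj U_monster limS limI sDall sB B0B c1 c2.
  have sv v : s (h i v) = (if v.1 then e0 else f0) v.2.
    case: v => y x; rewrite /h /= (se (i, y)) // /e2 ?inE //=.
    by case: y; rewrite eqxx ?orbT.
  exact: (iffLR (satB _ _ _ sauto sf sv) hth).
Qed.

End Commutation.
End CutTypes.

(** * Insertion at the cuts in terms of chains of left limits *)

Section Insertion.
Variables (L : language) (K : Type) (U : structure L).
Variables (X I : Type) (le : rel I) (b : I -> X -> U).
Hypothesis b_ind : indiscernible_sequence K le b.
Variables (n : nat) (P : I -> 'I_n.+1) (P_Dedekind : Dedekind le P).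

Let le_linear : linear_order le. Proof. by case: b_ind. Qed.
Let b_indisc : indiscernible le b. Proof. by case: b_ind. Qed.
Let P_mono x y : le x y -> (P x <= P y)%N.
Proof. by case: P_Dedekind => _ h _ _; exact: h. Qed.

Notation lim := (limit_type b_ind P_Dedekind).
Notation B0 := (seq_params b).
Let Dall (lam : cut_side n) : set X := [set: X].

Definition left_side (i : 'I_n) : cut_side n := (i, false).

Lemma gen_closer (J : eqType) (l : J -> cut_side n) f zs w t :
  gen le P l f zs w -> t \in w -> closer le P (l t) (map f zs) (f t).
Proof.
elim: w zs => [//|s w IH] zs /= [h1 h2]; rewrite inE => /orP[/eqP ->//|tw].
by apply: closer_sub (IH _ h2 tw) => y hy; right.
Qed.

(** For any increasing choice of indices in the extended sequence, the inserted tuples can be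
    replaced by terms close to their cuts without changing the order pattern; [limit_chain] shows
    that the formula keeps its truth value. *)
Lemma chain_inserts (i0 : 'I_n) (a : 'I_n -> X -> U) :
  chain Dall lim B0 (named left_side a (enum 'I_n)) -> inserts le b P a [set: 'I_n].
Proof.
move=> ca; pose J : eqType := {classic (I + 'I_n)}.
pose e (z : J) : X -> U := match (z : I + 'I_n) with inl x => b x | inr i => a i end.
(* The side given to a term of the sequence is a placeholder: sides matter only for the elements of
   [w]. *)
pose l (z : J) : cut_side n :=
  match (z : I + 'I_n) with inl x => (i0, false) | inr i => (i, false) end.
pose w : seq J := [seq (inr i : J) | i <- rev (enum 'I_n)].
pose forget (u : I + {i : 'I_n | i \in [set: 'I_n]%SET}) : J :=
  match u with inl x => inl x | inr i => inr (sval i) end.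
have w_uniq : uniq w by rewrite map_inj_uniq ?rev_uniq ?enum_uniq // => i j [].
have cw : chain Dall lim B0 (named l e (rev w)).
  by move: ca; rewrite /named -map_rev revK -map_comp.
case: (P_Dedekind) => Psurj _ _ _; have [x0 _] := Psurj ord0.
have le_refl x : le x x by case: le_linear => _ _ tot; have := tot x x; rewrite orbb.
have key k (phi : formula L ('I_k * X)) (i : 'I_k -> I + {i : 'I_n | i \in [set: 'I_n]%SET}) :
    (forall u v : 'I_k, (u < v)%N -> ~~ insertion_le le P (i v) (i u)) ->
    exists i' : 'I_k -> I, (forall u v : 'I_k, (u < v)%N -> ~~ le (i' v) (i' u)) /\
      (sat (fun v => insertion b a (i v.1) v.2) phi <-> sat (fun v => b (i' v.1) v.2) phi).
  move=> iinc.
  pose zs : seq J := [seq z <- undup [seq forget (i u) | u <- enum 'I_k] | z \notin w].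
  have uwz : uniq (w ++ zs).
    rewrite cat_uniq w_uniq filter_uniq ?undup_uniq // andbT.
    by apply/hasPn => z; rewrite mem_filter => /andP[].
  pose f0 (z : J) : I := if (z : I + 'I_n) is inl x then x else x0.
  have [f [gf ff0]] := gen_ex b_ind P_Dedekind l f0 uwz.
  have inw j : (inr j : J) \in w.
    by rewrite map_f // mem_rev mem_enum.
  have inlw x : (inl x : J) \notin w by apply/mapP => -[].
  have zs_f x : (inl x : J) \in zs -> f (inl x) = x by move=> /ff0 <-.
  have zs_mem z : z \in zs -> exists x, z = inl x.
    by case: z => [x _|j]; [exists x|rewrite mem_filter inw].
  have in_zs u x : i u = inl x -> (inl x : J) \in zs.
    move=> iu; rewrite mem_filter inlw mem_undup; apply/mapP; exists u; rewrite ?mem_enum //.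
    by rewrite iu.
  have pat u v : le (f (forget (i u))) (f (forget (i v))) = insertion_le le P (i u) (i v).
    have cl j x : (inl x : J) \in zs ->
        le (f (inr j)) x = (j < P x)%N /\ le x (f (inr j)) = (P x <= j)%N.
      move=> xzs; have hx : List.In x (map f zs).
        by rewrite List.in_map_iff; exists (inl x); split; [exact: zs_f|exact/In_mem].
      have [-> ->] := closer_le b_ind P_Dedekind (gen_closer gf (inw j)) hx.
      exact: side_leE.
    have Pf j : P (f (inr j)) = j :> nat.
      by have [-> _] := gen_closer gf (inw j); rewrite /block /= addn0.
    case iu: (i u) => [x|[j jS]]; case iv: (i v) => [y|[j' j'S]] /=.
    - by rewrite (zs_f _ (in_zs _ _ iu)) (zs_f _ (in_zs _ _ iv)).
    - by rewrite (zs_f _ (in_zs _ _ iu)); have [] := cl j' x (in_zs _ _ iu).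
    - by rewrite (zs_f _ (in_zs _ _ iv)); have [] := cl j y (in_zs _ _ iv).
    - case: (ltngtP j j') => [jj'|j'j|/val_inj ->]; last exact: le_refl.
      + case: le_linear => _ _ tot; have := tot (f (inr j)) (f (inr j')).
        by case/orP => // /P_mono; rewrite !Pf leqNgt jj'.
      + by apply/negP => /P_mono; rewrite !Pf leqNgt j'j.
  exists (fun u => f (forget (i u))); split; first by move=> u v /iinc; rewrite pat.
  pose phi' := fmap (fun v : 'I_k * X => (forget (i v.1), v.2)) phi.
  transitivity (sat (fun x => e x.1 x.2) phi').
    by rewrite sat_fmap; apply: sat_eq_iff => -[u x] /=; rewrite /e; case: (i u).
  rewrite (@limit_chain _ _ _ _ _ _ _ b_ind _ _ P_Dedekind J l w zs e f phi' uwz cw) //.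
  - by rewrite sat_fmap.
  - move=> z zzs; have [x zx] := zs_mem z zzs; subst z.
    by rewrite /e zs_f.
  - move=> x; rewrite fv_fmap mem_cat => -[[u y] _ <-] /=.
    rewrite mem_filter mem_undup; case: (_ \in w) => //=.
    by apply/mapP; exists u; rewrite ?mem_enum.
move=> k phi; case: (b_indisc phi) => h; [left|right] => i /key => /(_ phi)[i' [i'inc E]].
  exact/E/h.
by move=> /E; exact: h.
Qed.

(** A formula of the limit type holds at a term [b t] beyond all terms of its block that the formula
    mentions. In the extended sequence [t] and the filler of the i-th cut then have the same order
    relations to all indices involved, so indiscernibility passes the formula to the filler. *)
Lemma inserts_chain (a : 'I_n -> X -> U) (S : {set 'I_n}) w :
  inserts le b P a S -> uniq w -> {subset w <= S} ->
  chain Dall lim B0 (named left_side a w).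
Proof.
move=> ins; elim/last_ind: w => [//|w i IH].
rewrite rcons_uniq -cats1 => /andP[iw uw] wS; rewrite named_cat chain_cat; split.
  by apply: IH => // j jw; apply: wS; rewrite mem_cat jw.
split => // psi lpsi psiB.
pose J := option (I + 'I_n).
pose k (z : J * X) : X + U := match z.1 with
  | None => inl z.2 | Some (inl x) => inr (b x z.2) | Some (inr j) => inr (a j z.2) end.
have [|phi [phiE phiw]] := @fmap_factor_in _ _ _ k
    [set z | if z.1 is Some (inr j) then j \in w else True] psi.
  move=> [x|u] hv; first by exists (None, x).
  have [[t [x <-]]|/supp_namedP[j [x [jw _ <-]]]] := psiB _ hv.
    by exists (Some (inl t), x).
  by exists (Some (inr j), x).
have [js [_ jsP]] := @fv_index L {classic J} X phi.
have [F FP] : exists F, forall x, (Some (inl x) : {classic J}) \in js -> List.In x F.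
  elim: (js) => [|z s [F FP]]; first by exists [::].
  case: z => [[x|j]|]; [exists (x :: F)|exists F|exists F] => y; rewrite inE;
    move=> /orP[/eqP // [->]|/FP h]; by [left|right|].
have [t [tc ht]] := limit_closer F lpsi.
have iS : i \in S by apply: wS; rewrite mem_cat mem_head orbT.
pose emb (z : J) (u : I + {i : 'I_n | i \in S}) : I + {i : 'I_n | i \in S} :=
  match z with
  | None => u | Some (inl x) => inl x
  | Some (inr j) => if insub j is Some j' then inr j' else u
  end.
pose ui : I + {i : 'I_n | i \in S} := inr (exist _ i iS).
have satE (v : X -> U) u : insertion b a u = v ->
    sat (with_params v) psi <-> sat (fun x => insertion b a (emb x.1 u) x.2) phi.
  move=> uv; rewrite phiE sat_fmap; apply: sat_ext => -[[[x|j]|] y] /= hy //.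
    have jS : j \in S by apply: wS; rewrite mem_cat (phiw _ hy).
    by rewrite /k /= insubT.
  by rewrite uv.
apply/(satE (a i) ui erefl).
move/(satE (b t) (inl t) erefl): ht.
apply: (indiscernible_pattern (f := fun z => emb z (inl t)) (f' := fun z => emb z ui)
  (insertion_le_linear S le_linear P_mono) ins).
have jS j y : fv phi (Some (inr j), y) -> (j \in S) /\ j <> i.
  move=> /phiw /= jw; split; first by apply: wS; rewrite mem_cat jw.
  by move=> ji; rewrite -ji jw in iw.
have Pt : P t = i :> nat by have [-> _] := tc; rewrite /block /= addn0.
have cl y : List.In y F -> le t y = (i < P y)%N /\ le y t = (P y <= i)%N.
  by move=> yF; have [-> ->] := closer_le b_ind P_Dedekind tc yF; exact: side_leE.
have le_refl x : le x x by case: le_linear => _ _ tot; have := tot x x; rewrite orbb.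
move=> [[[x|j]|] vx] [[[y|j']|] vy] hx hy; rewrite /emb /=.
- by [].
- by have [j'S _] := jS _ _ hy; rewrite insubT.
- by have [] := cl x (FP _ (jsP _ hx)).
- by have [jS' _] := jS _ _ hx; rewrite insubT.
- by have [j'S _] := jS _ _ hy; have [jS' _] := jS _ _ hx; rewrite !insubT.
- have [jS' ji] := jS _ _ hx; rewrite insubT /= Pt [(j <= i)%N]leq_eqVlt.
  by case: eqP => // /ord_inj /ji.
- by have [] := cl y (FP _ (jsP _ hy)).
- by have [j'S _] := jS _ _ hy; rewrite insubT /= Pt.
- by rewrite le_refl leqnn.
Qed.

End Insertion.

(** * Base change *)

Lemma suppP (L : language) (U : structure L) (Lam V : Type) (D : Lam -> set V)
    (w : seq (Lam * (V -> U))) u :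
  supp D w u <-> exists x, List.In x w /\ exists v, D x.1 v /\ x.2 v = u.
Proof.
elim: w => [|x w IH] /=; first by split=> // -[x []].
split=> [[[v Dv <-]|/IH[y [yw h]]]|[y [[<-|yw] h]]].
- by exists x; split; [left|exists v].
- by exists y; split => //; right.
- by left; case: h => v [Dv <-]; exists v.
- by right; apply/IH; exists y.
Qed.

Lemma Stype_extend (L : language) (U : structure L) (V : Type) (D : set V)
    (Sig : set (formula L (V + U))) :
  (forall phi, Sig phi -> vars phi `<=` D) ->
  (forall s, (forall phi, List.In phi s -> Sig phi) ->
    exists a : V -> U, forall phi, List.In phi s -> sat (with_params a) phi) ->
  exists p, Stype D [set: U] p /\ Sig `<=` p.
Proof.
move=> SD fin; pose Mod phi := [set a : V -> U | sat (with_params a) phi].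
have [|F [FU FSig]] := @ultra_ext (V -> U) (Mod @` Sig).
  move=> s hs.
  have [s' [hs' hs'']] : exists s', (forall phi, List.In phi s' -> Sig phi) /\
      (forall B, List.In B s -> exists2 phi, List.In phi s' & B = Mod phi).
    elim: s hs => [|B s IH] hs; first by exists [::].
    have [s' [h1 h2]] := IH (fun C h => hs C (or_intror h)).
    have [phi Sphi <-] := hs B (or_introl erefl).
    exists (phi :: s'); split=> [psi [<-|/h1]//|C [<-|/h2[psi]]].
      by exists phi => //; left.
    by exists psi => //; right.
  have [a ha] := fin s' hs'; exists a => B /hs''[phi /ha h ->] //.
exists [set phi | vars phi `<=` D /\ F (Mod phi)]; split; last first.
  by move=> phi Sphi; split; [exact: SD|apply: FSig; exact: imageP].
split.
- by move=> phi [h _]; split => //; exact: subsetT.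
- move=> phi vphi _; have [h|h] := in_ultra_setVsetC (Mod phi) FU; first by left.
  by right; split; [rewrite vars_Neg|].
- move=> G /finite_set_In[s sE] hG.
  have : F [set a | forall phi, List.In phi s -> sat (with_params a) phi].
    have : forall phi, List.In phi s -> F (Mod phi) by move=> phi /sE/hG[].
    elim: s {sE hG} => [|phi s IH] hs; first by apply: filterS filterT => t _ phi [].
    apply: filterS (filterI (hs phi (or_introl erefl)) (IH (fun psi h => hs psi (or_intror h)))).
    by move=> t [h1 h2] psi [<-|]; [exact: h1|exact: h2].
  by move=> /filter_ex[a ha]; exists a => phi /sE; exact: ha.
Qed.

Lemma pairwise_index (J : eqType) (w : seq J) : uniq w ->
  pairwise (fun i j => index i w < index j w)%N w.
Proof.
case: w => [//|x0 w0]; set w := x0 :: w0 => uw.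
by apply/(pairwiseP x0) => i j; rewrite !inE => iw jw ij; rewrite !index_uniq.
Qed.

Section BaseChange.
Variables (L : language) (T : set (sentence L)) (K : Type) (U : structure L).
Hypotheses (U_monster : monster K T U) (U_NIP : NIP U).
Let K_nat := monster_nat U_monster.
Variables (X I : Type) (X_small : small K [set: X]) (le : rel I) (b : I -> X -> U).
Hypothesis b_ind : indiscernible_sequence K le b.
Variables (n : nat) (P : I -> 'I_n.+1) (P_Dedekind : Dedekind le P).

Notation side := (cut_side n).
Notation lim := (limit_type b_ind P_Dedekind).
Notation B0 := (seq_params b).
Let Dall (lam : side) : set X := [set: X].
Let sDall lam : small K (Dall lam) := X_small.
Let limS : forall lam, Stype (Dall lam) [set: U] (lim lam) := Stype_limit b_ind P_Dedekind.
Let limI : forall lam, invariant_over B0 (lim lam) :=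
  @invariant_limit _ _ _ _ U_monster _ _ X_small _ _ b_ind _ _ P_Dedekind.
Let sB0 : small K B0 := small_seq_params U_monster X_small b_ind.
Let B0B0 : B0 `<=` B0 := @subset_refl _ _.
Let rc lam mu : lam <> mu -> rcomm K Dall lim B0 lam mu :=
  @limit_rcomm _ _ _ _ U_monster U_NIP _ _ X_small _ _ b_ind _ _ P_Dedekind lam mu.

Implicit Types s : seq ('I_n * (X -> U)).
Let lw s := [seq (left_side x.1, x.2) | x <- s].
Definition right_side (i : 'I_n) : side := (i, true).
Let rw s := [seq (right_side x.1, x.2) | x <- s].

Let supp_lw s u : supp Dall (lw s) u <-> exists x v, List.In x s /\ x.2 v = u.
Proof.
rewrite suppP; split=> [[x [+ [v [_ <-]]]]|[x [v [xs <-]]]].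
  by rewrite List.in_map_iff => -[y [<- ys]]; exists y, v.
exists (left_side x.1, x.2); split; last by exists v.
by rewrite List.in_map_iff; exists x.
Qed.

Let supp_rw s u : supp Dall (rw s) u <-> exists x v, List.In x s /\ x.2 v = u.
Proof.
rewrite suppP; split=> [[x [+ [v [_ <-]]]]|[x [v [xs <-]]]].
  by rewrite List.in_map_iff => -[y [<- ys]]; exists y, v.
exists (right_side x.1, x.2); split; last by exists v.
by rewrite List.in_map_iff; exists x.
Qed.

Let In_rev s x : List.In x (rev s) <-> List.In x s.
Proof.
elim: s => [|y s IH] //; rewrite rev_cons -cats1 List.in_app_iff IH /=.
by split=> [[|[]]|[]]; auto.
Qed.

(* The last item can be moved to the front, where, over [seq_params b] alone, a
   left limit is also a right limit. *)
Lemma chain_reverse s :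
  chain Dall lim B0 (lw s) -> chain Dall lim B0 (rw (rev s)).
Proof.
elim/last_ind: s => [//|s x IH]; rewrite -cats1 /lw map_cat -/(lw s) chain_cat.
move=> [/IH c [hx _]]; rewrite rev_cat /=.
have : chain Dall lim B0 (rw (rev s) ++ [:: (left_side x.1, x.2)]).
  rewrite chain_cat; split => //; split => //; apply: realizes_mono hx => u.
  move=> [Bu|/supp_rw[y [v [/In_rev ys <-]]]]; first by left.
  by right; apply/supp_lw; exists y, v.
move=> /(chain_blocks U_monster sDall sB0 B0B0) [].
  move=> y z; rewrite List.in_map_iff => -[y' [<- _]] [<-|//].
  by apply: rc.
by move=> h1 h2; split => //; exact: (limit_left_right U_monster X_small h1).
Qed.

(* Right limits over all of [a] leave room for [a] on the left side of the cuts,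
   and their type over [seq_params b] is that of [s]. *)
Lemma chain_refill s (a : 'I_n -> X -> U) : chain Dall lim B0 (lw s) ->
  exists sg, [/\ automorphism sg, fixes B0 sg &
    forall w, chain Dall lim B0 (named (@left_side n) a w) ->
      chain Dall lim (B0 `|` supp Dall (lw s)) (named (@left_side n) (fun i => sg \o a i) w)].
Proof.
move=> /chain_reverse; set s' := rev s => c.
case s'E : s' => [|x0 s''].
  exists id; split => //; first exact: automorphism_id.
  have -> : s = [::] by rewrite -[s]revK -/s' s'E.
  by move=> w; rewrite setU0.
pose l k := right_side (nth x0 s' k).1.
pose e0 k := (nth x0 s' k).2.
pose ks := iota 0 (size s').
have e0E : named l e0 ks = rw s'.
  rewrite /rw -[in RHS](mkseq_nth x0 s') /mkseq -map_comp.
  by apply: eq_map.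
rewrite -e0E in c.
pose Ba := B0 `|` [set u | exists i x, a i x = u].
have sBa : small K Ba.
  apply: small_setU => //; apply: (@small_sub _ _ _ (range (fun z : 'I_n * X => a z.1 z.2))).
    by move=> u [i [x <-]]; exists (i, x).
  apply: small_range; apply: smallT_prod => //; last exact/small_setT.
  exact: smallT_countType.
have [e1 c1] := chain_exists U_monster limS sDall l sBa (iota_uniq 0 (size s')).
have c1' : chain Dall lim B0 (named l e1 ks) by apply: chain_mono c1; left.
have [sg [sgauto sgf sge]] := chain_conj U_monster limS limI sDall sB0 B0B0 c1' c.
exists sg; split => // w cw.
have : chain Dall lim B0 (named (@left_side n) a w ++ named l e1 ks).
  rewrite chain_cat; split => //; apply: chain_mono c1 => u [Bu|/supp_namedP[i [x [_ _ <-]]]].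
    by left.
  by right; exists i, x.
move=> /(chain_blocks U_monster sDall sB0 B0B0) h.
have {}h : chain Dall lim B0 (named l e1 ks ++ named (@left_side n) a w).
  by apply: h => x y /In_named[t _ ->] /In_named[t' _ ->]; exact: rc.
move: h; rewrite chain_cat => -[_ /(chain_automorphism limI sgauto sgf)].
apply: chain_mono => u [Bu|/supp_lw[y [v [/In_rev ys <-]]]].
  by exists u; [left|exact: sgf].
have : supp Dall (rw s') (y.2 v) by apply/supp_rw; exists y, v.
rewrite -e0E => /supp_namedP[k [v' [kks _ <-]]]; rewrite -(sge k v' kks Logic.I).
by exists (e1 k v') => //; right; apply/supp_namedP; exists k, v'.
Qed.

Let V := ('I_n * X)%type.
Let unc (a : 'I_n -> X -> U) (v : V) := a v.1 v.2.

(** The formula follows from the restriction to [Bd] of the product of the left limit types along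
    the word. *)
Let valid Bd (z : seq 'I_n * formula L (V + U)) := [/\ uniq z.1,
  vars z.2 `<=` [set v | v.1 \in z.1] &
  forall e, chain Dall lim Bd (named (@left_side n) e z.1) -> sat (with_params (unc e)) z.2].

(* If no conjugate of [a] satisfied [th] in addition to [Ls], realizations of the
   word [w] coming from conjugates of [a] and from the limit types could be
   appended alternately to [s], and [th] would alternate along them. *)
Lemma base_change Bd a (Ls : seq (seq 'I_n * formula L (V + U))) s :
  small K Bd -> B0 `<=` Bd ->
  (forall z, List.In z Ls -> valid Bd z) ->
  (forall z, List.In z Ls -> chain Dall lim B0 (named (@left_side n) a z.1)) ->
  chain Dall lim B0 (lw s) ->
  exists sg, [/\ automorphism sg, fixes B0 sg,
    forall w, chain Dall lim B0 (named (@left_side n) a w) ->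
      chain Dall lim (B0 `|` supp Dall (lw s)) (named (@left_side n) (fun i => sg \o a i) w) &
    forall z, List.In z Ls -> sat (with_params (unc (fun i => sg \o a i))) z.2].
Proof.
move=> sBd B0Bd; elim: Ls s => [|[w th] Ls IH] s Lsv Lsa cs.
  by have [sg [h1 h2 h3]] := chain_refill a cs; exists sg; split.
(* The sequence [s] stays free in the induction on [Ls], because the hypothesis is applied after
   each extension of the alternating sequence. *)
have {}IH s' : chain Dall lim B0 (lw s') -> _ := IH s'
  (fun z h => Lsv z (or_intror h)) (fun z h => Lsa z (or_intror h)).
have [w_uniq th_vars th_valid] := Lsv _ (or_introl erefl).
have /= wa := Lsa _ (or_introl erefl).
apply: contrapT => nex.
pose ent (h : nat -> V -> U) (t : nat * 'I_n) (x : X) := h t.1 (t.2, x).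
pose l (t : nat * 'I_n) := left_side t.2.
pose word N : seq (nat * 'I_n) := [seq (k, i) | k <- iota 0 N, i <- w].
pose R (t t' : nat * 'I_n) := (t.1 < t'.1)%N ||
  (t.1 == t'.1) && (index t.2 w < index t'.2 w)%N.
have R_trans : transitive R.
  move=> [j y] [i x] [k z]; rewrite /R /= => /orP[ij|/andP[/eqP -> xy]] /orP[jk|].
  - by rewrite (ltn_trans ij jk).
  - by move=> /andP[/eqP <- _]; rewrite ij.
  - by rewrite jk.
  - by move=> /andP[-> yz]; rewrite (ltn_trans xy yz) orbT.
have R_irr : irreflexive R by move=> t; rewrite /R !ltnn andbF.
have mem_word N t : (t \in word N) = (t.1 < N)%N && (t.2 \in w).
  apply/allpairsP/andP => [[[k i] [/= ]]|[tN tw]].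
    by rewrite mem_iota /= => kN iw ->.
  by exists t; rewrite mem_iota tN tw; split => //; case: (t).
have word_pw f M : (forall i j, (i < j < M)%N -> (f i < f j)%N) ->
    pairwise R [seq (f t.1, t.2) | t <- word M].
  elim: M => [//|M IHM] finc.
  have wS : word M.+1 = word M ++ [seq (M, i) | i <- w].
    rewrite /word; have -> : iota 0 M.+1 = iota 0 M ++ [:: M] by rewrite -addn1 iotaD.
    by rewrite map_cat flatten_cat /= cats0.
  rewrite wS map_cat pairwise_cat IHM; last first.
    by move=> i j /andP[ij jM]; apply: finc; rewrite ij ltnW.
  apply/andP; split; last first.
    rewrite -map_comp pairwise_map; apply: sub_pairwise (pairwise_index w_uniq) => i j ij.
    by rewrite /R /= eqxx ij orbT.
  apply/allrelP => t t' /mapP[u + ->] /mapP[u' /mapP[i _ ->] ->] /=.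
  rewrite mem_word => /andP[uM _]; rewrite /R /= finc // uM /=.
  exact: ltnSn.
have word_id N : [seq (id t.1, t.2) | t <- word N] = word N.
  by rewrite -[RHS]map_id; apply: eq_map => -[].
have word_sorted N : sorted R (word N).
  by rewrite sorted_pairwise // -word_id; apply: (word_pw id) => i j /andP[].
have word_uniq N : uniq (word N) by exact: sorted_uniq R_trans R_irr _ (word_sorted N).
(* The base is [B0] and not [Bd]: conjugates of [a] are under control only over [B0] and the items
   before them, while the parameters of [th] are arbitrary. *)
pose H N h := chain Dall lim B0 (named l (ent h) (word N)).
have [||N hN] := @NIP_alternation _ _ _ _ U_monster U_NIP V [set v | v.1 \in w] H th th_vars.
- move=> N M h f ho finc fN; rewrite /H.
  have -> : named l (ent (fun i => h (f i))) (word M) =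
      named l (ent h) [seq (f t.1, t.2) | t <- word M].
    by rewrite /named -map_comp.
  apply: (chain_subset_sorted R_trans R_irr _ (word_sorted N) _ ho).
    by rewrite sorted_pairwise //; exact: word_pw.
  move=> _ /mapP[t + ->]; rewrite !mem_word => /andP[tM ->]; rewrite andbT.
  exact: fN.
- move=> N h h' phi c c' phiw.
  have [sg [sgauto sgf sge]] := chain_conj U_monster limS limI sDall sB0 B0B0 c c'.
  rewrite -(sat_automorphism _ _ sgauto); apply: (iffLR (sat_ext _)) => -[k [i x]] /phiw /= iw.
  by apply: (sge (val k, i) x) => //; rewrite mem_word ltn_ord.
- suff [h [hh halt]] : exists h, chain Dall lim B0 (lw s ++ named l (ent h) (word N)) /\
      forall i, (i < N)%N -> sat (with_params (h i)) th <-> odd i.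
    apply: (hN h) => //; move: hh; rewrite chain_cat => -[_].
    by apply: chain_mono; left.
  have [u0] := carrier_inhabited U.
  elim: N {hN} => [|N [h [hh halt]]].
    by exists (fun _ _ => u0); rewrite cats0.
  pose sN := s ++ [seq (t.2, ent h t) | t <- word N].
  have lwN : lw sN = lw s ++ named l (ent h) (word N).
    by rewrite /lw /sN map_cat -map_comp.
  suff [a' [ca' tha']] : exists a', chain Dall lim (B0 `|` supp Dall (lw sN)) (named (@left_side n) a' w) /\
      (sat (with_params (unc a')) th <-> odd N).
    exists (fun k => if k == N then unc a' else h k).
    have E : named l (ent (fun k => if k == N then unc a' else h k)) (word N.+1) =
        named l (ent h) (word N) ++ named (@left_side n) a' w.
      have wS : word N.+1 = word N ++ [seq (N, i) | i <- w].
        rewrite /word; have -> : iota 0 N.+1 = iota 0 N ++ [:: N] by rewrite -addn1 iotaD.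
        by rewrite map_cat flatten_cat /= cats0.
      rewrite wS named_cat; congr (_ ++ _).
        apply/eq_in_map => t; rewrite mem_word /ent => /andP[tN _].
        by rewrite (ltn_eqF tN).
      rewrite /named -map_comp; apply: eq_map => i /=.
      by rewrite /ent /= eqxx.
    split; first by rewrite E catA -lwN chain_cat; split => //; rewrite lwN.
    move=> i; rewrite ltnS leq_eqVlt => /orP[/eqP ->|iN]; first by rewrite eqxx.
    by rewrite (ltn_eqF iN); exact: halt.
  (* At odd places the limit types are realized over [Bd] too, so [th] holds by validity. At even
     places a conjugate of [a] satisfying [Ls] is appended; there [th] fails, since otherwise this
     conjugate would contradict [nex]. *)
  rewrite -lwN in hh; case oddN: (odd N).
    have sBN : small K (Bd `|` supp Dall (lw sN)) by apply: small_setU => //; exact: (small_supp U_monster sDall).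
    have [a' ca'] := chain_exists U_monster limS sDall (@left_side n) sBN w_uniq.
    exists a'; split; last by split => // _; apply: th_valid; apply: chain_mono ca'; left.
    by apply: chain_mono ca' => u [/B0Bd Bu|]; [left|right].
  have [sg [sgauto sgf sgc sgL]] := IH sN hh.
  exists (fun i => sg \o a i); split; first exact: sgc.
  split => // tha; case: nex; exists sg; split => //.
    move=> w' /sgc; apply: chain_mono; rewrite lwN supp_cat => u [Bu|su]; first by left.
    by right; left.
  by move=> z [<-|/sgL].
Qed.

End BaseChange.

(** * m-distality from determinacy *)

Section DeterminedDistal.
Variables (L : language) (T : set (sentence L)) (K : Type) (U : structure L).
Hypotheses (U_monster : monster K T U) (U_NIP : NIP U).
Let K_nat := monster_nat U_monster.
Variables (X I : Type) (X_small : small K [set: X]) (le : rel I) (b : I -> X -> U).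
Hypothesis b_ind : indiscernible_sequence K le b.
Variables (n : nat) (P : I -> 'I_n.+1) (P_Dedekind : Dedekind le P).

Notation side := (cut_side n).
Notation lim := (limit_type b_ind P_Dedekind).
Notation left := (@left_side n).
Notation B0 := (seq_params b).
Let Dall (lam : side) : set X := [set: X].
Let sDall lam : small K (Dall lam) := X_small.
Let limS : forall lam, Stype (Dall lam) [set: U] (lim lam) := Stype_limit b_ind P_Dedekind.
Let limI : forall lam, invariant_over B0 (lim lam) :=
  @invariant_limit _ _ _ _ U_monster _ _ X_small _ _ b_ind _ _ P_Dedekind.
Let sB0 : small K B0 := small_seq_params U_monster X_small b_ind.
Let rc lam mu : lam <> mu -> rcomm K Dall lim B0 lam mu :=
  @limit_rcomm _ _ _ _ U_monster U_NIP _ _ X_small _ _ b_ind _ _ P_Dedekind lam mu.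

Let V := ('I_n * X)%type.
Definition cut_vars (i : 'I_n) : set ('I_n * X) := [set v | v.1 = i].
Let D := cut_vars.

Let drop (z : V + U) : X + U := match z with inl v => inl v.2 | inr u => inr u end.
Let put (i : 'I_n) (z : X + U) : V + U :=
  match z with inl x => inl (i, x) | inr u => inr u end.

(* The left limit types at the cuts, in disjoint tuples of variables *)
Definition cut_type (i : 'I_n) : set (formula L (('I_n * X) + U)) :=
  [set phi | vars phi `<=` cut_vars i /\ lim (left i) (fmap drop phi)].

Let params_drop (phi : formula L (V + U)) : params (fmap drop phi) = params phi.
Proof.
apply/seteqP; split=> u; rewrite /params /= fv_fmap; last by exists (inr u).
by move=> [[v|u'] h //= [<-]].
Qed.

Let params_put i (phi : formula L (X + U)) : params (fmap (put i) phi) = params phi.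
Proof.
apply/seteqP; split=> u; rewrite /params /= fv_fmap; last by exists (inr u).
by move=> [[v|u'] h //= [<-]].
Qed.

Let sat_drop i (e : V -> U) (phi : formula L (V + U)) : vars phi `<=` D i ->
  sat (with_params (fun x => e (i, x))) (fmap drop phi) <-> sat (with_params e) phi.
Proof.
move=> vD; rewrite sat_fmap; apply: sat_ext => -[[j x]|u] //= hv.
by have <- : j = i by exact: (vD (j, x) hv).
Qed.

Let put_drop i (phi : formula L (X + U)) : fmap drop (fmap (put i) phi) = phi.
Proof.
by rewrite fmap_comp -[RHS]fmap_id; apply: fmap_ext => -[x|u].
Qed.

Lemma realizes_cut_type i B e :
  realizes_over (cut_type i) B e <-> realizes_over (lim (left i)) B (fun x => e (i, x)).
Proof.
split=> h phi.
  move=> lphi pB; have vD : vars (fmap (put i) phi) `<=` D i.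
    by move=> v; rewrite /vars /= fv_fmap => -[[x|u] _ //= [<-]].
  have := h (fmap (put i) phi); rewrite /cut_type /= put_drop params_put => hh.
  by have /(sat_drop _ vD) := hh (conj vD lphi) pB; rewrite put_drop.
by move=> [vD lphi] pB; apply/(sat_drop e vD); apply: h => //; rewrite params_drop.
Qed.

Lemma Stype_cut i : Stype (D i) [set: U] (cut_type i).
Proof.
have [u0] := carrier_inhabited U.
split.
- by move=> phi [h _]; split => //; exact: subsetT.
- move=> phi vD _; have [_ /(_ (fmap drop phi) (@subsetT _ _) (@subsetT _ _)) h _] := limS (left i).
  by case: h => h; [left|right; split; rewrite ?vars_Neg].
- move=> F /finite_set_In[s sE] hF.
  have [|a ha] := Stype_sat (limS (left i)) (s := [seq fmap drop phi | phi <- s]).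
    by move=> psi; rewrite List.in_map_iff => -[phi [<- /sE/hF[]]].
  exists (fun v => a v.2) => phi Fphi; have [vD _] := hF _ Fphi.
  apply/(sat_drop (fun v => a v.2) vD); apply: ha.
  by rewrite List.in_map_iff; exists phi; split => //; apply/sE.
Qed.

Lemma invariant_cut i : invariant_over B0 (cut_type i).
Proof.
apply: (automorphism_invariant U_monster sB0) => s phi sauto sf [vD lphi].
split; first by rewrite vars_map_params.
have := invariant_automorphism (@limI (left i)) sauto sf lphi.
by rewrite !fmap_comp (@fmap_ext _ _ _ _ (drop \o map_params s)) // => -[].
Qed.

Lemma small_cut_vars i : small K (D i).
Proof.
apply: (@small_sub _ _ _ (range (fun x : X => (i, x)))).
  by move=> [j x] ji; have -> : j = i := ji; exists x.
by apply: small_range; exact/small_setT.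
Qed.

Lemma cut_vars_eq i j v : D i v -> D j v -> i = j.
Proof. by move=> <- <-. Qed.

Let image_cut (e : V -> U) i : e @` D i = (fun x => e (i, x)) @` [set: X].
Proof.
apply/seteqP; split=> u.
  by move=> [[j x] ji <-]; have -> : j = i := ji; exists x.
by move=> [x _ <-]; exists (i, x).
Qed.

Lemma rcomm_cut i j : i <> j -> rcomm K D cut_type B0 i j.
Proof.
move=> ij B e f sB AB /realizes_cut_type he /realizes_cut_type; rewrite image_cut => hf.
apply/realizes_cut_type; rewrite image_cut.
by apply: (rc (lam := left i) (mu := left j)) he hf => // -[].
Qed.

Lemma chain_cut B e w : chain D cut_type B (named id (fun _ => e) w) <->
  chain Dall lim B (named left (fun i x => e (i, x)) w).
Proof.
elim: w B => [//|i w IH] B /=; rewrite realizes_cut_type IH image_cut //.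
Qed.

(** If [a] does not insert, some [phi] over [b] in the product of the left limits fails at [a]. A
    completion of [Sig] would agree with the product on all sets of [m] variables and yet contain
    the negation of [phi]. For finite satisfiability, base change provides a conjugate of [a] over
    [b]; there [phi] still fails, its parameters being fixed. *)
Lemma determined_inserts (m : nat) (a : 'I_n -> X -> U) : (m < n)%N ->
  commuting_products_determined m n K U ->
  (forall S : {set 'I_n}, #|S| = m -> inserts le b P a S) ->
  inserts le b P a [set: 'I_n].
Proof.
move=> mn det insS; have i0 : 'I_n by apply: Ordinal (leq_ltn_trans (leq0n m) mn).
apply: (@chain_inserts _ _ _ _ _ _ _ b_ind _ _ P_Dedekind i0 a); apply: contrapT => nch.
have Dtr := cut_vars_eq.
have [prS prA] := wproductS U_monster Stype_cut invariant_cut sB0 small_cut_vars (enum 'I_n).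
have prR B e (sB : small K B) (AB : B0 `<=` B) :
    realizes_over (wproduct K D cut_type (enum 'I_n)) B e <->
    chain D cut_type B (named id (fun _ => e) (enum 'I_n)).
  exact: (realizes_wproduct U_monster Stype_cut invariant_cut sB0 small_cut_vars Dtr e sB AB (enum_uniq _)).
have sW := small_wvars U_monster small_cut_vars.
pose ea (v : V) := a v.1 v.2.
have [phi [prphi phiB nphi]] : exists phi, [/\ wproduct K D cut_type (enum 'I_n) phi,
    params phi `<=` B0 & ~ sat (with_params ea) phi].
  apply: contrapT => n1; apply: nch; apply/(chain_cut B0 ea).
  apply/(prR B0 ea sB0 (@subset_refl _ _)).
  by move=> phi prphi phiB; apply: contrapT => n2; apply: n1; exists phi.
pose Sig := [set psi | psi = Neg phi \/ exists S : {set 'I_n}, [/\ #|S| = m,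
  wproduct K D cut_type (enum 'I_n) psi & vars psi `<=` wvars D (enum S)]].
have [||p' [p'S Sigp']] := @Stype_extend _ _ _ (wvars D (enum 'I_n)) Sig.
- move=> psi [->|[S [_ /(Stype_vars prS)//]]].
  by rewrite vars_Neg; exact: Stype_vars prS _ prphi.
- move=> s sSig.
  (* The finitely many formulas considered may have parameters outside [b], over which nothing is
     known about [a] itself. *)
  pose Bd := B0 `|` \bigcup_(psi in [set psi | List.In psi s]) params psi.
  have sBd : small K Bd.
    apply: small_setU => //; apply: small_finite => //.
    by apply: bigcup_finite; [exact: finite_In|move=> psi _; exact: finite_params].
  have B0Bd : B0 `<=` Bd by left.
  have [Ls [LsP sLs]] : exists Ls : seq (seq 'I_n * formula L (V + U)),
      (forall z, List.In z Ls -> exists S : {set 'I_n}, [/\ #|S| = m, z.1 = enum S,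
        wproduct K D cut_type (enum 'I_n) z.2, params z.2 `<=` Bd &
        vars z.2 `<=` wvars D (enum S)]) /\
      (forall psi, List.In psi s -> psi = Neg phi \/ exists z, List.In z Ls /\ z.2 = psi).
    have sBd' psi : List.In psi s -> params psi `<=` Bd.
      by move=> hpsi u hu; right; exists psi.
    elim: (s) sSig sBd' => [|psi s' IH] sSig sBd'; first by exists [::].
    have [Ls [h1 h2]] := IH (fun z h => sSig z (or_intror h)) (fun z h => sBd' z (or_intror h)).
    have [->|[S [Sm prpsi vpsi]]] := sSig psi (or_introl erefl).
      by exists Ls; split => // z [<-|/h2]; auto.
    exists ((enum S, psi) :: Ls); split=> [z [<-|/h1]//|z [<-|/h2[]]]; last 2 first.
    + by left.
    + by move=> [z' [z'L <-]]; right; exists z'; split => //; right.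
    + by exists S; split => //; exact: sBd' (or_introl erefl).
    + by right; exists (enum S, psi); split => //; left.
  have [||sg [sgauto sgf _ sgL]] := @base_change _ _ _ _ U_monster U_NIP _ _ X_small _ _ b_ind
      _ _ P_Dedekind Bd a Ls [::] sBd B0Bd _ _ Logic.I.
  + move=> z /LsP[S [Sm zS prz zB zv]]; split.
    * by rewrite zS enum_uniq.
    * by move=> v /zv [i iS vi]; rewrite /= zS; have -> : v.1 = i := vi.
    * move=> e ce.
      have [e1 he1] := Stype_realize U_monster prS (sW _) sBd.
      have /(prR _ _ sBd B0Bd) c1 := he1.
      have {}c1 : chain D cut_type Bd (named id (fun _ => e1) z.1).
        have e2 : z.1 = [seq i <- enum 'I_n | i \in S] by rewrite zS enumT.
        have /subseqP[msk _ e3] := filter_subseq (fun l => l \in S) (enum 'I_n).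
        by rewrite e2 e3 /named map_mask; exact: chain_mask.
      have c2 : chain D cut_type Bd (named id (fun _ => (fun v : V => e v.1 v.2)) z.1).
        by apply/chain_cut.
      have [s1 [s1auto s1f s1e]] := chain_conj U_monster Stype_cut invariant_cut small_cut_vars
        sBd B0Bd c1 c2.
      have : sat (with_params e1) z.2 by exact: he1.
      rewrite -(sat_automorphism _ _ s1auto); apply: (iffLR (sat_ext _)) => -[v|u] hv /=.
        have [i iS vi] := zv v hv; apply: (s1e i v) => //.
        by rewrite zS.
      by rewrite s1f //; exact: zB.
  + move=> z /LsP[S [Sm zS _ _ _]]; rewrite zS.
    apply: inserts_chain (insS S Sm) (enum_uniq _) _.
    by move=> i; rewrite mem_enum.
  exists (fun v => sg (a v.1 v.2)) => psi /sLs[->|[z [/sgL h <-]]]; last first.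
    by apply: sat_eq h => -[].
  move=> hphi; apply: nphi; rewrite -(sat_automorphism _ _ sgauto).
  apply: (iffLR (sat_ext _)) hphi => -[v|u] hv //=.
  by rewrite sgf //; exact: phiB.
have p'E : p' = wproduct K D cut_type (enum 'I_n).
  apply: (det V D cut_type).
  - exact: small_cut_vars.
  - by move=> i j _ _ [v [iv jv]]; exact: Dtr iv jv.
  - exact: Stype_cut.
  - by move=> i; exists B0; split => //; exact: invariant_cut.
  - move=> i j ij; apply: (rcomm_commute U_monster Stype_cut invariant_cut sB0 small_cut_vars Dtr ij).
    exact: rcomm_cut.
  - by rewrite -wvars_enumT.
  - move=> S Sm q qS qp psi qpsi; apply: Sigp'; right; exists S; split => //; first exact: qp.
    by rewrite wvars_enum; exact: Stype_vars qS _ qpsi.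
have : p' (Neg phi) by apply: Sigp'; left.
rewrite p'E => /(Stype_Neg prS (Stype_vars prS prphi)); exact.
Qed.

End DeterminedDistal.

Lemma determined_distal (L : language) (T : set (sentence L)) (K : Type)
    (U : structure L) (m : nat) : monster K T U -> NIP U ->
  commuting_products_determined m m.+1 K U -> m_distal m K U.
Proof.
move=> U_monster U_NIP det X G X_small _ I le b P b_ind _ P_Dedekind a nins.
apply: contrapT => /forallNP nS; apply: nins.
apply: (determined_inserts U_monster U_NIP X_small b_ind P_Dedekind (ltnSn m) det).
by move=> S Sm; apply: contrapT => h; apply: (nS S).
Qed.

Theorem theorem7p7 (L : language) (T : set (sentence L)) (K : Type)
    (U : structure L) (m : nat)
    (T_complete : complete_theory T) (T_infinite : has_infinite_model T)
    (U_monster : monster K T U) (U_NIP : NIP U) (m_gt0 : (0 < m)%N) :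
  (m_distal m K U <->
    (forall n : nat, (m < n)%N -> commuting_products_determined m n K U)) /\
  ((forall n : nat, (m < n)%N -> commuting_products_determined m n K U) <->
    commuting_products_determined m m.+1 K U).
Proof.
have distal_all : m_distal m K U ->
    forall n : nat, (m < n)%N -> commuting_products_determined m n K U.
  by move=> h n mn; exact: (distal_determined U_monster h mn).
have one_distal := determined_distal U_monster U_NIP (m := m).
split; split => h.
- exact: distal_all.
- by apply: one_distal; exact: h.
- exact: h.
- by apply: distal_all; exact: one_distal.
Qed.
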